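(* For every state $\rho_{AB}$ on a finite-dimensional system $\mathcal{H}_A\otimes\mathcal{H}_B$, $I^{(\infty)}_{b,\rm sym}(\rho_{AB})=2E^C_{\rm sq}(\rho_{AB})$.
   Context: Mutual information $I(X:Y)_\rho=S(X)+S(Y)-S(XY)$ (von Neumann entropies, base 2). An $n$-copy broadcast state of $\rho_{AB}$ is a state $\rho^{(n)}$ on $A_1B_1\cdots A_nB_n$ whose reduced state on each $A_kB_k$ equals $\rho_{AB}$; it is permutation-invariant if $\pi\rho^{(n)}\pi^{-1}=\rho^{(n)}$ for every permutation $\pi$ of the $n$ pairs $A_kB_k$. The symmetric broadcast regularization of mutual information is $I^{(\infty)}_{b,\rm sym}(\rho_{AB})=\lim_n\frac1n\min I(A_1\cdots A_n:B_1\cdots B_n)_{\rho^{(n)}}$, minimum over permutation-invariant $n$-copy broadcast states of $\rho_{AB}$. Classical squashed entanglement: $E^C_{\rm sq}(\rho_{AB})=\frac12\min\big(I(A:B\hat E)_\rho-I(A:\hat E)_\rho\big)$ over all extensions of $\rho_{AB}$ of the form $\sum_kp_k\rho^k_{AB}\otimes|k\rangle\langle k|_{\hat E}$ with $\sum_kp_k\rho^k_{AB}=\rho_{AB}$. *)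

(* Defs.v *)
From HB Require Import structures.
From mathcomp Require Import all_boot all_order all_algebra all_fingroup.
From mathcomp Require Import all_classical all_reals all_analysis.
From mathcomp.real_closed Require Import complex.
Set Implicit Arguments. Unset Strict Implicit. Unset Printing Implicit Defensive.
Import Order.TTheory GRing.Theory Num.Theory.
Local Open Scope ring_scope.
Local Open Scope complex_scope.
Local Open Scope ring_scope.

Section QInfo.
Variable R : realType.
Local Notation C := R[i].

(* Operators on the Hilbert space C^I, I a finite type (basis labels). *)
Definition op (I : finType) := I -> I -> C.

Definition adj (I : finType) (M : op I) : op I := fun i j => Num.conj (M j i).
Definition opmul (I : finType) (M N : op I) : op I :=
  fun i k => \sum_(j : I) M i j * N j k.
Definition id_op (I : finType) : op I := fun i j => if i == j then 1 else 0.
Definition diag_op (I : finType) (d : I -> R) : op I :=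
  fun i j => if i == j then (d i)%:C else 0.
Definition unitary (I : finType) (U : op I) : Prop := opmul (adj U) U = @id_op I.
Definition trace (I : finType) (M : op I) : C := \sum_(i : I) M i i.
Definition psd (I : finType) (M : op I) : Prop :=
  forall v : I -> C, 0 <= \sum_(i : I) \sum_(j : I) Num.conj (v i) * M i j * v j.
Definition is_state (I : finType) (M : op I) : Prop := psd M /\ trace M = 1.

Definition ptr2 (I J : finType) (M : op (I * J)%type) : op I :=
  fun i i' => \sum_(j : J) M (i, j) (i', j).
Definition ptr1 (I J : finType) (M : op (I * J)%type) : op J :=
  fun j j' => \sum_(i : I) M (i, j) (i, j').

Definition eta2 (x : R) : R := if 0 < x then - (x * (ln x / ln 2)) else 0.
Definition spectral_dec (I : finType) (M : op I) (d : I -> R) : Prop :=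
  exists U : op I, unitary U /\ M = opmul (opmul U (diag_op d)) (adj U).
Definition vN_entropy (I : finType) (M : op I) : R :=
  match pselect (exists d, spectral_dec M d) with
  | left H => \sum_(i : I) eta2 (projT1 (cid H) i)
  | right _ => 0
  end.

Definition mutinf (X Y : finType) (M : op (X * Y)%type) : R :=
  vN_entropy (ptr2 M) + vN_entropy (ptr1 M) - vN_entropy M.

Definition ncopy (n : nat) (A B : finType) : finType :=
  ({ffun 'I_n -> A} * {ffun 'I_n -> B})%type.

Definition upd (n : nat) (T : finType) (f : {ffun 'I_n -> T}) (k : 'I_n) (x : T)
  : {ffun 'I_n -> T} := [ffun i => if i == k then x else f i].

Definition marg_k (n : nat) (A B : finType) (S : op (ncopy n A B)) (k : 'I_n)
  : op (A * B)%type :=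
  fun ab ab' => \sum_(x : ncopy n A B | (x.1 k == ab.1) && (x.2 k == ab.2))
                  S x (upd x.1 k ab'.1, upd x.2 k ab'.2).

Definition is_broadcast (n : nat) (A B : finType) (rho : op (A * B)%type)
  (S : op (ncopy n A B)) : Prop :=
  is_state S /\ forall k : 'I_n, marg_k S k = rho.

Definition permx (n : nat) (A B : finType) (p : {perm 'I_n}) (x : ncopy n A B)
  : ncopy n A B := ([ffun i => x.1 (p i)], [ffun i => x.2 (p i)]).

Definition perm_invariant (n : nat) (A B : finType) (S : op (ncopy n A B)) : Prop :=
  forall (p : {perm 'I_n}) (x y : ncopy n A B), S (permx p x) (permx p y) = S x y.

Definition Ib_sym_n (A B : finType) (rho : op (A * B)%type) (n : nat) : R :=
  inf [set mutinf S | S in [set S : op (ncopy n A B) |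
                              perm_invariant S /\ is_broadcast rho S]].

Definition ptr_mid (A B E : finType) (M : op (A * (B * E))%type) : op (A * E)%type :=
  fun ae ae' => \sum_(b : B) M (ae.1, (b, ae.2)) (ae'.1, (b, ae'.2)).

Definition cq_ext (A B : finType) (m : nat) (p : 'I_m -> R) (rk : 'I_m -> op (A * B)%type)
  : op (A * (B * 'I_m))%type :=
  fun x y => if x.2.2 == y.2.2
             then (p x.2.2)%:C * rk x.2.2 (x.1, x.2.1) (y.1, y.2.1) else 0.

Definition is_cq_decomp (A B : finType) (rho : op (A * B)%type) (m : nat)
  (p : 'I_m -> R) (rk : 'I_m -> op (A * B)%type) : Prop :=
  [/\ forall k, 0 <= p k, \sum_(k < m) p k = 1, forall k, is_state (rk k)
    & forall x y, \sum_(k < m) (p k)%:C * rk k x y = rho x y].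

Definition Esq_C (A B : finType) (rho : op (A * B)%type) : R :=
  inf [set r : R | exists (m : nat) (p : 'I_m -> R) (rk : 'I_m -> op (A * B)%type),
         is_cq_decomp rho p rk /\
         r = (mutinf (cq_ext p rk) - mutinf (ptr_mid (cq_ext p rk))) / 2].

End QInfo.

(* Main.v *)
(** The conditional mutual informations in [Esq_C] are averages
    [\sum_k p_k I(A:B)_{rho_k}], so [2 * Esq_C rho] is the convex roof of the mutual
    information.

    On permutation-invariant states of [k] copies the entropy is almost linear.
    The permutation-invariant operators form an algebra of dimension polynomial in
    [k]; a maximal family of orthogonal projections [P_x] in it therefore has only
    poly([k]) members, and maximality makes each [P_x M P_x] a multiple of [P_x] for
    every invariant [M].  Comparing a state with the reference state
    [\sum_x P_x / (v tr P_x)], where [v] is the number of projections, shows that its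
    entropy differs from [\sum_x tr(P_x rho) log (tr P_x)] by at most [log v].

    Upper bound: for a decomposition [rho = \sum_k p_k rho_k], near-linearity applied
    to the broadcast state [\sum_k p_k rho_k^(tensor n)] gives
    [I <= n \sum_k p_k I(rho_k) + O(log n)].

    Lower bound: tensor products of these projections over blocks of [k] copies
    bound the mutual information of an [n]-copy state from below by [n / k] times a
    linear functional of its [k]-copy marginal, up to [O(n log k / k)].  By a
    quantum de Finetti theorem this marginal is close, for [n] large, to some
    [\sum_z p_z s_z^(tensor k)] with [\sum_z p_z s_z = rho], on which the
    functional is at least [k * 2 Esq_C rho - O(log k)].  *)
Require Import Defs.
From HB Require Import structures.
From mathcomp Require Import all_boot all_order all_algebra all_fingroup.
From mathcomp Require Import all_classical all_reals all_analysis.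
From mathcomp.real_closed Require Import complex.
From mathcomp Require Import ring lra.
Import Order.TTheory GRing.Theory Num.Theory numFieldNormedType.Exports.
Local Open Scope classical_set_scope.
Local Open Scope complex_scope.
Local Open Scope ring_scope.
Set Implicit Arguments. Unset Strict Implicit. Unset Printing Implicit Defensive.
Import Normc.

(** * Operators and functional calculus *)

Section OpAlgebra.
Variable R : realType.
Local Notation C := R[i].
Implicit Types I J : finType.

(** The obstacle is that near-linearity and de Finetti live at different scales. On all [n] copies
    the projections cost only [O(log n)], but the resulting functional sees the whole state, while
    de Finetti controls a marginal whose size [k] is fixed before [n] grows. Blocks reconcile the
    two: the functional then depends on the [k]-copy marginal alone, at the price of an error of
    order [log k / k] per copy. Hence the order of choices: [k] from [e], then the projections and
    the Lipschitz constant of the functional, then the accuracy asked of de Finetti, and [n] last.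
    Linearity also settles mixtures: the value at a mixture of product states is the average of the
    values at these, each within the loss of the true mutual information. Conditioning on
    measurement outcomes is chosen for de Finetti because averaging the conditional states of a
    further copy gives back the one-copy marginal exactly; the mixture is thus a decomposition of
    [rho] itself, and its average mutual information is compared with [Esq_C rho] directly. *)

Lemma op_ext I (M N : op R I) : (forall i j, M i j = N i j) -> M = N.
Proof. by move=> e; apply/funext=> i; apply/funext=> j. Qed.

Lemma opmulA I (M N P : op R I) :
  opmul M (opmul N P) = opmul (opmul M N) P.
Proof.
apply: op_ext => i j; rewrite /opmul.
under eq_bigr do rewrite mulr_sumr.
rewrite exchange_big; apply: eq_bigr => k _; rewrite mulr_suml.
by apply: eq_bigr => l _; rewrite mulrA.
Qed.

Lemma opmul1l I (M : op R I) : opmul (@id_op R I) M = M.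
Proof.
apply: op_ext => i j; rewrite /opmul (bigD1 i)//= /id_op eqxx mul1r big1 ?addr0//.
by move=> k /negPf ki; rewrite eq_sym ki mul0r.
Qed.

Lemma opmul1r I (M : op R I) : opmul M (@id_op R I) = M.
Proof.
apply: op_ext => i j; rewrite /opmul (bigD1 j)//= /id_op eqxx mulr1 big1 ?addr0//.
by move=> k /negPf kj; rewrite kj mulr0.
Qed.

Lemma adj_mul I (M N : op R I) : adj (opmul M N) = opmul (adj N) (adj M).
Proof.
apply: op_ext => i j; rewrite /adj /opmul rmorph_sum; apply: eq_bigr => k _.
by rewrite rmorphM mulrC.
Qed.

Lemma adjK I : involutive (@adj R I).
Proof. by move=> M; apply: op_ext => i j; rewrite /adj conjCK. Qed.

Lemma conj_real_complex (x : R) : Num.conj (x%:C : C) = x%:C.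
Proof. by rewrite -[LHS]/(conjc _) conjc_real. Qed.

Lemma adj_id I : adj (@id_op R I) = @id_op R I.
Proof.
by apply: op_ext => i j; rewrite /adj /id_op eq_sym; case: eqP; rewrite ?rmorph1 ?rmorph0.
Qed.

Lemma adj_diag I (d : I -> R) : adj (diag_op d) = diag_op d.
Proof.
apply: op_ext => i j; rewrite /adj /diag_op eq_sym; case: eqP => [->|_].
  by rewrite conj_real_complex.
by rewrite rmorph0.
Qed.

Lemma trace_mulC I (M N : op R I) : trace (opmul M N) = trace (opmul N M).
Proof.
rewrite /trace /opmul exchange_big; apply: eq_bigr => i _.
by apply: eq_bigr => j _; rewrite mulrC.
Qed.

Lemma mul_diagr I (M : op R I) (d : I -> R) i j :
  opmul M (diag_op d) i j = M i j * (d j)%:C.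
Proof.
rewrite /opmul (bigD1 j)//= /diag_op eqxx big1 ?addr0//.
by move=> k /negPf ->; rewrite mulr0.
Qed.

Lemma mul_diagl I (M : op R I) (d : I -> R) i j :
  opmul (diag_op d) M i j = (d i)%:C * M i j.
Proof.
rewrite /opmul (bigD1 i)//= /diag_op eqxx big1 ?addr0//.
by move=> k /negPf ki; rewrite eq_sym ki mul0r.
Qed.

Definition mx_of I (M : op R I) : 'M[C]_#|I| :=
  \matrix_(i, j) M (enum_val i) (enum_val j).
Definition of_mx I (A : 'M[C]_#|I|) : op R I :=
  fun i j => A (enum_rank i) (enum_rank j).

Lemma mx_ofK I : cancel (@mx_of I) (@of_mx I).
Proof. by move=> M; apply: op_ext => i j; rewrite /of_mx mxE !enum_rankK. Qed.

Lemma of_mxK I : cancel (@of_mx I) (@mx_of I).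
Proof. by move=> A; apply/matrixP => i j; rewrite mxE /of_mx !enum_valK. Qed.

Lemma mx_of_mul I (M N : op R I) : mx_of (opmul M N) = mx_of M *m mx_of N.
Proof.
apply/matrixP => i j; rewrite !mxE /opmul (reindex _ (onW_bij _ (enum_val_bij I))).
by apply: eq_bigr => k _; rewrite !mxE.
Qed.

Lemma of_mx_mul I (A B : 'M[C]_#|I|) : of_mx (A *m B) = opmul (of_mx A) (of_mx B).
Proof. by apply: (can_inj (@mx_ofK I)); rewrite mx_of_mul !of_mxK. Qed.

Lemma mx_of_id I : mx_of (@id_op R I) = 1%:M.
Proof.
apply/matrixP => i j; rewrite !mxE /id_op (inj_eq enum_val_inj).
by case: eqP.
Qed.

Lemma unitary_mulr I (U : op R I) : unitary U -> opmul U (adj U) = @id_op R I.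
Proof.
move=> hU; apply: (can_inj (@mx_ofK I)).
by rewrite mx_of_mul mx_of_id; apply: mulmx1C; rewrite -mx_of_mul hU mx_of_id.
Qed.

(** The spectral theorem for normal matrices, transported along [enum_rank]. The matrix version
    diagonalizes as [P^-1 D P], so the unitary sought here is the conjugate transpose of [P]. *)
Lemma spectral_dec_exists I (M : op R I) : adj M = M -> exists d, spectral_dec M d.
Proof.
move=> hM; set A := mx_of M.
have hA : A \is hermsymmx.
  rewrite is_hermitianmxE expr0 scale1r; apply/eqP/matrixP => i j.
  by rewrite !mxE -[in LHS]hM.
have Areal := hermitian_spectral_diag_real hA.
have/orthomx_spectralP := hermitian_normalmx hA.
have Pun := spectral_unitarymx A.
set P := spectralmx A; rewrite invmx_unitary//; move=> eA.
pose d i : R := complex.Re (spectral_diag A 0 (enum_rank i)).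
have eU : adj (of_mx (P ^t*)%sesqui) = of_mx P.
  by apply: op_ext => i j; rewrite /adj /of_mx !mxE conjCK.
exists d, (of_mx (P ^t*)%sesqui); split.
  rewrite /unitary eU; apply: (can_inj (@mx_ofK I)).
  by rewrite -of_mx_mul of_mxK mx_of_id; apply/unitarymxP.
rewrite eU; have -> : diag_op d = of_mx (diag_mx (spectral_diag A)).
  apply: op_ext => i j; rewrite /diag_op /of_mx !mxE (inj_eq enum_rank_inj) /d.
  case: eqP => //= _; rewrite mulr1n RRe_real //.
  by move/mxOverP : Areal; apply.
by rewrite -!of_mx_mul -eA mx_ofK.
Qed.

Lemma sum_delta (I : finType) (a : I) (F : I -> C) : \sum_i F i * (i == a)%:R = F a.
Proof.
rewrite (bigD1 a)//= eqxx mulr1 big1 ?addr0// => i /negPf ->.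
by rewrite mulr0.
Qed.

(** The test vector is [x e_a + y e_b]; written additively, it also covers [a = b]. *)
Lemma psd_pair I (M : op R I) a b (x y : C) : psd M ->
  0 <= Num.conj x * M a a * x + Num.conj x * M a b * y +
       Num.conj y * M b a * x + Num.conj y * M b b * y.
Proof.
move=> hM; apply: le_trans (hM (fun k => x * (k == a)%:R + y * (k == b)%:R)) _.
rewrite le_eqVlt; apply/orP; left; apply/eqP.
have S p q (F : I -> I -> C) :
    \sum_k \sum_l (k == p)%:R * ((l == q)%:R * F k l) = F p q.
  transitivity (\sum_k (\sum_l F k l * (l == q)%:R) * (k == p)%:R).
    apply: eq_bigr => k _; rewrite mulr_suml; apply: eq_bigr => l _; ring.
  by rewrite sum_delta sum_delta.
transitivity (\sum_k \sum_l
    ((k == a)%:R * ((l == a)%:R * (Num.conj x * M k l * x)) +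
     (k == a)%:R * ((l == b)%:R * (Num.conj x * M k l * y)) +
     (k == b)%:R * ((l == a)%:R * (Num.conj y * M k l * x)) +
     (k == b)%:R * ((l == b)%:R * (Num.conj y * M k l * y)))); last first.
  under eq_bigr do rewrite !big_split; rewrite !big_split /=.
  by rewrite !S.
apply: eq_bigr => k _; apply: eq_bigr => l _; rewrite rmorphD !rmorphM !rmorph_nat.
ring.
Qed.

(** Over the complex numbers [0 <= z] includes that [z] is real. Reality of the form at [e_i],
    [e_j], [e_i + e_j] and [e_i + 'i e_j] forces the two off-diagonal entries to be conjugate. *)
Lemma psd_adj I (M : op R I) : psd M -> adj M = M.
Proof.
move=> hM; apply: op_ext => i j; rewrite /adj.
have di := psd_pair i i 1 0 hM; have dj := psd_pair j j 1 0 hM.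
have h1 := psd_pair i j 1 1 hM; have h2 := psd_pair i j 1 'i%C hM.
move: di dj h1 h2; rewrite -![Num.conj _]/(conjc _).
case: (M i i) => a1 a2; case: (M j j) => b1 b2.
case: (M i j) => c1 c2; case: (M j i) => d1 d2.
rewrite !lecE /=; simpc => /=.
move=> /andP[/eqP p1 _] /andP[/eqP p2 _] /andP[/eqP p3 _] /andP[/eqP p4 _].
by apply/eqP; rewrite eq_complex /=; apply/andP; split; apply/eqP; lra.
Qed.

End OpAlgebra.

(** * Functional calculus, entropy and resolutions into projections *)

Section Entropy.
Variable R : realType.
Local Notation C := R[i].

Definition sandwich (I : finType) (U : op R I) (d : I -> R) : op R I :=
  opmul (opmul U (diag_op d)) (adj U).

(** In the two eigenbases the hypothesis reads [N i j * d j = e i * N i j], so each entry of [N]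
    vanishes or links equal eigenvalues, and [f] may be applied to both sides. [W = id] gives
    independence of the diagonalization; [U = V] gives commutation with spectral projections. *)
Lemma sandwich_intertwine (I : finType) (W U V : op R I) (d e : I -> R) (f : R -> R) :
  unitary U -> unitary V ->
  opmul W (sandwich U d) = opmul (sandwich V e) W ->
  opmul W (sandwich U (f \o d)) = opmul (sandwich V (f \o e)) W.
Proof.
move=> hU hV E; pose N := opmul (adj V) (opmul W U).
have hN : opmul N (diag_op d) = opmul (diag_op e) N.
  have := congr1 (fun X => opmul (adj V) (opmul X U)) E.
  by rewrite /sandwich /N -!opmulA hU opmul1r !opmulA hV opmul1l.
have hfN : opmul N (diag_op (f \o d)) = opmul (diag_op (f \o e)) N.
  apply: op_ext => i j; move/(congr1 (fun X => X i j)): hN.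
  rewrite !mul_diagr !mul_diagl => /eqP.
  rewrite [_ * N i j]mulrC -subr_eq0 -mulrBr mulf_eq0 => /orP[/eqP->|].
    by rewrite mul0r mulr0.
  by rewrite subr_eq0 => /eqP/complexI /= ->; rewrite mulrC.
have := congr1 (fun X => opmul V (opmul X (adj U))) hfN.
rewrite /N /sandwich -!opmulA (unitary_mulr hU) opmul1r !opmulA (unitary_mulr hV) opmul1l.
by [].
Qed.

Lemma sandwich_uniq (I : finType) (U V : op R I) (d e : I -> R) (f : R -> R) :
  unitary U -> unitary V -> sandwich U d = sandwich V e ->
  sandwich U (f \o d) = sandwich V (f \o e).
Proof.
move=> hU hV E.
have := @sandwich_intertwine _ (@id_op R I) _ _ d e f hU hV.
by rewrite !opmul1l !opmul1r; apply.
Qed.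

Lemma trace_sandwich (I : finType) (U : op R I) (d : I -> R) : unitary U ->
  trace (sandwich U d) = (\sum_i d i)%:C.
Proof.
move=> hU; rewrite /sandwich trace_mulC opmulA hU opmul1l /trace rmorph_sum.
by apply: eq_bigr => i _; rewrite /diag_op eqxx.
Qed.

Lemma eta2E (x : R) : eta2 x = - (x * ln x) / ln 2.
Proof.
rewrite /eta2; case: ltP => [_|/ln0 ->]; first by rewrite mulNr mulrA.
by rewrite mulr0 oppr0 mul0r.
Qed.

(** The definition picks some spectral decomposition by choice; the entropy is the trace of [eta2]
    of the operator, so every decomposition gives the same value. *)
Lemma vN_entropyE (I : finType) (M : op R I) (d : I -> R) :
  spectral_dec M d -> vN_entropy M = \sum_i eta2 (d i).
Proof.
move=> hd; rewrite /vN_entropy; case: pselect => [H|[]]; last by exists d.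
case: (cid H) => e /= [V [hV eV]]; case: hd => U [hU eU].
have E := sandwich_uniq (@eta2 R) hU hV (etrans (esym eU) eV).
by move/(congr1 (@trace R I)): E; rewrite !trace_sandwich// => /complexI.
Qed.

(** This is [ln y <= y - 1] at [y = t / x], multiplied by [x]. *)
Lemma gibbs (x t : R) : 0 <= x -> 0 < t -> - (x * ln x) <= - (x * ln t) + t - x.
Proof.
rewrite le_eqVlt => /predU1P[<-|x0] t0.
  by rewrite !mul0r !oppr0 addr0 add0r ltW.
have : ln (1 + (t / x - 1)) <= t / x - 1.
  by apply: le_ln1Dx; rewrite ltrBrDl subrr divr_gt0.
rewrite addrC subrK ln_div// -(ler_pM2l x0) !mulrBr mulrCA divff ?gt_eqF// !mulr1.
lra.
Qed.

(* Here [q x = tr (P_x rho)], [r x = tr P_x] and [w i x = <u_i, P_x u_i>] for an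
   eigenbasis [u_i] of [rho] with eigenvalues [d i]; the last hypothesis is what
   [P_x rho P_x = (q x / r x) P_x] says about eigenvectors.  The upper bound is
   Gibbs' inequality against the spectrum [1 / (#|X| r x)]. *)
Lemma entropy_estimate (I X : finType) (d : I -> R) (w : I -> X -> R) (q r : X -> R) :
  (forall i, 0 <= d i) -> \sum_i d i = 1 ->
  (forall i x, 0 <= w i x) -> (forall i, \sum_x w i x = 1) ->
  (forall x, \sum_i w i x = r x) -> (forall x, 0 < r x) ->
  (forall x, \sum_i d i * w i x = q x) ->
  (forall i x, r x * (d i * w i x) <= q x) ->
  `|\sum_i - (d i * ln (d i)) - \sum_x q x * ln (r x)| <= ln #|X|%:R.
Proof.
move=> d0 d1 w0 w1 wr r0 dq rdq.
have [i0 _] : exists i : I, True.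
  apply: contrapT => h; move: d1; rewrite big1 => [/eqP|i]; last by case: h; exists i.
  by rewrite eq_sym oner_eq0.
have v0 : 0 < #|X|%:R :> R.
  rewrite ltr0n lt0n; apply/negP => /eqP/card0_eq h.
  move: (w1 i0); rewrite big1 => [/eqP|x]; last by have := h x.
  by rewrite eq_sym oner_eq0.
have sq : \sum_x q x = 1.
  under eq_bigr do rewrite -dq; rewrite exchange_big -d1; apply: eq_bigr => i _.
  by rewrite -mulr_sumr w1 mulr1.
have q0 x : 0 <= q x by rewrite -dq; apply: sumr_ge0 => i _; rewrite mulr_ge0.
have q1 x : q x <= 1 by rewrite -sq (bigD1 x)//= lerDl sumr_ge0.
set v : R := #|X|%:R.
rewrite ler_norml; apply/andP; split.
- rewrite lerBrDl.
  have -> : \sum_i - (d i * ln (d i)) = \sum_i \sum_x - (d i * ln (d i)) * w i x.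
    by apply: eq_bigr => i _; rewrite -mulr_sumr w1 mulr1.
  (* Logarithm of the last hypothesis, weighted by [d i * w i x]. After summation the [ln (q x)]
     terms are dropped, since [q x <= 1] gives them a favourable sign, and each row [w i], being a
     probability vector on [v] points, costs at most [ln v]. *)
  have step i x : d i * w i x * ln (r x) - d i * w i x * ln (q x) + d i * (w i x * ln (w i x))
     <= - (d i * ln (d i)) * w i x.
    have := d0 i; rewrite le_eqVlt => /predU1P[<-|di]; first by rewrite !(mul0r, oppr0, addr0).
    have := w0 i x; rewrite le_eqVlt => /predU1P[<-|wi].
      by rewrite !(mulr0, mul0r, oppr0, addr0).
    have rdw : 0 < r x * (d i * w i x) by rewrite !mulr_gt0.
    have := rdq i x; rewrite -ler_ln ?posrE//; last exact: lt_le_trans (rdq i x).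
    rewrite lnM ?posrE ?mulr_gt0// lnM ?posrE//.
    rewrite -(ler_pM2l (mulr_gt0 di wi)); lra.
  apply: le_trans (ler_sum _ (fun i _ => ler_sum _ (fun x _ => step i x))).
  under [leRHS]eq_bigr do rewrite !big_split /=.
  rewrite !big_split /= exchange_big /= [X in _ + X + _]exchange_big /=.
  have -> : \sum_x \sum_i d i * w i x * ln (r x) = \sum_x q x * ln (r x).
    by apply: eq_bigr => x _; rewrite -mulr_suml dq.
  have h2 : 0 <= \sum_x \sum_i - (d i * w i x * ln (q x)).
    apply: sumr_ge0 => x _; rewrite sumrN -mulr_suml dq -mulrN.
    by rewrite mulr_ge0// oppr_ge0; apply: ln_le0; rewrite q1.
  have h3 : - ln v <= \sum_i \sum_x d i * (w i x * ln (w i x)).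
    rewrite -[- _]mul1r -d1 mulr_suml; apply: ler_sum => i _; rewrite -mulr_sumr.
    apply: ler_wpM2l => //; rewrite lerNl -sumrN.
    have vi : 0 < v^-1 by rewrite invr_gt0.
    apply: le_trans (ler_sum _ (fun x _ => gibbs (w0 i x) vi)) _.
    rewrite big_split /= big_split /= !sumrN -mulr_suml w1 sumr_const -mulr_natl divff ?gt_eqF//.
    by rewrite lnV ?posrE// mul1r opprK addrK.
  lra.
rewrite lerBlDr.
have -> : \sum_i - (d i * ln (d i)) = \sum_i \sum_x - (d i * ln (d i)) * w i x.
  by apply: eq_bigr => i _; rewrite -mulr_sumr w1 mulr1.
have t0 x : 0 < (v * r x)^-1 by rewrite invr_gt0 mulr_gt0.
have step i x : - (d i * ln (d i)) * w i x <=
    d i * w i x * (ln v + ln (r x)) + (v * r x)^-1 * w i x - d i * w i x.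
  have := ler_wpM2r (w0 i x) (gibbs (d0 i) (t0 x)).
  rewrite lnV ?posrE ?mulr_gt0// lnM ?posrE//; lra.
apply: le_trans (ler_sum _ (fun i _ => ler_sum _ (fun x _ => step i x))) _.
rewrite exchange_big /=.
have -> : \sum_x \sum_i (d i * w i x * (ln v + ln (r x)) + (v * r x)^-1 * w i x - d i * w i x)
  = \sum_x (q x * ln v + q x * ln (r x) + v^-1 - q x).
  apply: eq_bigr => x _; rewrite !big_split /= sumrN -mulr_suml -mulr_sumr dq wr mulrDr.
  by rewrite invfM -mulrA mulVf ?gt_eqF// mulr1.
rewrite !big_split /= sumrN sq -mulr_suml sq sumr_const -[v^-1 *+ _]mulr_natl divff ?gt_eqF//.
by rewrite mul1r addrK.
Qed.

(* [r x] is the rank of the projection [P x]. *)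
Definition resolution (I X : finType) (P : X -> op R I) (r : X -> R) :=
  [/\ forall x, adj (P x) = P x, forall x, opmul (P x) (P x) = P x,
      forall i j, \sum_x P x i j = @id_op R I i j,
      forall x, trace (P x) = (r x)%:C & forall x, 0 < r x].

Definition compresses (I : finType) (P M : op R I) :=
  exists c, forall i j, opmul (opmul P M) P i j = c * P i j.

(** For [M = \sum_x q_x P_x / r_x] this is the entropy of [M] without the Shannon entropy of [q];
    leaving that term out makes the expression linear in [M]. *)
Definition lin_entropy (I X : finType) (P : X -> op R I) (r : X -> R) (M : op R I) : R :=
  \sum_x complex.Re (trace (opmul (P x) M)) * (ln (r x) / ln 2).

Lemma psd_spectral (I : finType) (M : op R I) : psd M ->
  exists U d, [/\ unitary U, M = opmul (opmul U (diag_op d)) (adj U) & forall i, 0 <= d i].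
Proof.
move=> psdM; have [d [U [hU eM]]] := spectral_dec_exists (psd_adj psdM).
exists U, d; split=> // i.
have : 0 <= opmul (opmul (adj U) M) U i i.
  have := psdM (fun k => U k i); rewrite exchange_big.
  by under [X in 0 <= X -> _]eq_bigr do rewrite -mulr_suml.
rewrite eM -!opmulA hU opmul1r opmulA hU opmul1l /diag_op eqxx.
by rewrite lecR.
Qed.

Lemma state_spectral (I : finType) (M : op R I) : is_state M ->
  exists U d, [/\ unitary U, M = opmul (opmul U (diag_op d)) (adj U),
    (forall i, 0 <= d i) & \sum_i d i = 1].
Proof.
move=> [/psd_spectral[U [d [hU eM d0]]] trM]; exists U, d; split=> //.
by apply: complexI; rewrite -(trace_sandwich _ hU) /sandwich -eM trM.
Qed.

Lemma sum_real_complex (I : finType) (f : I -> R) :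
  (\sum_i f i)%:C = \sum_i (f i)%:C :> C.
Proof. by rewrite rmorph_sum. Qed.

Lemma real_complexM (x y : R) : (x * y)%:C = x%:C * y%:C :> C.
Proof. by rewrite rmorphM. Qed.

Lemma normsq_real (z : C) : Num.conj z * z = (complex.Re (Num.conj z * z))%:C /\
  0 <= complex.Re (Num.conj z * z).
Proof.
case: z => a b; rewrite -[Num.conj _]/(conjc _) /=; simpc => /=; split.
  by apply/eqP; rewrite eq_complex /= eqxx /=; apply/eqP; ring.
have := sqr_ge0 a; have := sqr_ge0 b; lra.
Qed.

Lemma ln2_gt0 : 0 < ln (2 : R).
Proof. by apply: ln_gt0; rewrite ltr1n. Qed.

Lemma entropy_lin (I X : finType) (P : X -> op R I) (r : X -> R) (M : op R I) :
  is_state M -> resolution P r -> (forall x, compresses (P x) M) ->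
  `|vN_entropy M - lin_entropy P r M| <= ln #|X|%:R / ln 2.
Proof.
move=> sM [Padj Pid Psum Ptr r0] cM.
have [U [d [hU eM d0 d1]]] := state_spectral sM.
pose W x := opmul (adj U) (opmul (P x) U).
have WP x : W x = opmul (adj (opmul (P x) U)) (opmul (P x) U).
  by rewrite adj_mul Padj -opmulA [opmul (P x) (opmul _ _)]opmulA Pid.
have Wadj x : adj (W x) = W x by rewrite WP adj_mul adjK.
pose w i x := complex.Re (W x i i).
have wE i x : W x i i = (w i x)%:C /\ 0 <= w i x.
  rewrite /w WP.
  have -> : opmul (adj (opmul (P x) U)) (opmul (P x) U) i i =
     (\sum_j complex.Re (Num.conj (opmul (P x) U j i) * opmul (P x) U j i))%:C.
    by rewrite rmorph_sum; apply: eq_bigr => j _; exact: (normsq_real _).1.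
  by split => //=; apply: sumr_ge0 => j _; case: (normsq_real (opmul (P x) U j i)).
have trq x : trace (opmul (P x) M) = (\sum_i d i * w i x)%:C.
  have -> : opmul (P x) M = opmul (opmul (P x) (opmul U (diag_op d))) (adj U).
    by rewrite eM !opmulA.
  rewrite trace_mulC opmulA opmulA -[opmul (opmul _ _) U]opmulA -/(W x) sum_real_complex.
  by apply: eq_bigr => i _; rewrite mul_diagr (wE i x).1 rmorphM mulrC.
have wr x : \sum_i w i x = r x.
  apply: complexI; rewrite -Ptr -[P x]opmul1r -(unitary_mulr hU) opmulA trace_mulC -/(W x).
  by rewrite sum_real_complex; apply: eq_bigr => i _; rewrite (wE i x).1.
have w1 i : \sum_x w i x = 1.
  apply: complexI; rewrite sum_real_complex.
  under eq_bigr do rewrite -(wE i _).1.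
  rewrite /W /opmul exchange_big /=.
  under eq_bigr do rewrite -mulr_sumr exchange_big /=.
  under eq_bigr do under eq_bigr do rewrite -mulr_suml Psum /id_op.
  have -> : (1%:C : C) = opmul (adj U) U i i by rewrite hU /id_op eqxx.
  rewrite /opmul.
  apply: eq_bigr => j _; congr (_ * _); rewrite (bigD1 j)//= eqxx mul1r big1 ?addr0// => k.
  by rewrite eq_sym => /negPf ->; rewrite mul0r.
(* With [P_x M P_x = c P_x], taking traces gives [c = q_x / r_x]. In the eigenbasis of [M] the same
   identity has diagonal entry [\sum_j d_j |W_ij|^2 = c w_i]; keeping only [j = i] yields
   [d_i w_i <= c]. *)
have key i x : r x * (d i * w i x) <= \sum_i d i * w i x.
  have [c hc] := cM x.
  have trc : trace (opmul (P x) M) = c * trace (P x).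
    rewrite -{1}[P x]Pid -opmulA trace_mulC /trace mulr_sumr.
    by apply: eq_bigr => j _; rewrite hc.
  rewrite trq Ptr in trc.
  have cE : c = ((\sum_i d i * w i x) / r x)%:C.
    by rewrite real_complexM trc -mulrA -real_complexM mulfV ?gt_eqF// mulr1.
  have WDW : opmul (opmul (W x) (diag_op d)) (W x) i i = c * W x i i.
    have -> : opmul (opmul (W x) (diag_op d)) (W x) =
        opmul (adj U) (opmul (opmul (opmul (P x) M) (P x)) U).
      by rewrite eM /W !opmulA.
    rewrite /W /opmul mulr_sumr; apply: eq_bigr => j _; rewrite mulrCA; congr (_ * _).
    by rewrite mulr_sumr; apply: eq_bigr => k _; rewrite mulrA -hc.
  have : c * W x i i = (\sum_j d j * complex.Re (Num.conj (W x j i) * W x j i))%:C.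
    rewrite -WDW {1}/opmul sum_real_complex; apply: eq_bigr => j _.
    have Wij : W x i j = Num.conj (W x j i) by rewrite -{1}[W x]Wadj.
    rewrite mul_diagr Wij mulrAC mulrC real_complexM; congr (_ * _).
    exact: (normsq_real _).1.
  rewrite (wE i x).1 cE -real_complexM => /complexI E.
  have /= [_ w0] := wE i x.
  move: (w0); rewrite le_eqVlt => /predU1P[<-|wi].
    rewrite !mulr0; apply: sumr_ge0 => j _.
    by rewrite mulr_ge0//; case: (wE j x).
  have : d i * (w i x * w i x) <= (\sum_j d j * w j x) / r x * w i x.
    rewrite E (bigD1 i)//= (wE i x).1 conj_real_complex -real_complexM /= lerDl.
    apply: sumr_ge0 => j _; rewrite mulr_ge0//.
    by case: (normsq_real (W x j i)).
  rewrite mulrA (ler_pM2r wi) ler_pdivlMr// [_ * r x]mulrC.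
  by [].
have w0 i x : 0 <= w i x by case: (wE i x).
have := entropy_estimate d0 d1 w0 w1 wr r0 (fun x => erefl) key.
have -> : \sum_i - (d i * ln (d i)) = ln 2 * vN_entropy M.
  rewrite (@vN_entropyE _ M d); last by exists U.
  rewrite mulr_sumr; apply: eq_bigr => i _; rewrite eta2E.
  by rewrite mulrCA divff ?mulr1// gt_eqF// ln2_gt0.
have -> : \sum_x (\sum_i d i * w i x) * ln (r x) = ln 2 * lin_entropy P r M.
  rewrite /lin_entropy mulr_sumr; apply: eq_bigr => x _; rewrite trq /=.
  by rewrite mulrCA [ln 2 * _]mulrC divfK// gt_eqF// ln2_gt0.
rewrite -mulrBr normrM gtr0_norm ?ln2_gt0// mulrC -ler_pdivlMr ?ln2_gt0//.
Qed.

End Entropy.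

(** * Minimal projections of an invariance algebra *)

Section SymmetricAlgebra.
Variable R : realType.
Local Notation C := R[i].

Definition opadd (I : finType) (M N : op R I) : op R I := fun i j => M i j + N i j.
Definition opscale (I : finType) (c : C) (M : op R I) : op R I := fun i j => c * M i j.
Definition op0 (I : finType) : op R I := fun _ _ => 0.

Lemma opmulDl (I : finType) (M N P : op R I) :
  opmul (opadd M N) P = opadd (opmul M P) (opmul N P).
Proof.
apply: op_ext => i j; rewrite /opadd /opmul -big_split; apply: eq_bigr => k _.
by rewrite mulrDl.
Qed.

Lemma opmulDr (I : finType) (M N P : op R I) :
  opmul P (opadd M N) = opadd (opmul P M) (opmul P N).
Proof.
apply: op_ext => i j; rewrite /opadd /opmul -big_split; apply: eq_bigr => k _.
by rewrite mulrDr.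
Qed.

Lemma opscaleAl (I : finType) c (M P : op R I) :
  opmul (opscale c M) P = opscale c (opmul M P).
Proof.
apply: op_ext => i j; rewrite /opscale /opmul mulr_sumr; apply: eq_bigr => k _.
by rewrite mulrA.
Qed.

Lemma opscaleAr (I : finType) c (M P : op R I) :
  opmul P (opscale c M) = opscale c (opmul P M).
Proof.
apply: op_ext => i j; rewrite /opscale /opmul mulr_sumr; apply: eq_bigr => k _.
by rewrite mulrCA.
Qed.

Lemma opmul0l (I : finType) (M : op R I) : opmul (@op0 I) M = @op0 I.
Proof. by apply: op_ext => i j; apply: big1 => k _; rewrite mul0r. Qed.

Lemma opmul0r (I : finType) (M : op R I) : opmul M (@op0 I) = @op0 I.
Proof. by apply: op_ext => i j; apply: big1 => k _; rewrite mulr0. Qed.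

Lemma adj_add (I : finType) (M N : op R I) : adj (opadd M N) = opadd (adj M) (adj N).
Proof. by apply: op_ext => i j; rewrite /adj /opadd rmorphD. Qed.

Lemma adj_scale (I : finType) c (M : op R I) :
  adj (opscale c M) = opscale (Num.conj c) (adj M).
Proof. by apply: op_ext => i j; rewrite /adj /opscale rmorphM. Qed.

Definition opsub (I : finType) (M N : op R I) := opadd M (opscale (-1) N).

Lemma sandwich_adj (I : finType) (U : op R I) d : adj (sandwich U d) = sandwich U d.
Proof. by rewrite /sandwich !adj_mul adjK adj_diag opmulA. Qed.

Lemma sandwich_mul (I : finType) (U : op R I) d e : unitary U ->
  opmul (sandwich U d) (sandwich U e) = sandwich U (fun i => d i * e i).
Proof.
move=> hU; rewrite /sandwich -!opmulA [opmul (adj U) _]opmulA hU opmul1l.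
congr opmul; rewrite opmulA; congr opmul; apply: op_ext => i j.
rewrite mul_diagr /diag_op; case: eqP => [->|_]; last by rewrite mul0r.
by rewrite real_complexM.
Qed.

Section Algebra.
Variables (J : finType) (S : (J -> J) -> Prop).
Hypothesis Sbij : forall s, S s -> bijective s.

Definition invariant (M : op R J) := forall s, S s -> forall i j, M (s i) (s j) = M i j.

Lemma invariant_mul M N : invariant M -> invariant N -> invariant (opmul M N).
Proof.
move=> hM hN s Ss i j; rewrite /opmul (reindex s (onW_bij _ (Sbij Ss))).
by apply: eq_bigr => k _; rewrite hM// hN.
Qed.

Lemma invariant_adj M : invariant M -> invariant (adj M).
Proof. by move=> hM s Ss i j; rewrite /adj hM. Qed.

Lemma invariant_add M N : invariant M -> invariant N -> invariant (opadd M N).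
Proof. by move=> hM hN s Ss i j; rewrite /opadd hM// hN. Qed.

Lemma invariant_scale c M : invariant M -> invariant (opscale c M).
Proof. by move=> hM s Ss i j; rewrite /opscale hM. Qed.

Lemma invariant_id : invariant (@id_op R J).
Proof. by move=> s Ss i j; rewrite /id_op (inj_eq (bij_inj (Sbij Ss))). Qed.

(** Permuting the rows of [U] by [s] diagonalizes the same operator with the same eigenvalues, so
    uniqueness of the functional calculus applies. This keeps spectral projections inside the
    algebra. *)
Lemma invariant_sandwich (U : op R J) d f : unitary U ->
  invariant (sandwich U d) -> invariant (sandwich U (f \o d)).
Proof.
move=> hU hi s Ss i j.
pose V : op R J := fun i k => U (s i) k.
have eV e k l : sandwich U e (s k) (s l) = sandwich V e k l by [].
have hV : unitary V.
  rewrite /unitary -hU; apply: op_ext => k l.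
  by rewrite /opmul [RHS](reindex s (onW_bij _ (Sbij Ss))).
have E : sandwich V d = sandwich U d by apply: op_ext => k l; rewrite -eV hi.
by rewrite eV -[RHS]/(sandwich _ _ _ _); congr (_ _ _); apply: sandwich_uniq.
Qed.

Definition projection_family v (P : 'I_v -> op R J) :=
  [/\ forall x, invariant (P x), forall x, adj (P x) = P x /\ P x <> @op0 J,
      forall x, opmul (P x) (P x) = P x,
      forall x y, x != y -> opmul (P x) (P y) = @op0 J &
      forall i j, \sum_x P x i j = @id_op R J i j].

(* Nonzero orthogonal projections are linearly independent, and invariant operators
   are determined by their values on the [#|T|] labels. *)
Lemma projection_family_label (T : finType) (t : J -> J -> T) v (P : 'I_v -> op R J) :
  (forall M, invariant M -> forall i j k l, t i j = t k l -> M i j = M k l) ->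
  projection_family P -> (v <= #|T|)%N.
Proof.
move=> ht [Pinv Pne Pid Porth _].
pose G x (a : T) := if [pick ij | t ij.1 ij.2 == a] is Some ij then P x ij.1 ij.2 else 0.
have GE x i j : P x i j = G x (t i j).
  rewrite /G; case: pickP => [[k l] /= /eqP e|/(_ (i, j))]; last by rewrite /= eqxx.
  by apply: ht => //; apply: Pinv.
pose A : 'M[C]_(v, #|T|) := \matrix_(x, a) G x (enum_val a).
suff /eqP <- : row_free A by apply: rank_leq_col.
rewrite -kermx_eq0; apply/rowV0P => u /sub_kermxP uA.
have h i j : \sum_x u 0 x * P x i j = 0.
  move/matrixP/(_ 0 (enum_rank (t i j))): uA; rewrite !mxE => uA.
  by rewrite -[RHS]uA; apply: eq_bigr => x _; rewrite !mxE enum_rankK GE.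
apply/rowP => y; rewrite mxE; apply/eqP/negPn/negP => uy.
case: (Pne y) => _; apply; apply: op_ext => i k.
have : \sum_j (\sum_x u 0 x * P x i j) * P y j k = 0.
  by apply: big1 => j _; rewrite h mul0r.
under eq_bigr do rewrite mulr_suml.
rewrite exchange_big (bigD1 y)//= [X in _ + X]big1 ?addr0; last first.
  move=> x xy; under eq_bigr do rewrite -mulrA.
  by rewrite -mulr_sumr -[\sum_j _]/(opmul (P x) (P y) i k) Porth// mulr0.
under eq_bigr do rewrite -mulrA.
rewrite -mulr_sumr -[\sum_j _]/(opmul (P y) (P y) i k) Pid => /eqP.
by rewrite mulf_eq0 (negPf uy) /= => /eqP.
Qed.

(* If every spectral projection of [H], cut down by [P], were [0] or [P], then [H]
   would be a multiple of [P]. *)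
Lemma spectral_split (P H : op R J) : invariant P -> adj P = P -> opmul P P = P ->
  P <> @op0 J -> invariant H -> adj H = H -> opmul P H = H -> opmul H P = H ->
  ~ (exists c, H = opscale c P) ->
  exists Q, [/\ invariant Q, adj Q = Q, opmul Q Q = Q, opmul P Q = Q /\ opmul Q P = Q
     & Q <> @op0 J /\ Q <> P].
Proof.
move=> Pinv Padj Pid Pn0 Hinv Hadj PH HP Hns.
have [d [U [hU eH]]] := spectral_dec_exists Hadj.
rewrite -/(sandwich U d) in eH.
(* [F i] is the spectral projection of [H] for the eigenvalue [d i], repeated according to
   multiplicity. *)
pose F i := sandwich U ((fun y => (y == d i)%:R) \o d).
have Finv i : invariant (F i) by apply: invariant_sandwich => //; rewrite -eH.
have Fadj i : adj (F i) = F i by apply: sandwich_adj.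
have Fid i : opmul (F i) (F i) = F i.
  rewrite sandwich_mul//; congr sandwich; apply/funext => j /=.
  by case: eqP; rewrite ?mulr1 ?mulr0.
have PF i : opmul P (F i) = opmul (F i) P.
  by apply: sandwich_intertwine => //; rewrite -eH PH HP.
have FH i : opmul (F i) H = opscale (d i)%:C (F i).
  rewrite {1}eH sandwich_mul// /sandwich -opscaleAl -opscaleAr.
  congr opmul; congr opmul; apply: op_ext => k l; rewrite /opscale /diag_op /=.
  case: eqP => _; last by rewrite mulr0.
  by rewrite -real_complexM; case: eqP => [->|]; rewrite ?mulr1 ?mulr0 ?mul1r ?mul0r.
have [i Pi0] : exists i, opmul P (F i) <> @op0 J.
  apply: contrapT => h; apply: Pn0.
  rewrite -[P]opmul1r -(unitary_mulr hU) opmulA -[@op0 J](opmul0l (adj U)).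
  congr opmul; apply: op_ext => k i.
  have /(congr1 (fun X => opmul X U k i)) : opmul P (F i) = @op0 J.
    by apply: contrapT => h'; apply: h; exists i.
  rewrite opmul0l /op0 => <-.
  by rewrite /F /sandwich -!opmulA hU opmul1r !opmulA mul_diagr /= eqxx mulr1.
exists (opmul P (F i)); split.
- exact: invariant_mul.
- by rewrite adj_mul Padj Fadj PF.
- by rewrite {2}PF -opmulA [opmul (F i) _]opmulA Fid -PF opmulA Pid.
- by split; [rewrite opmulA Pid | rewrite PF -opmulA Pid].
split=> // Pi1; apply: Hns; exists (d i)%:C.
by rewrite -PH -{1}Pi1 -opmulA FH opscaleAr Pi1.
Qed.

(** [P x] is replaced by the pair [Q], [P x - Q]; the new index [ord0] carries [Q]. *)
Lemma projection_family_refine v (P : 'I_v -> op R J) x Q :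
  projection_family P -> invariant Q -> adj Q = Q -> opmul Q Q = Q ->
  opmul (P x) Q = Q -> opmul Q (P x) = Q -> Q <> @op0 J -> Q <> P x ->
  exists P' : 'I_v.+1 -> op R J, projection_family P'.
Proof.
move=> [Pinv Pne Pid Porth Psum] Qi Qa Qid PQ QP Q0 QPx.
pose P' (z : 'I_v.+1) := if unlift ord0 z is Some y then
  (if y == x then opsub (P x) Q else P y) else Q.
have QPy y : y != x -> opmul Q (P y) = @op0 J.
  by move=> yx; rewrite -QP -opmulA Porth ?opmul0r// eq_sym.
have PyQ y : y != x -> opmul (P y) Q = @op0 J.
  by move=> yx; rewrite -PQ opmulA Porth ?opmul0l.
have subE M : opsub M M = @op0 J.
  by apply: op_ext => i j; rewrite /opsub /opadd /opscale mulN1r subrr.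
have opmulBl M N K : opmul (opsub M N) K = opsub (opmul M K) (opmul N K).
  by rewrite /opsub opmulDl opscaleAl.
have opmulBr M N K : opmul K (opsub M N) = opsub (opmul K M) (opmul K N).
  by rewrite /opsub opmulDr opscaleAr.
have sub0 M : opsub M (@op0 J) = M.
  by apply: op_ext => i j; rewrite /opsub /opadd /opscale mulr0 addr0.
exists P'; split.
- move=> z; rewrite /P'; case: unliftP => [y _|_] //; case: eqP => // _.
  by apply: invariant_add => //; apply: invariant_scale.
- move=> z; rewrite /P'; case: unliftP => [y _|_] //; case: eqP => [_|_]; last exact: Pne.
  split.
    have [Pa _] := Pne x.
    apply: op_ext => i j; rewrite -{2}Pa -{2}Qa /adj /opsub /opadd /opscale.
    by rewrite rmorphD rmorphM rmorphN rmorph1.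
  move=> e; apply: QPx; apply: op_ext => i j.
  move/(congr1 (fun X => X i j)): e; rewrite /opsub /opadd /opscale /op0 mulN1r => /eqP.
  by rewrite subr_eq0 => /eqP.
- move=> z; rewrite /P'; case: unliftP => [y _|_] //; case: eqP => // _.
  by rewrite opmulBl !opmulBr Pid PQ QP Qid subE sub0.
- move=> z w; rewrite /P'; case: unliftP => [y ->|->]; case: unliftP => [y' ->|->]; last 1 first.
  + by rewrite eqxx.
  + rewrite (inj_eq lift_inj) => yy'; case: eqP => [e|]; case: eqP => [e'|].
    * by rewrite e e' eqxx in yy'.
    * by move=> /eqP y'x; rewrite opmulBl Porth 1?eq_sym// QPy// subE.
    * by move=> /eqP yx; rewrite opmulBr Porth// PyQ// subE.
    * by move=> _ _; apply: Porth.
  + move=> _; case: eqP => [_|/eqP yx]; last exact: PyQ.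
    by rewrite opmulBl PQ Qid subE.
  + move=> _; case: eqP => [_|/eqP yx]; last exact: QPy.
    by rewrite opmulBr QP Qid subE.
move=> i j; rewrite big_ord_recl -Psum /P' unlift_none (bigD1 x)//= [in RHS](bigD1 x)//=.
rewrite liftK eqxx addrA; congr (_ + _).
  by rewrite /opsub /opadd /opscale mulN1r addrC subrK.
by apply: eq_bigr => y yx; rewrite liftK (negPf yx).
Qed.

Lemma minimal_projections (T : finType) (t : J -> J -> T) : (0 < #|J|)%N ->
  (forall M, invariant M -> forall i j k l, t i j = t k l -> M i j = M k l) ->
  exists v (P : 'I_v -> op R J) (r : 'I_v -> R), [/\ resolution P r, (v <= #|T|)%N,
    forall x, invariant (P x) & forall x M, invariant M -> compresses (P x) M].
Proof.
move=> /card_gt0P[j0 _] ht.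
pose fam v := `[< exists P : 'I_v -> op R J, projection_family P >].
have ex : exists v, fam v.
  exists 1%N; apply/asboolP; exists (fun=> @id_op R J); split=> //.
  - by move=> x; exact: invariant_id.
  - move=> _; split; first exact: adj_id.
    move/(congr1 (fun X => X j0 j0)); rewrite /id_op /op0 eqxx => /eqP.
    by rewrite oner_eq0.
  - by move=> _; rewrite opmul1l.
  - by move=> x y; rewrite !ord1.
  - by move=> i j; rewrite big_ord1.
have ub v : fam v -> (v <= #|T|)%N.
  by move=> /asboolP[P hP]; exact: projection_family_label ht hP.
case: (ex_maxnP ex ub) => v /asboolP[P hP] vmax.
have [Pinv Pne Pid Porth Psum] := hP.
(* Otherwise the compression splits [P x], and the refined family contradicts the maximality of
   [v]. *)
have herm x M : invariant M -> adj M = M -> compresses (P x) M.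
  move=> Mi Ma; set H := opmul (opmul (P x) M) (P x).
  have [Pa Pn0] := Pne x.
  apply: contrapT => nc.
  have [|||||Q [Qi Qa Qid [PQ QP] [Q0 QP1]]] :=
    @spectral_split (P x) H (Pinv x) Pa (Pid x) Pn0.
  - by do 2?apply: invariant_mul.
  - by rewrite /H !adj_mul Pa Ma opmulA.
  - by rewrite /H !opmulA Pid.
  - by rewrite /H -!opmulA Pid.
  - by move=> [c e]; apply: nc; exists c => i j; rewrite -/H e.
  have [P' hP'] := projection_family_refine hP Qi Qa Qid PQ QP Q0 QP1.
  have /vmax : fam v.+1 by apply/asboolP; exists P'.
  by rewrite ltnn.
have tr x : exists r : R, trace (P x) = r%:C /\ 0 < r.
  have [Pa Pn0] := Pne x.
  (* The trace of a projection is its squared Hilbert-Schmidt norm, hence positive unless the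
     projection vanishes. *)
  exists (\sum_i \sum_j complex.Re (Num.conj (P x j i) * P x j i)); split.
    rewrite -[in LHS]Pid -[in LHS]Pa.
    rewrite sum_real_complex; apply: eq_bigr => i _.
    rewrite sum_real_complex; apply: eq_bigr => j _.
    rewrite Pa; rewrite -{1}Pa; exact: (normsq_real _).1.
  have ge0 i j := (normsq_real (P x j i)).2.
  rewrite lt_neqAle sumr_ge0 ?andbT; last by move=> i _; apply: sumr_ge0.
  apply/eqP => e; apply: Pn0; apply: op_ext => j i; apply/eqP.
  have := esym e; move/eqP; rewrite psumr_eq0; last by move=> k _; apply: sumr_ge0.
  move/allP/(_ i (mem_index_enum _)) => /=; rewrite psumr_eq0//.
  move/allP/(_ j (mem_index_enum _)) => /= /eqP e'.
  have := (normsq_real (P x j i)).1; rewrite e' => /eqP.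
  by rewrite mulf_eq0 conjC_eq0 orbb.
exists v, P, (fun x => projT1 (cid (tr x))); split=> //.
- split=> //.
  + by move=> x; case: (Pne x).
  + by move=> x; case: (projT2 (cid (tr x))).
  + by move=> x; case: (projT2 (cid (tr x))).
- exact: ub (introT (asboolP _) (ex_intro _ P hP)).
move=> x M Mi.
have [c1 h1] : compresses (P x) (opadd M (adj M)).
  apply: herm; first by apply: invariant_add => //; apply: invariant_adj.
  by rewrite adj_add adjK; apply: op_ext => i j; rewrite /opadd addrC.
have [c2 h2] : compresses (P x) (opscale 'i%C (opsub M (adj M))).
  apply: herm.
    apply: invariant_scale; apply: invariant_add => //.
    by apply: invariant_scale; apply: invariant_adj.
  rewrite /opsub adj_scale adj_add adj_scale adjK rmorphN rmorph1.
  rewrite -[Num.conj 'i%C]/(conjc 'i%C) /=; apply: op_ext => i j; rewrite /opscale /opadd.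
  have -> : (0 -i* 1)%C = - 'i%C :> C by apply/eqP; rewrite eq_complex /= oppr0 !eqxx.
  ring.
exists ((c1 - 'i%C * c2) / 2) => i j.
move: (h1 i j) (h2 i j).
rewrite /opsub opscaleAr opscaleAl !(opmulDr, opmulDl) opscaleAr opscaleAl.
rewrite /opscale /opadd; set a := opmul _ _ i j; set b := opmul _ _ i j => e1 e2.
have ii : 'i%C * 'i%C = -1 :> C by rewrite -expr2 sqr_i.
have : a *+ 2 = (c1 - 'i%C * c2) * P x i j.
  rewrite mulrBl -e1 -mulrA -e2 mulrA ii; ring.
move=> e; apply: (@mulIf _ (2 : C)); first by rewrite pnatr_eq0.
by rewrite -mulr_natr in e; rewrite e mulrAC divfK// pnatr_eq0.
Qed.

End Algebra.
End SymmetricAlgebra.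

(** * Permutations of tensor factors and joint types *)

Section PermutationAction.
Variable R : realType.
Local Notation C := R[i].

Definition actf (k : nat) (D : finType) (p : {perm 'I_k}) (f : {ffun 'I_k -> D}) :
  {ffun 'I_k -> D} := [ffun i => f (p i)].

Definition perm_sym k (D : finType) (s : {ffun 'I_k -> D} -> {ffun 'I_k -> D}) := exists p, s = actf p.

Lemma actf_bij k (D : finType) (p : {perm 'I_k}) : bijective (@actf k D p).
Proof.
exists (actf (p^-1)%g) => f; apply/ffunP => i; rewrite !ffunE; first by rewrite permKV.
by rewrite permK.
Qed.

Lemma perm_sym_bij k (D : finType) s : @perm_sym k D s -> bijective s.
Proof. by move=> [p ->]; apply: actf_bij. Qed.

Definition perm_inv k (D : finType) (M : op R {ffun 'I_k -> D}) :=
  forall p f g, M (actf p f) (actf p g) = M f g.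

Lemma perm_invP k (D : finType) (M : op R {ffun 'I_k -> D}) : perm_inv M -> invariant (@perm_sym k D) M.
Proof. by move=> hM s [p ->] f g; apply: hM. Qed.

Definition joint_type k (D : finType) (f g : {ffun 'I_k -> D}) : {ffun D * D -> 'I_k.+1} :=
  [ffun ab => inord (count_mem ab [tuple (f i, g i) | i < k])].

(* Pairs of words with the same joint type differ by a simultaneous permutation, so
   there are at most [k.+1 ^ (#|D| * #|D|)] orbits. *)
Lemma joint_typeP k (D : finType) (f g f' g' : {ffun 'I_k -> D}) :
  joint_type f g = joint_type f' g' -> exists p, f = actf p f' /\ g = actf p g'.
Proof.
move=> e.
have cnt (s : k.-tuple (D * D)) ab : (count_mem ab s < k.+1)%N.
  by rewrite ltnS -{2}(size_tuple s) count_size.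
have : perm_eq [tuple (f i, g i) | i < k] [tuple (f' i, g' i) | i < k].
  apply/allP => ab _ /=; apply/eqP.
  move/ffunP/(_ ab): e; rewrite !ffunE => /(congr1 (@nat_of_ord _)).
  by rewrite !inordK.

move=> /tuple_permP[p ep]; exists p.
have h i : (f i, g i) = (f' (p i), g' (p i)).
  have := congr1 (fun s => nth (f i, g i) s i) ep.
  by rewrite -!tnth_nth !tnth_mktuple.
by split; apply/ffunP => i; rewrite ffunE; case: (h i).
Qed.

Lemma sym_resolution k (D : finType) : (0 < #|D|)%N ->
  exists v (P : 'I_v -> op R {ffun 'I_k -> D}) (r : 'I_v -> R),
    [/\ resolution P r, (v <= k.+1 ^ (#|D| * #|D|))%N
      & forall x M, perm_inv M -> compresses (P x) M].
Proof.
move=> D0.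
have c0 : (0 < #|{ffun 'I_k -> D}|)%N by rewrite card_ffun expn_gt0 D0.
have [v [P [r [h1 h2 _ h4]]]] :=
  @minimal_projections R _ (@perm_sym k D) (@perm_sym_bij k D) _ (@joint_type k D) c0
  (fun M Mi i j i' j' e => let: ex_intro p (conj e1 e2) := joint_typeP e in
     eq_trans (f_equal2 M e1 e2) (Mi _ (ex_intro _ p erefl) i' j')).
exists v, P, r; split=> //.
  by move: h2; rewrite card_ffun card_prod card_ord.
by move=> x M Mi; apply: h4; apply: perm_invP.
Qed.

End PermutationAction.

(** * Tensor products and relabelling of bases *)

Section Tensor.
Variable R : realType.
Local Notation C := R[i].

Lemma sum_pair (J L : finType) (F : J * L -> C) :
  \sum_p F p = \sum_j \sum_l F (j, l).
Proof. by rewrite pair_bigA; apply: eq_bigr => -[]. Qed.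

Definition tens (J L : finType) (P : op R J) (Q : op R L) : op R (J * L)%type :=
  fun a b => P a.1 b.1 * Q a.2 b.2.

Lemma tens_mul (J L : finType) (P P' : op R J) (Q Q' : op R L) :
  opmul (tens P Q) (tens P' Q') = tens (opmul P P') (opmul Q Q').
Proof.
apply: op_ext => a b; rewrite /tens /opmul mulr_suml.
rewrite sum_pair.
apply: eq_bigr => j _; rewrite mulr_sumr; apply: eq_bigr => l _; ring.
Qed.

Lemma tens_adj (J L : finType) (P : op R J) (Q : op R L) :
  adj (tens P Q) = tens (adj P) (adj Q).
Proof. by apply: op_ext => a b; rewrite /adj /tens rmorphM. Qed.

Lemma trace_tens (J L : finType) (P : op R J) (Q : op R L) :
  trace (tens P Q) = trace P * trace Q.
Proof.
rewrite /trace /tens sum_pair mulr_suml.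
by apply: eq_bigr => j _; rewrite mulr_sumr.
Qed.

Lemma resolution_tens (J L X Y : finType) (P : X -> op R J) (Q : Y -> op R L) r s :
  resolution P r -> resolution Q s ->
  resolution (fun xy : X * Y => tens (P xy.1) (Q xy.2)) (fun xy => r xy.1 * s xy.2).
Proof.
move=> [a1 b1 c1 d1 e1] [a2 b2 c2 d2 e2]; split.
- by move=> x; rewrite tens_adj a1 a2.
- by move=> x; rewrite tens_mul b1 b2.
- move=> [i k] [j l]; rewrite /tens /=.
  rewrite sum_pair /=.
  under eq_bigr do rewrite -mulr_sumr.
  rewrite -mulr_suml c1 c2 /id_op xpair_eqE.
  by case: eqP; case: eqP; rewrite /= ?(mulr0, mul0r, mulr1).
- by move=> x; rewrite trace_tens d1 d2 real_complexM.
- by move=> x; rewrite mulr_gt0.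
Qed.

Definition slice (J L : finType) (M : op R (J * L)%type) (l l' : L) : op R J :=
  fun j j' => M (j, l) (j', l').

(** The partial trace over the first factor of [(a^T tensor 1) M]. Like [slice], it stays in the
    symmetric algebra of one factor when [M] is invariant under permutations of both. *)
Definition wslice (J L : finType) (M : op R (J * L)%type) (a : J -> J -> C) : op R L :=
  fun l l' => \sum_j \sum_j' a j j' * M (j, l) (j', l').

Lemma compresses_tens (J L : finType) (P : op R J) (Q : op R L) (M : op R (J * L)%type) :
  opmul P P = P -> trace P <> 0 ->
  (forall l l', compresses P (slice M l l')) ->
  (forall a, compresses Q (wslice M a)) -> compresses (tens P Q) M.
Proof.
move=> Pid Ptr hP hQ.
have hc l l' : exists c, forall i j, opmul (opmul P (slice M l l')) P i j = c * P i j.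
  exact: hP.
pose c l l' := projT1 (cid (hc l l')).
have cE l l' i j : opmul (opmul P (slice M l l')) P i j = c l l' * P i j.
  exact: (projT2 (cid (hc l l'))).
have ctr l l' : trace (opmul P (slice M l l')) = c l l' * trace P.
  rewrite -{1}Pid -opmulA trace_mulC /trace mulr_sumr.
  by apply: eq_bigr => j _; rewrite cE.
have [c' hc'] := hQ (fun j j' => P j' j / trace P).
exists c' => -[i l] [j l'].
have ew k k' : wslice M (fun j j' => P j' j / trace P) k k' = c k k'.
  have tP : trace P != 0 by apply/eqP.
  rewrite -[RHS](mulfK tP) -ctr /wslice /trace /opmul mulr_suml exchange_big.
  apply: eq_bigr => a _; rewrite mulr_suml; apply: eq_bigr => b _.
  by rewrite /slice mulrAC.
rewrite /tens /= mulrCA -hc' /opmul.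
under eq_bigr => a _ do rewrite mulr_suml.
rewrite sum_pair exchange_big /= mulr_sumr; apply: eq_bigr => y _.
rewrite mulr_suml mulr_sumr.
under eq_bigr => x _ do rewrite sum_pair exchange_big /=.
rewrite exchange_big /=; apply: eq_bigr => b _.
transitivity (Q l b * Q y l' * (c b y * P i j)); last by rewrite ew; ring.
rewrite -cE /opmul mulr_sumr; apply: eq_bigr => x _.
rewrite mulr_suml mulr_sumr; apply: eq_bigr => a _; rewrite /slice; ring.
Qed.

(** The logarithm of the product rank splits, and in each half the other family sums to the
    identity, which turns [M] into a marginal. Exact additivity needs no independence of the two
    factors. *)
Lemma lin_entropy_tens (J L X Y : finType) (P : X -> op R J) (Q : Y -> op R L) r s M :
  resolution P r -> resolution Q s ->
  lin_entropy (fun xy : X * Y => tens (P xy.1) (Q xy.2)) (fun xy => r xy.1 * s xy.2) M =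
  lin_entropy P r (ptr2 M) + lin_entropy Q s (ptr1 M).
Proof.
move=> [_ _ c1 d1 e1] [_ _ c2 d2 e2].
have ReD := raddf_sum (@complex.Re R : Rcomplex R -> R).
have tE x y : trace (opmul (tens (P x) (Q y)) M) =
    \sum_j \sum_l \sum_j' \sum_l' P x j j' * Q y l l' * M (j', l') (j, l).
  rewrite /trace /opmul sum_pair; apply: eq_bigr => j _; apply: eq_bigr => l _.
  by rewrite sum_pair.
have t1 x : \sum_y trace (opmul (tens (P x) (Q y)) M) = trace (opmul (P x) (ptr2 M)).
  under eq_bigr do rewrite tE.
  rewrite exchange_big; apply: eq_bigr => j _.
  rewrite exchange_big /=; under eq_bigr do rewrite exchange_big.
  rewrite exchange_big /opmul; apply: eq_bigr => j' _; rewrite /ptr2 mulr_sumr.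
  apply: eq_bigr => l _; rewrite exchange_big (bigD1 l)//= [X in _ + X]big1 ?addr0; last first.
    move=> l' l'l; rewrite -!mulr_suml -mulr_sumr c2 /id_op eq_sym (negPf l'l).
    by rewrite mulr0 mul0r.
  by rewrite -!mulr_suml -mulr_sumr c2 /id_op eqxx mulr1.
have t2 y : \sum_x trace (opmul (tens (P x) (Q y)) M) = trace (opmul (Q y) (ptr1 M)).
  under eq_bigr do rewrite tE.
  under eq_bigr do rewrite exchange_big.
  rewrite exchange_big; apply: eq_bigr => l _.
  rewrite exchange_big /=; under eq_bigr do under eq_bigr do rewrite exchange_big.
  under eq_bigr do rewrite exchange_big.
  rewrite exchange_big /opmul; apply: eq_bigr => l' _; rewrite /ptr1 mulr_sumr.
  apply: eq_bigr => j _; rewrite exchange_big (bigD1 j)//= [X in _ + X]big1 ?addr0; last first.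
    move=> j' j'j; rewrite -!mulr_suml c1 /id_op eq_sym (negPf j'j).
    by rewrite !mul0r.
  by rewrite -!mulr_suml c1 /id_op eqxx mul1r.
rewrite /lin_entropy.
rewrite -(pair_bigA _ (fun x y => complex.Re (trace (opmul (tens (P x) (Q y)) M)) *
  (ln (r x * s y) / ln 2))) /=.
have lnD x y : ln (r x * s y) / ln 2 = ln (r x) / ln 2 + ln (s y) / ln 2.
  by rewrite lnM ?posrE// mulrDl.
under eq_bigr do under eq_bigr do rewrite lnD mulrDr.
under eq_bigr do rewrite big_split.
rewrite big_split /=; congr (_ + _).
  by apply: eq_bigr => x _; rewrite -mulr_suml -t1 -ReD.
by rewrite exchange_big; apply: eq_bigr => y _; rewrite -mulr_suml -t2 -ReD.
Qed.

Definition pull (I J : finType) (h : I -> J) (M : op R J) : op R I :=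
  fun i i' => M (h i) (h i').

Section Pull.
Variables (I J : finType) (h : I -> J).
Hypothesis hb : bijective h.

Lemma pull_mul M N : opmul (pull h M) (pull h N) = pull h (opmul M N).
Proof.
by apply: op_ext => i j; rewrite /pull /opmul [RHS](reindex h (onW_bij _ hb)).
Qed.

Lemma trace_pull M : trace (pull h M) = trace M.
Proof. by rewrite /trace [RHS](reindex h (onW_bij _ hb)). Qed.

Lemma pull_id : pull h (@id_op R J) = @id_op R I.
Proof. by apply: op_ext => i j; rewrite /pull /id_op (inj_eq (bij_inj hb)). Qed.

Lemma pull_diag d : pull h (diag_op d) = diag_op (fun i => d (h i) : R).
Proof. by apply: op_ext => i j; rewrite /pull /diag_op (inj_eq (bij_inj hb)). Qed.

Lemma resolution_pull (X : finType) (P : X -> op R J) r :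
  resolution P r -> resolution (fun x => pull h (P x)) r.
Proof.
move=> [a b c d e]; split=> //.
- by move=> x; rewrite -{2}(a x).
- by move=> x; rewrite pull_mul b.
- by move=> i j; rewrite /pull c -pull_id.
- by move=> x; rewrite trace_pull d.
Qed.

Lemma compresses_pull P M : compresses P M -> compresses (pull h P) (pull h M).
Proof. by move=> [c hc]; exists c => i j; rewrite !pull_mul /pull hc. Qed.

Lemma lin_entropy_pull (X : finType) (P : X -> op R J) r M :
  lin_entropy (fun x => pull h (P x)) r (pull h M) = lin_entropy P r M.
Proof. by apply: eq_bigr => x _; rewrite pull_mul trace_pull. Qed.

Lemma is_state_pull M : is_state M -> is_state (pull h M).
Proof.
case: hb => g hK gK [psdM trM]; split; last by rewrite trace_pull.
move=> v; have := psdM (v \o g).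
rewrite (reindex h (onW_bij _ hb)) /=.
under eq_bigr do rewrite (reindex h (onW_bij _ hb)) /=.
by under eq_bigr do under eq_bigr do rewrite !hK.
Qed.

Lemma entropy_pull M : is_state M -> vN_entropy (pull h M) = vN_entropy M.
Proof.
move=> sM; have [U [d [hU eM _ _]]] := state_spectral sM.
rewrite (@vN_entropyE _ _ M d); last by exists U.
rewrite (@vN_entropyE _ _ _ (fun i => d (h i))).
  by rewrite [RHS](reindex h (onW_bij _ hb)).
exists (pull h U); split.
  by rewrite /unitary -[adj _]/(pull h (adj U)) pull_mul hU pull_id.
by rewrite -[adj _]/(pull h (adj U)) -pull_diag !pull_mul -eM.
Qed.

End Pull.

End Tensor.

(** * Blocks and marginals *)

Section Blocks.
Variable R : realType.
Local Notation C := R[i].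

Definition catf (k m : nat) (D : finType) (fg : {ffun 'I_k -> D} * {ffun 'I_m -> D}) :
  {ffun 'I_(k + m) -> D} :=
  [ffun i => match fintype.split i with inl a => fg.1 a | inr b => fg.2 b end].

Definition splitf (k m : nat) (D : finType) (f : {ffun 'I_(k + m) -> D}) :
  {ffun 'I_k -> D} * {ffun 'I_m -> D} :=
  ([ffun i => f (lshift m i)], [ffun i => f (rshift k i)]).

Lemma catf_l k m (D : finType) fg i : @catf k m D fg (lshift m i) = fg.1 i.
Proof. by rewrite ffunE (unsplitK (inl i)). Qed.

Lemma catf_r k m (D : finType) fg i : @catf k m D fg (rshift k i) = fg.2 i.
Proof. by rewrite ffunE (unsplitK (inr i)). Qed.

Lemma catfK k m (D : finType) : cancel (@catf k m D) (@splitf k m D).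
Proof.
by move=> [f g]; congr (_, _); apply/ffunP => i; rewrite ffunE ?catf_l ?catf_r.
Qed.

Lemma splitfK k m (D : finType) : cancel (@splitf k m D) (@catf k m D).
Proof.
by move=> f; apply/ffunP => i; rewrite -(splitK i); case: (fintype.split i) => j /=;
  rewrite ?catf_l ?catf_r /= ffunE.
Qed.

Lemma catf_bij k m (D : finType) : bijective (@catf k m D).
Proof. by exists (@splitf k m D); [apply: catfK|apply: splitfK]. Qed.

Lemma sum_cat k m (D : finType) (F : {ffun 'I_(k + m) -> D} -> C) :
  \sum_f F f = \sum_f \sum_g F (catf (f, g)).
Proof. by rewrite (reindex _ (onW_bij _ (@catf_bij k m D))) sum_pair. Qed.

Definition sum_perm_fun k m (p : {perm 'I_k}) (q : {perm 'I_m}) (i : 'I_(k + m)) : 'I_(k + m) :=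
  match fintype.split i with inl a => lshift m (p a) | inr b => rshift k (q b) end.

Lemma sum_perm_inj k m p q : injective (@sum_perm_fun k m p q).
Proof.
have l a : sum_perm_fun p q (lshift m a) = lshift m (p a).
  by rewrite /sum_perm_fun (unsplitK (inl a)).
have r a : sum_perm_fun p q (rshift k a) = rshift k (q a).
  by rewrite /sum_perm_fun (unsplitK (inr a)).
move=> i j; rewrite -(splitK i) -(splitK j).
case: (fintype.split i) => a; case: (fintype.split j) => b /=; rewrite ?l ?r.
- by move/lshift_inj/perm_inj ->.
- by move/eqP; rewrite eq_lrshift.
- by move/eqP; rewrite eq_rlshift.
- by move/rshift_inj/perm_inj ->.
Qed.

Lemma actf_cat k m (D : finType) (p : {perm 'I_k}) (q : {perm 'I_m})
    (f : {ffun 'I_k -> D}) (g : {ffun 'I_m -> D}) :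
  catf (actf p f, actf q g) = actf (perm (@sum_perm_inj k m p q)) (catf (f, g)).
Proof.
apply/ffunP => i; rewrite -(splitK i) [RHS]ffunE permE /sum_perm_fun.
case: (fintype.split i) => a; rewrite /unsplit ?catf_l ?catf_r /= ffunE.
  by rewrite (unsplitK (inl a)) catf_l.
by rewrite (unsplitK (inr a)) catf_r.
Qed.

Lemma actf1 k (D : finType) (f : {ffun 'I_k -> D}) : actf 1%g f = f.
Proof. by apply/ffunP => i; rewrite ffunE perm1. Qed.

Lemma perm_inv_slice k m (D : finType) (M : op R {ffun 'I_(k + m) -> D}) g g' :
  perm_inv M -> perm_inv (slice (pull (@catf k m D) M) g g').
Proof.
move=> hM p f f'; rewrite /slice /pull.
by rewrite -{1}(actf1 g) -{1}(actf1 g') !actf_cat hM.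
Qed.

Lemma perm_inv_wslice k m (D : finType) (M : op R {ffun 'I_(k + m) -> D}) a :
  perm_inv M -> perm_inv (wslice (pull (@catf k m D) M) a).
Proof.
move=> hM p f f'; rewrite /wslice /pull; apply: eq_bigr => j _; apply: eq_bigr => j' _.
by congr (_ * _); rewrite -{1}(actf1 j) -{1}(actf1 j') !actf_cat hM.
Qed.

Lemma ptr1_wslice (J L : finType) (M : op R (J * L)%type) :
  ptr1 M = wslice M (@id_op R J).
Proof.
apply: op_ext => l l'; rewrite /ptr1 /wslice; apply: eq_bigr => j _.
rewrite (bigD1 j)//= /id_op eqxx mul1r big1 ?addr0// => j' /negPf jj'.
by rewrite eq_sym jj' mul0r.
Qed.

Definition mxunit (D : finType) (a b : D) : op R D := fun x y => ((x == a) && (y == b))%:R.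

(* [Lam M [:: O_1; ...; O_j]] is [tr (M (O_1 tensor ... tensor O_j tensor 1 ...))]:
   the default of [nth] fills the missing factors, and factors beyond the [n]-th are
   ignored. *)
Definition Lam n (D : finType) (M : op R {ffun 'I_n -> D}) (s : seq (op R D)) : C :=
  \sum_F \sum_G M F G * \prod_(i < n) nth (@id_op R D) s i (G i) (F i).

(* The marginal on the first [k] copies, meaningful for [k <= n]. *)
Definition kmarg k n (D : finType) (M : op R {ffun 'I_n -> D}) : op R {ffun 'I_k -> D} :=
  fun f g => Lam M [seq mxunit (g i) (f i) | i <- enum 'I_k].

Arguments kmarg k {n D} M.

Lemma prod_delta k (D : finType) (f g : {ffun 'I_k -> D}) :
  \prod_(i < k) @id_op R D (f i) (g i) = (f == g)%:R.
Proof.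
case: eqP => [->|/eqP fg]; first by apply: big1 => i _; rewrite /id_op eqxx.
have [i fi] : exists i, f i != g i.
  apply: contrapT => h; case/negP: fg; apply/eqP/ffunP => i; apply/eqP/negPn/negP => e.
  by apply: h; exists i.
by rewrite (bigD1 i)//= /id_op (negPf fi) mul0r.
Qed.

Lemma prod_mxunit k (D : finType) (f g F G : {ffun 'I_k -> D}) :
  \prod_(i < k) mxunit (g i) (f i) (G i) (F i) = (G == g)%:R * (F == f)%:R :> C.
Proof.
rewrite -!prod_delta -big_split; apply: eq_bigr => i _ /=.
by rewrite /mxunit /id_op; case: eqP => _; case: eqP => _; rewrite /= ?mulr1 ?mulr0.
Qed.

(** [kmarg] goes through [Lam] so that it can be stated for any [n] without a cast from [k + m];
    here it is identified with the partial trace. *)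
Lemma kmargE k m (D : finType) (M : op R {ffun 'I_(k + m) -> D}) :
  kmarg k M = ptr2 (pull (@catf k m D) M).
Proof.
apply: op_ext => f g; rewrite /kmarg /Lam /ptr2 sum_cat.
have E F1 F2 G1 G2 : \prod_(i < k + m) nth (@id_op R D) [seq mxunit (g i) (f i) | i <- enum 'I_k] i
    ((catf (G1, G2) : {ffun 'I_(k + m) -> D}) i) (catf (F1, F2) i) =
    (F1 == f)%:R * ((G1 == g)%:R * (G2 == F2)%:R).
  rewrite big_split_ord /=.
  rewrite (eq_bigr (fun i => mxunit (g i) (f i) (G1 i) (F1 i))); last first.
    move=> i _; rewrite !catf_l (nth_map i) ?size_enum_ord//=.
    by rewrite nth_ord_enum.
  rewrite prod_mxunit (eq_bigr (fun i => @id_op R D (G2 i) (F2 i))); last first.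
    by move=> i _; rewrite !catf_r nth_default// size_map size_enum_ord leq_addr.
  by rewrite prod_delta mulrCA mulrA.
under eq_bigr do under eq_bigr do rewrite sum_cat.
under eq_bigr do under eq_bigr do under eq_bigr do under eq_bigr do rewrite E.
rewrite exchange_big /=; apply: eq_bigr => F2 _.
transitivity (\sum_F1 (\sum_G1 (\sum_G2 M (catf (F1, F2)) (catf (G1, G2)) * (G2 == F2)%:R)
   * (G1 == g)%:R) * (F1 == f)%:R).
  apply: eq_bigr => F1 _; rewrite mulr_suml; apply: eq_bigr => G1 _.
  rewrite !mulr_suml; apply: eq_bigr => G2 _; ring.
by rewrite sum_delta sum_delta sum_delta.
Qed.

Lemma Lam_ptr1 k m (D : finType) (M : op R {ffun 'I_(k + m) -> D}) s :
  Lam (ptr1 (pull (@catf k m D) M)) s = Lam M (nseq k (@id_op R D) ++ s).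
Proof.
rewrite /Lam sum_cat [RHS]exchange_big /=; apply: eq_bigr => F2 _.
under [RHS]eq_bigr do rewrite sum_cat.
have E F1 G1 G2 : \prod_(i < k + m) nth (@id_op R D) (nseq k (@id_op R D) ++ s) i
    ((catf (G1, G2) : {ffun 'I_(k + m) -> D}) i) (catf (F1, F2) i) =
    (G1 == F1)%:R * \prod_(i < m) nth (@id_op R D) s i (G2 i) (F2 i).
  rewrite big_split_ord /= -prod_delta; congr (_ * _); apply: eq_bigr => i _.
    by rewrite !catf_l nth_cat size_nseq ltn_ord nth_nseq ltn_ord.
  by rewrite !catf_r nth_cat size_nseq ltnNge leq_addr /= addKn.
under [RHS]eq_bigr do under eq_bigr do under eq_bigr do rewrite E.
rewrite /ptr1 /pull.
under eq_bigr do rewrite mulr_suml.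
rewrite exchange_big; apply: eq_bigr => F1 _.
rewrite exchange_big; apply: eq_bigr => G2 _.
rewrite -[LHS](sum_delta F1 (fun G1 => M (catf (F1, F2)) (catf (G1, G2)) * _)).
by apply: eq_bigr => G1 _; rewrite -mulrA [X in _ * X]mulrC.
Qed.

Lemma Lam_perm n (D : finType) (M : op R {ffun 'I_n -> D}) s s' (p : {perm 'I_n}) :
  perm_inv M -> (forall i : 'I_n, nth (@id_op R D) s' i = nth (@id_op R D) s (p i)) ->
  Lam M s' = Lam M s.
Proof.
move=> hM hs; rewrite /Lam [LHS](reindex (actf p) (onW_bij _ (actf_bij D p))).
apply: eq_bigr => F _.
rewrite [LHS](reindex (actf p) (onW_bij _ (actf_bij D p))); apply: eq_bigr => G _.
rewrite hM; congr (_ * _); rewrite [RHS](reindex_inj (@perm_inj _ p)).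
by apply: eq_bigr => i _; rewrite !ffunE hs.
Qed.

Lemma Lam_drop1 n (D : finType) (M : op R {ffun 'I_n -> D}) s1 s2 :
  perm_inv M -> (size s1 + size s2 < n)%N ->
  Lam M (s1 ++ @id_op R D :: s2) = Lam M (s1 ++ s2).
Proof.
case: n M => // n M hM sz; symmetry.
have j1 : (size s1 < n.+1)%N by apply: leq_ltn_trans sz; rewrite leq_addr.
(* This permutation moves the identity to the last position and keeps the order of the others; the
   size hypothesis leaves that position to the default of [nth]. *)
apply: (Lam_perm (p := lift_perm ord_max (Ordinal j1) 1%g)) => // i.
case: (unliftP ord_max i) => [i' ->|->].
  rewrite lift_perm_lift perm1 /= !nth_cat /bump [(n <= i')%N]leqNgt ltn_ord add0n.
  case: leqP => h; last by rewrite add0n h.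
  rewrite add1n ltnNge (leq_trans h (leqnSn _)) /= subSn//.
rewrite lift_perm_id [in RHS]nth_cat /= ltnn subnn /= nth_default// size_cat.
by rewrite -ltnS.
Qed.

Lemma Lam_drop n (D : finType) (M : op R {ffun 'I_n -> D}) k s1 s2 :
  perm_inv M -> (size s1 + k + size s2 <= n)%N ->
  Lam M (s1 ++ nseq k (@id_op R D) ++ s2) = Lam M (s1 ++ s2).
Proof.
move=> hM; elim: k => [|k IH] sz //=.
rewrite Lam_drop1//; last by move: sz; rewrite size_cat size_nseq addnA addnS.
by apply: IH; apply: leq_trans sz; rewrite leq_add2r leq_add2l.
Qed.

Lemma perm_inv_ptr1 k m (D : finType) (M : op R {ffun 'I_(k + m) -> D}) :
  perm_inv M -> perm_inv (ptr1 (pull (@catf k m D) M)).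
Proof. by move=> hM; rewrite ptr1_wslice; apply: perm_inv_wslice. Qed.

Lemma kmarg_ptr1 k k' m (D : finType) (M : op R {ffun 'I_(k' + m) -> D}) : (k <= m)%N ->
  perm_inv M -> kmarg k (ptr1 (pull (@catf k' m D) M)) = kmarg k M.
Proof.
move=> km hM; apply: op_ext => f g; rewrite /kmarg Lam_ptr1.
rewrite -[X in Lam M X]cat0s Lam_drop// add0n size_map size_enum_ord.
by rewrite leq_add2l.
Qed.

(** All ranks are [1], so the linear entropy is zero and [entropy_lin] reduces to the bound of the
    entropy by the logarithm of the dimension. *)
Lemma basis_resolution (J : finType) :
  resolution (fun x : J => mxunit x x) (fun=> 1).
Proof.
split=> //.
- move=> x; apply: op_ext => i j; rewrite /adj /mxunit rmorph_nat andbC.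
  by [].
- move=> x; apply: op_ext => i j; rewrite /opmul (bigD1 x)//= /mxunit eqxx /= andbT big1 ?addr0.
    by rewrite -natrM mulnb.
  by move=> k /negPf kx; rewrite kx andbF mul0r.
- move=> i j; rewrite /mxunit (bigD1 i)//= eqxx big1 ?addr0 /id_op.
    by rewrite eq_sym; case: eqP.
  by move=> k /negPf kx; rewrite eq_sym kx.
- move=> x; rewrite /trace (bigD1 x)//= /mxunit eqxx big1 ?addr0//.
  by move=> k /negPf ->.
Qed.

Lemma basis_compresses (J : finType) (x : J) (M : op R J) : compresses (mxunit x x) M.
Proof.
exists (M x x) => i j; rewrite /opmul (bigD1 x)//= [X in _ + X]big1 ?addr0; last first.
  by move=> k /negPf kx; rewrite /mxunit kx /= mulr0.
rewrite (bigD1 x)//= [X in _ + X]big1 ?addr0; last first.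
  by move=> k /negPf kx; rewrite /mxunit kx andbF mul0r.
rewrite /mxunit !eqxx /= andbT.
by case: eqP => _; case: eqP => _; rewrite /= ?(mulr0, mul0r, mulr1, mul1r).
Qed.

(* [b] blocks of size [k] and [r] leftover copies, measured in the standard basis;
   writing the length as an [iter] makes the splitting of ['I_(k + m)] definitional. *)
Lemma block_resolution (D : finType) k r (X : finType) (P : X -> op R {ffun 'I_k -> D}) rk :
  resolution P rk -> (forall x M, perm_inv M -> compresses (P x) M) -> forall b,
  exists (Y : finType) (Q : Y -> op R {ffun 'I_(iter b (addn k) r) -> D}) (s : Y -> R),
   [/\ resolution Q s, #|Y| = (#|X| ^ b * #|D| ^ r)%N,
       forall y M, perm_inv M -> compresses (Q y) M &
       forall M, perm_inv M -> lin_entropy Q s M = b%:R * lin_entropy P rk (kmarg k M)].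
Proof.
move=> hP cP; elim=> [|b [Y [Q [s [hQ cY cQ lQ]]]]].
  exists {ffun 'I_r -> D}, (fun x => mxunit x x), (fun=> 1); split.
  - exact: basis_resolution.
  - by rewrite card_ffun card_ord expn0 mul1n.
  - by move=> y M _; apply: basis_compresses.
  - move=> M _; rewrite mul0r; apply: big1 => x _.
    by rewrite ln1 mul0r mulr0.
set m := iter b (addn k) r in Y Q s hQ cY cQ lQ *.
have fb := Bijective (@splitfK k m D) (@catfK k m D).
exists (X * Y)%type, (fun xy => pull (@splitf k m D) (tens (P xy.1) (Q xy.2))),
  (fun xy => rk xy.1 * s xy.2); split.
- by apply: resolution_pull => //; apply: resolution_tens.
- by rewrite card_prod cY expnS mulnA.
- have pK (M : op R {ffun 'I_(k + m) -> D}) : M = pull (@splitf k m D) (pull (@catf k m D) M).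
    by apply: op_ext => f g; rewrite /pull !splitfK.
  move=> [x y] M hM; rewrite [M]pK; apply: compresses_pull => //=.
  have [_ Pid _ Ptr P0] := hP.
  apply: compresses_tens => //.
  + by rewrite Ptr => /complexI/eqP; rewrite gt_eqF.
  + by move=> l l'; apply: cP; apply: perm_inv_slice.
  + by move=> a; apply: cQ; apply: perm_inv_wslice.
- move=> M hM.
  have -> : M = pull (@splitf k m D) (pull (@catf k m D) M).
    by apply: op_ext => f g; rewrite /pull !splitfK.
  rewrite lin_entropy_pull// lin_entropy_tens//.
  have -> : pull (@splitf k m D) (pull (@catf k m D) M) = M.
    by apply: op_ext => f g; rewrite /pull !splitfK.
  rewrite kmargE lQ; last exact: perm_inv_ptr1.
  rewrite [b.+1%:R]mulrS mulrDl mul1r; congr (_ + _).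
  (* For [b = 0] only [r] copies remain, possibly fewer than [k], and [kmarg k] of them means
     nothing; its coefficient is zero. *)
  have [b0|b0] := posnP b.
    by rewrite (_ : b%:R = 0 :> R) ?mul0r// b0.
  have km : (k <= m)%N by rewrite /m -(prednK b0) /= leq_addr.
  by rewrite (kmarg_ptr1 km hM) -kmargE.
Qed.

End Blocks.
Arguments kmarg {R} k {n D} M.

(** * Positivity of product operators *)

Section Positivity.
Variable R : realType.
Local Notation C := R[i].

Lemma conjM (x y : C) : Num.conj (x * y) = Num.conj x * Num.conj y.
Proof. exact: rmorphM. Qed.

Lemma conj_sum (I : finType) (F : I -> C) :
  Num.conj (\sum_i F i) = \sum_i Num.conj (F i).
Proof. exact: rmorph_sum. Qed.

Lemma conj_prod (I : finType) (F : I -> C) :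
  Num.conj (\prod_i F i) = \prod_i Num.conj (F i).
Proof. exact: rmorph_prod. Qed.

Definition tpow n (D : finType) (rho : op R D) : op R {ffun 'I_n -> D} :=
  fun F G => \prod_(i < n) rho (F i) (G i).

Arguments tpow n {D} rho.

Lemma psd_gram (D : finType) (O : op R D) : psd O ->
  exists v : D -> D -> C, forall i j, O i j = \sum_k v k i * Num.conj (v k j).
Proof.
move=> /psd_spectral[U [d [hU eO d0]]].
exists (fun k i => U i k * (Num.sqrt (d k))%:C) => i j.
rewrite eO {1}/opmul; apply: eq_bigr => k _.
rewrite mul_diagr conjM conj_real_complex -[d k in LHS]sqr_sqrtr// expr2 real_complexM.
rewrite /adj; ring.
Qed.

Lemma gram_psd (D K : finType) (v : K -> D -> C) (O : op R D) :
  (forall i j, O i j = \sum_k v k i * Num.conj (v k j)) -> psd O.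
Proof.
move=> e w.
have -> : \sum_i \sum_j Num.conj (w i) * O i j * w j =
    \sum_k (\sum_j Num.conj (v k j) * w j) * Num.conj (\sum_j Num.conj (v k j) * w j).
  transitivity (\sum_i \sum_j \sum_k Num.conj (w i) * v k i * (Num.conj (v k j) * w j)).
    apply: eq_bigr => i _; apply: eq_bigr => j _; rewrite e mulr_sumr mulr_suml.
    by apply: eq_bigr => k _; rewrite !mulrA.
  under eq_bigr do rewrite exchange_big.
  rewrite exchange_big; apply: eq_bigr => k _.
  rewrite mulrC conj_sum mulr_suml; apply: eq_bigr => i _.
  rewrite conjM conjCK mulr_sumr; apply: eq_bigr => j _.
  by rewrite [Num.conj (w i) * _]mulrC.
by apply: sumr_ge0 => k _; apply: mul_conjC_ge0.
Qed.

(** Gram representations multiply: the vectors of the product are the tensor products of the vectors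
    of the factors. *)
Lemma psd_prod n (D : finType) (O : 'I_n -> op R D) : (forall i, psd (O i)) ->
  psd (fun F G : {ffun 'I_n -> D} => \prod_i O i (F i) (G i)).
Proof.
move=> hO.
pose v i := projT1 (cid (psd_gram (hO i))).
have vE i a b : O i a b = \sum_k v i k a * Num.conj (v i k b).
  exact: (projT2 (cid (psd_gram (hO i)))).
apply: (@gram_psd {ffun 'I_n -> D} {ffun 'I_n -> D}
  (fun (K F : {ffun 'I_n -> D}) => \prod_i v i (K i) (F i))) => F G.
under eq_bigr do rewrite vE.
rewrite bigA_distr_bigA; apply: eq_bigr => K _.
by rewrite conj_prod -big_split.
Qed.

Lemma psd_trace_mul (I : finType) (M N : op R I) : psd M -> psd N ->
  0 <= \sum_F \sum_G M F G * N G F.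
Proof.
move=> hM /psd_gram[v e].
have -> : \sum_F \sum_G M F G * N G F =
    \sum_k \sum_F \sum_G Num.conj (v k F) * M F G * v k G.
  transitivity (\sum_F \sum_G \sum_k Num.conj (v k F) * M F G * v k G).
    apply: eq_bigr => F _; apply: eq_bigr => G _; rewrite e mulr_sumr.
    by apply: eq_bigr => k _; ring.
  under eq_bigr do rewrite exchange_big.
  by rewrite exchange_big.
by apply: sumr_ge0 => k _; apply: hM.
Qed.

Lemma psd_id (D : finType) : psd (@id_op R D).
Proof.
apply: (@gram_psd _ D (fun k i => (k == i)%:R)) => i j.
rewrite (bigD1 i)//= eqxx mul1r rmorph_nat big1 ?addr0 /id_op; first by case: eqP.
by move=> k /negPf ->; rewrite mul0r.
Qed.

Lemma psd_sum (I : Type) (s : seq I) (D : finType) (p : I -> R) (O : I -> op R D) :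
  (forall i, 0 <= p i) -> (forall i, psd (O i)) ->
  psd (fun a b => \sum_(i <- s) (p i)%:C * O i a b).
Proof.
move=> p0 hO w.
have -> : \sum_a \sum_b Num.conj (w a) * (\sum_(i <- s) (p i)%:C * O i a b) * w b =
   \sum_(i <- s) (p i)%:C * (\sum_a \sum_b Num.conj (w a) * O i a b * w b).
  under [RHS]eq_bigr do rewrite mulr_sumr.
  rewrite [RHS]exchange_big; apply: eq_bigr => a _.
  under [RHS]eq_bigr do rewrite mulr_sumr.
  rewrite [RHS]exchange_big; apply: eq_bigr => b _.
  rewrite mulr_sumr mulr_suml; apply: eq_bigr => i _; ring.
by apply: sumr_ge0 => i _; rewrite mulr_ge0// ?ler0c// hO.
Qed.

Lemma psd_scale (D : finType) (c : R) (O : op R D) : 0 <= c -> psd O ->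
  psd (fun a b => c%:C * O a b).
Proof.
move=> c0 hO w.
under eq_bigr do under eq_bigr do rewrite mulrCA -mulrA.
under eq_bigr do rewrite -mulr_sumr.
by rewrite -mulr_sumr mulr_ge0// ?ler0c// hO.
Qed.

Lemma trace_tpow n (D : finType) (rho : op R D) : trace (tpow n rho) = trace rho ^+ n.
Proof.
rewrite /trace /tpow -(bigA_distr_bigA (fun _ : 'I_n => fun d : D => rho d d)).
by rewrite prodr_const card_ord.
Qed.

Lemma tpow_state n (D : finType) (rho : op R D) : is_state rho -> is_state (tpow n rho).
Proof.
by move=> [h1 h2]; split; [exact: (@psd_prod n D (fun=> rho))|rewrite trace_tpow h2 expr1n].
Qed.

Lemma tpow_perm_inv n (D : finType) (rho : op R D) : perm_inv (tpow n rho).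
Proof.
move=> p F G; rewrite /tpow [RHS](reindex_inj (@perm_inj _ p)).
by apply: eq_bigr => i _; rewrite !ffunE.
Qed.

Lemma Lam_ge0 n (D : finType) (M : op R {ffun 'I_n -> D}) s : psd M ->
  (forall i, psd (nth (@id_op R D) s i)) -> 0 <= Lam M s.
Proof.
move=> hM hs; apply: (@psd_trace_mul _ M (fun G F => \prod_(i < n) nth (@id_op R D) s i (G i) (F i))) => //.
exact: (@psd_prod n D (fun i => nth (@id_op R D) s i)).
Qed.

(** The vectors [e_a + t e_b] with [t] among [1], [-1], ['i], [-'i] bound twice each part by
    [M a a + M b b], and every diagonal entry is at most the trace. *)
Lemma psd_entry_bound (D : finType) (M : op R D) a b : psd M ->
  `|complex.Re (M a b)| <= complex.Re (trace M) /\ `|complex.Im (M a b)| <= complex.Re (trace M).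
Proof.
move=> hM.
have dge c : 0 <= complex.Re (M c c).
  have := hM (fun k => (k == c)%:R).
  rewrite (_ : \sum_i _ = M c c); first by rewrite lecE => /andP[].
  under eq_bigr do rewrite sum_delta rmorph_nat mulrC.
  by rewrite sum_delta.
have trE : complex.Re (trace M) = \sum_c complex.Re (M c c).
  by rewrite /trace (raddf_sum (@complex.Re R : Rcomplex R -> R)).
have tle c : complex.Re (M c c) <= complex.Re (trace M).
  by rewrite trE (bigD1 c)//= lerDl sumr_ge0.
have hab : complex.Re (M b a) = complex.Re (M a b) /\ complex.Im (M b a) = - complex.Im (M a b).
  have : conjc (M b a) = M a b by rewrite -[in RHS](psd_adj hM).
  by move=> <-; case: (M b a) => u w /=; rewrite opprK.
have ta := tle a; have tb := tle b.
have h1 := psd_pair a b 1 1 hM; have h2 := psd_pair a b 1 (-1) hM.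
have h3 := psd_pair a b 1 'i%C hM; have h4 := psd_pair a b 1 (- 'i%C) hM.
move: hab ta tb h1 h2 h3 h4; rewrite -![Num.conj _]/(conjc _).
case: (M a a) => a1 a2; case: (M b b) => b1 b2.
case: (M a b) => c1 c2; case: (M b a) => d1 d2; rewrite !lecE /=; simpc => /=.
move=> [e1 e2] ta tb /andP[_ p1] /andP[_ p2] /andP[_ p3] /andP[_ p4].
by rewrite !ler_norml; split; apply/andP; split; lra.
Qed.

(** Multilinearity in one slot. The slot must lie below [n]: a factor beyond the [n]-th is ignored,
    whereas its coefficients would remain. *)
Lemma Lam_lin n (D Y : finType) (M : op R {ffun 'I_n -> D}) s1 s2 (a : Y -> C)
    (O : Y -> op R D) (O' : op R D) : (size s1 < n)%N ->
  (forall i j, O' i j = \sum_y a y * O y i j) ->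
  Lam M (s1 ++ O' :: s2) = \sum_y a y * Lam M (s1 ++ O y :: s2).
Proof.
move=> sz e; pose j := Ordinal sz.
have h Q F G : \prod_(i < n) nth (@id_op R D) (s1 ++ Q :: s2) i (F i) (G i) =
   Q (F j) (G j) * \prod_(i < n | i != j) nth (@id_op R D) (s1 ++ @id_op R D :: s2) i (F i) (G i).
  rewrite (bigD1 j)//= nth_cat ltnn subnn /=; congr (_ * _).
  apply: eq_bigr => i ij; rewrite !nth_cat; case: ltnP => // si.
  have : (0 < i - size s1)%N.
    rewrite subn_gt0 ltn_neqAle si andbT; apply: contra ij => /eqP ij.
    by apply/eqP/val_inj.
  by case: (i - size s1)%N.
rewrite /Lam; under [RHS]eq_bigr do rewrite mulr_sumr.
rewrite [RHS]exchange_big; apply: eq_bigr => F _.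
under [RHS]eq_bigr do rewrite mulr_sumr.
rewrite [RHS]exchange_big; apply: eq_bigr => G _.
rewrite h e mulrA mulr_sumr mulr_suml; apply: eq_bigr => y _.
by rewrite h; ring.
Qed.

End Positivity.
Arguments tpow {R} n {D} rho.

(** * An informationally complete measurement *)

Section Povm.
Variable R : realType.
Local Notation C := R[i].

Lemma povm_exists (D : finType) : (0 < #|D|)%N ->
  exists (X : finType) (E : X -> op R D) (c : D -> D -> X -> C),
  [/\ forall x, psd (E x), forall a b, @id_op R D a b = \sum_x 1 * E x a b &
      forall a b i j, mxunit R a b i j = \sum_x c a b x * E x i j].
Proof.
(* [E (a, b, t)] is proportional to the projection onto [e_a + i^t e_b]; matrix units
   are recovered by polarization. *)
move=> D0; set d : R := #|D|%:R.
have d0 : d != 0 by rewrite pnatr_eq0 -lt0n.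
pose ph (t : 'I_4) : C := nth 0 [:: 1; 'i%C; -1; - 'i%C] t.
pose v (x : D * D * 'I_4) (y : D) : C := (y == x.1.1)%:R + ph x.2 * (y == x.1.2)%:R.
(* Summed over the four phases the cross terms cancel and a pair contributes [4] times the sum of
   its two diagonal units; over all pairs this is [8 d] times the identity. *)
pose k : R := (8 * d)^-1.
pose E x : op R D := fun i j => k%:C * (v x i * Num.conj (v x j)).
have ii : 'i%C * 'i%C = -1 :> C by rewrite -expr2 sqr_i.
have cj : Num.conj ('i%C : C) = - 'i%C.
  by rewrite -[LHS]/(conjc _) /=; apply/eqP; rewrite eq_complex /= oppr0 !eqxx.
have S4 (F : 'I_4 -> C) : \sum_t F t = F 0 + F 1 + F (inord 2) + F (inord 3).
  rewrite !big_ord_recl big_ord0 addr0 !addrA.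
  by congr (F _ + F _ + F _ + F _); apply: val_inj; rewrite /= ?inordK.
have ph0 : ph 0 = 1 by []. have ph1 : ph 1 = 'i%C by [].
have ph2 : ph (inord 2) = -1 by rewrite /ph inordK.
have ph3 : ph (inord 3) = - 'i%C by rewrite /ph inordK.
have vC x y : Num.conj (v x y) = (y == x.1.1)%:R + Num.conj (ph x.2) * (y == x.1.2)%:R.
  by rewrite -[LHS]/(Num.conj (_ + _ * _)) rmorphD rmorphM !rmorph_nat.
have cN (z : C) : Num.conj (- z) = - Num.conj z by exact: rmorphN.
have cph0 : Num.conj (ph 0) = 1 by rewrite ph0 conjC1.
have cph1 : Num.conj (ph 1) = - 'i%C by rewrite ph1 cj.
have cph2 : Num.conj (ph (inord 2)) = -1 by rewrite ph2 cN conjC1.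
have cph3 : Num.conj (ph (inord 3)) = 'i%C by rewrite ph3 cN cj opprK.
exists (D * D * 'I_4)%type, E,
  (fun a b x => ((x.1.1 == a) && (x.1.2 == b))%:R * (2 * #|D|%:R) * ph x.2).
have kd : k%:C * (8 * #|D|%:R) = 1 :> C.
  have -> : k%:C = (8 * #|D|%:R)^-1 :> C by rewrite fmorphV rmorphM !rmorph_nat.
  by rewrite mulVf// mulf_neq0// pnatr_eq0// -lt0n.
have SS (F : D * D * 'I_4 -> C) : \sum_x F x = \sum_a \sum_b \sum_t F (a, b, t).
  by rewrite sum_pair sum_pair.
split.
- move=> x; apply: psd_scale; first by rewrite invr_ge0 mulr_ge0.
  by apply: (@gram_psd R D unit (fun _ => v x)) => i j; rewrite sumr_const card_unit mulr1n.
- move=> a b; rewrite SS.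
  have h p q : \sum_t 1 * E (p, q, t) a b =
      k%:C * 4 * ((a == p)%:R * (b == p)%:R + (a == q)%:R * (b == q)%:R).
    rewrite S4 /E !vC /v /= cph0 cph1 cph2 cph3 ph0 ph1 ph2 ph3.
    set A := (a == p)%:R; set B := (a == q)%:R; set P := (b == p)%:R; set Q := (b == q)%:R.
    transitivity (k%:C * (4 * (A * P) + 2 * (1 - 'i%C * 'i%C) * (B * Q))); first by ring.
    by rewrite ii; ring.
  under eq_bigr do under eq_bigr do rewrite h.
  have dl : \sum_p (a == p)%:R * (b == p)%:R = @id_op R D a b :> C.
    under eq_bigr do rewrite eq_sym [b == _]eq_sym.
    by rewrite sum_delta /id_op eq_sym; case: eqP.
  under eq_bigr do rewrite -mulr_sumr big_split /= dl sumr_const.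
  rewrite -mulr_sumr big_split /= sumr_const sumrMnl dl -[X in _ * (X + _)]mulr_natr -[X in _ * (_ + X)]mulr_natr.
  rewrite (_ : #|(xpredT : pred D)| = #|D|)//.
  transitivity ((k%:C * (8 * #|D|%:R)) * @id_op R D a b); first by rewrite kd mul1r.
  by move: (k%:C) (#|D|%:R : C) (id_op _ a b) => kk dd w; ring.
move=> a b i j; rewrite SS.
transitivity (\sum_p (\sum_q (4 * (2 * #|D|%:R) * k%:C * (i == p)%:R * (j == q)%:R) * (q == b)%:R) * (p == a)%:R).
  rewrite sum_delta sum_delta /mxunit.
  have -> : 4 * (2 * #|D|%:R) * k%:C = 1 :> C.
    rewrite -[RHS]kd; move: (k%:C) (#|D|%:R : C) => kk dd; ring.
  by rewrite mul1r; case: eqP => _; case: eqP => _; rewrite /= ?mulr1 ?mulr0 ?mul0r.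
apply: eq_bigr => p _; rewrite mulr_suml; apply: eq_bigr => q _.
rewrite S4 /E !vC /v /= cph0 cph1 cph2 cph3 ph0 ph1 ph2 ph3.
rewrite -mulnb natrM.
set A := (i == p)%:R; set B := (i == q)%:R; set P := (j == p)%:R; set Q := (j == q)%:R.
set u := (p == a)%:R; set w := (q == b)%:R; set dd := #|D|%:R.
apply/esym; transitivity (u * w * (2 * dd) * k%:C * (2 * (A * Q) * (1 - 'i%C * 'i%C) +
   2 * (B * P) * (1 + 'i%C * 'i%C))); first by ring.
by rewrite ii; ring.
Qed.

End Povm.

(** * A finite quantum de Finetti theorem *)

Section Words.
Variable X : finType.

(** Outcome strings are plain sequences rather than tuples, so that concatenation needs no cast on
    lengths. *)
Fixpoint words (m : nat) : seq (seq X) :=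
  if m is m'.+1 then [seq x :: y | x <- enum X, y <- words m'] else [:: [::]].

Lemma words_size m z : z \in words m -> size z = m.
Proof.
elim: m z => [|m IH] z /=; first by rewrite inE => /eqP ->.
by move=> /allpairsP[[x y] [_ /IH /= <- ->]].
Qed.

Lemma sum_wordsS (V : nmodType) m (F : seq X -> V) :
  \sum_(w <- words m.+1) F w = \sum_x \sum_(y <- words m) F (x :: y).
Proof. by rewrite /= big_allpairs_dep big_enum. Qed.

Lemma sum_words_cat (V : nmodType) m j (F : seq X -> V) :
  \sum_(w <- words (m + j)) F w = \sum_(z <- words m) \sum_(y <- words j) F (z ++ y).
Proof.
elim: m F => [|m IH] F; first by rewrite add0n big_seq1.
by rewrite addSn !sum_wordsS; apply: eq_bigr => x _; rewrite IH.
Qed.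

End Words.

Section ComplexParts.
Variable R : realType.
Local Notation C := R[i].

(** Indexing the two parts by a boolean lets one real-valued variance argument serve both. *)
Definition cpart (t : bool) (z : C) : R := if t then complex.Re z else complex.Im z.

Lemma cpart_sum t (I : Type) (r : seq I) (F : I -> C) :
  cpart t (\sum_(i <- r) F i) = \sum_(i <- r) cpart t (F i).
Proof.
case: t; first exact: (raddf_sum (@complex.Re R : Rcomplex R -> R)).
exact: (raddf_sum (@complex.Im R : Rcomplex R -> R)).
Qed.

Lemma cpartB t (y z : C) : cpart t (y - z) = cpart t y - cpart t z.
Proof. by case: t y z => -[a b] [c d]. Qed.

Lemma cpart_real t (x : R) (z : C) : cpart t (x%:C * z) = x * cpart t z.
Proof. by case: t z => -[a b] /=; rewrite mul0r ?subr0 ?addr0. Qed.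

Lemma normc_ge0 (z : C) : 0 <= normc z.
Proof. by case: z => a b; rewrite /normc sqrtr_ge0. Qed.

Lemma normc_parts (z : C) : normc z <= `|cpart true z| + `|cpart false z|.
Proof.
case: z => a b; rewrite /normc /=.
rewrite -[leRHS]ger0_norm ?addr_ge0// -sqrtr_sqr ler_wsqrtr//.
rewrite sqrrD !real_normK ?num_real// -addrA [_ *+ 2 + _]addrC addrA lerDl.
by rewrite mulrn_wge0// mulr_ge0.
Qed.

Lemma normc_sum (I : Type) (r : seq I) (F : I -> C) :
  normc (\sum_(i <- r) F i) <= \sum_(i <- r) normc (F i).
Proof.
elim: r => [|x r IH]; first by rewrite !big_nil normc0.
by rewrite !big_cons (le_trans (le_normcD _ _))// lerD2l.
Qed.

(* The second part follows from the first by [|t| <= e p / 2 + t^2 / (2 e p)].  Terms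
   with [p y = 0] vanish because then [s y = 0], consistently with [x / 0 = 0]. *)
Lemma variance_increment (I : eqType) (r : seq I) (p s : I -> R) (P S : R) :
  (forall y, y \in r -> `|s y| <= p y) -> P = \sum_(y <- r) p y -> S = \sum_(y <- r) s y ->
  0 <= \sum_(y <- r) s y ^+ 2 / p y - S ^+ 2 / P /\
  forall e : R, 0 < e -> \sum_(y <- r) `|s y - p y * (S / P)| <=
    e / 2 * P + (\sum_(y <- r) s y ^+ 2 / p y - S ^+ 2 / P) / (2 * e).
Proof.
move=> sp eP eS; set g := S / P.
have eq1 : \sum_(y <- r) s y ^+ 2 / p y - S ^+ 2 / P =
    \sum_(y <- r) (s y ^+ 2 / p y - 2 * g * s y + g ^+ 2 * p y).
  rewrite !big_split /= sumrN -!mulr_sumr -eP -eS -addrA; congr (_ + _).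
  rewrite /g; have [->|P0] := eqVneq P 0; first by rewrite invr0 !(mulr0, mul0r, oppr0) addr0.
  by field.
have term y : y \in r -> (p y = 0 /\ s y = 0) \/ 0 < p y.
  move=> /sp h; have := le_trans (normr_ge0 _) h; rewrite le_eqVlt => /predU1P[e|]; last by right.
  by left; split=> //; apply/eqP; rewrite -normr_le0 e.
have sqE y : 0 < p y -> s y ^+ 2 / p y - 2 * g * s y + g ^+ 2 * p y = (s y - p y * g) ^+ 2 / p y.
  by move=> py; field; rewrite gt_eqF.
split.
  rewrite eq1 big_seq; apply: sumr_ge0 => y /term[[-> ->]|py].
    by rewrite invr0 !mulr0 subr0 addr0.
  by rewrite sqE// divr_ge0 ?sqr_ge0 ?ltW.
move=> e e0; rewrite eq1 eP mulr_sumr mulr_suml -big_split [leLHS]big_seq [leRHS]big_seq.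
apply: ler_sum => y /term[[-> ->]|py] /=.
  by rewrite invr0 !(mulr0, mul0r, subrr, addr0) normr0 lexx.
rewrite sqE//; set t := s y - p y * g.
have ->: t ^+ 2 = `|t| ^+ 2 by rewrite real_normK ?num_real.
have := sqr_ge0 (`|t| - e * p y).
rewrite -subr_ge0 => h.
have -> : e / 2 * p y + `|t| ^+ 2 / p y / (2 * e) - `|t| = (`|t| - e * p y) ^+ 2 / (2 * e * p y).
  by field; rewrite !gt_eqF.
by rewrite divr_ge0 ?sqr_ge0// !mulr_ge0// ltW.
Qed.

End ComplexParts.

(** * Conditioning on measured copies *)

Section DeFinetti.
Variables (R : realType) (D : finType) (n : nat) (M : op R {ffun 'I_n -> D}).
Local Notation C := R[i].
Hypotheses (psdM : psd M) (trM : trace M = 1) (invM : perm_inv M).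
Variables (X : finType) (E : X -> op R D) (c : D -> D -> X -> C).
Hypotheses (Epsd : forall x, psd (E x))
  (Eid : forall a b, @id_op R D a b = \sum_x 1 * E x a b)
  (Eunit : forall a b i j, mxunit R a b i j = \sum_x c a b x * E x i j).

Local Notation EZ z := [seq E x | x <- z].
Local Notation units os := [seq mxunit R o.1 o.2 | o <- os].
Local Notation words := (words X).

(** Completeness of the measurement turns each slot summed over outcomes into an identity, and
    invariance removes it. *)
Lemma Lam_id_words s1 j s2 : (size s1 + j + size s2 <= n)%N ->
  \sum_(y <- words j) Lam M (s1 ++ EZ y ++ s2) = Lam M (s1 ++ s2).
Proof.
elim: j => [|j IH] sz; first by rewrite big_seq1.
rewrite sum_wordsS exchange_big /= -IH; last first.
  by apply: leq_trans sz; rewrite leq_add2r leq_add2l.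
rewrite [LHS]big_seq [RHS]big_seq; apply: eq_bigr => y /words_size ey.
have szy : (size s1 + size (EZ y ++ s2) < n)%N.
  by apply: leq_trans sz; rewrite size_cat size_map ey addnA addnS addSn.
rewrite -[RHS]Lam_drop1//; apply/esym.
have s1n : (size s1 < n)%N by apply: leq_ltn_trans szy; rewrite leq_addr.
by rewrite (Lam_lin M (EZ y ++ s2) s1n Eid); apply: eq_bigr => x _; rewrite mul1r.
Qed.

Definition coef (os : seq (D * D)) (y : seq X) : C := \prod_(p <- zip os y) c p.1.1 p.1.2 p.2.

Lemma Lam_unit_words os s1 s2 : (size s1 + size os <= n)%N ->
  Lam M (s1 ++ units os ++ s2) =
  \sum_(y <- words (size os)) coef os y * Lam M (s1 ++ EZ y ++ s2).
Proof.
elim: os s1 => [|o os IH] s1 sz; first by rewrite big_seq1 /coef big_nil mul1r.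
rewrite sum_wordsS /=.
have s1n : (size s1 < n)%N by apply: leq_trans sz; rewrite /= addnS ltnS leq_addr.
rewrite (Lam_lin M (units os ++ s2) s1n (Eunit o.1 o.2)); apply: eq_bigr => x _.
rewrite -cat_rcons IH; last by rewrite size_rcons addSnnS.
by rewrite mulr_sumr; apply: eq_bigr => y _; rewrite cat_rcons /coef big_cons mulrA.
Qed.

(* After measuring the first copies with outcomes [z]: [wprob z] is the probability of
   [z], and [wcond z] the unnormalized conditional state of the next copy. *)
Definition wprob (z : seq X) : R := complex.Re (Lam M (EZ z)).
Definition wcond (z : seq X) : op R D := fun a b => Lam M (EZ z ++ [:: mxunit R b a]).

Lemma nth_EZ_psd z i : psd (nth (@id_op R D) (EZ z) i).
Proof.
have [iz|zi] := ltnP i (size z); last by rewrite nth_default ?size_map//; apply: psd_id.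
have [x0 _] : exists x0 : X, True by case: z iz => // x0 z _; exists x0.
by rewrite (nth_map x0).
Qed.

Lemma wprobE z : Lam M (EZ z) = (wprob z)%:C /\ 0 <= wprob z.
Proof.
have := Lam_ge0 psdM (nth_EZ_psd z); rewrite /wprob.
by case: (Lam _ _) => a b; rewrite lecE /= => /andP[/eqP -> ->].
Qed.

(** The quadratic form at [v] is [Lam] with the rank-one operator of [v] in the slot after the
    measured ones, hence a trace of a product of positive operators. *)
Lemma wcond_psd z : (size z < n)%N -> psd (wcond z).
Proof.
move=> zn v.
pose O : op R D := fun i j => v i * Num.conj (v j).
have OP : psd O by apply: (@gram_psd R D unit (fun=> v)) => i j; rewrite sumr_const card_unit.
have e i j : O i j = \sum_(ab : D * D) (Num.conj (v ab.1) * v ab.2) * mxunit R ab.2 ab.1 i j.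
  rewrite sum_pair /=.
  transitivity (\sum_a (\sum_b Num.conj (v a) * v b * (b == i)%:R) * (a == j)%:R).
    by rewrite sum_delta sum_delta mulrC.
  apply: eq_bigr => a _; rewrite mulr_suml; apply: eq_bigr => b _.
  by rewrite /mxunit -mulnb natrM mulrA [i == b]eq_sym [j == a]eq_sym.
have zn' : (size (EZ z) < n)%N by rewrite size_map.
suff -> : \sum_a \sum_b Num.conj (v a) * wcond z a b * v b = Lam M (EZ z ++ [:: O]).
  apply: Lam_ge0 => // i; rewrite nth_cat; case: ltnP => _; first exact: nth_EZ_psd.
  by case: (i - _)%N => [|k] //=; rewrite nth_nil; apply: psd_id.
rewrite (Lam_lin M [::] zn' e) sum_pair; apply: eq_bigr => a _; apply: eq_bigr => b _.
by rewrite /wcond mulrAC.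
Qed.

Lemma wcond_trace z : (size z < n)%N -> trace (wcond z) = (wprob z)%:C.
Proof.
move=> zn; rewrite -(wprobE z).1 -[EZ z in RHS]cats0 -(@Lam_drop1 _ _ _ _ (EZ z) [::] invM).
  have zn' : (size (EZ z) < n)%N by rewrite size_map.
  have e i j : @id_op R D i j = \sum_a 1 * mxunit R a a i j.
    have [_ _ h _ _] := basis_resolution R D.
    by rewrite -h; apply: eq_bigr => a _; rewrite mul1r.
  by rewrite (Lam_lin M [::] zn' e); apply: eq_bigr => a _; rewrite mul1r.
by rewrite addn0 size_map.
Qed.

Lemma wcond_bound t z a b : (size z < n)%N -> `|cpart t (wcond z a b)| <= wprob z.
Proof.
move=> zn; have [h1 h2] := psd_entry_bound a b (wcond_psd zn).
by rewrite wcond_trace//= in h1 h2; case: t.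
Qed.

Lemma wcond_sum z j a b : (size z + j < n)%N ->
  \sum_(y <- words j) wcond (z ++ y) a b = wcond z a b.
Proof.
move=> zj; rewrite /wcond -(@Lam_id_words (EZ z) j).
  by apply: eq_bigr => y _; rewrite map_cat catA.
by rewrite size_map addn1.
Qed.

Lemma wprob_sum z j : (size z + j <= n)%N -> \sum_(y <- words j) wprob (z ++ y) = wprob z.
Proof.
move=> zj; apply: complexI; rewrite -(wprobE z).1 -[EZ z]cats0 -(@Lam_id_words (EZ z) j).
  rewrite rmorph_sum; apply: eq_bigr => y _ /=.
  by rewrite -(wprobE _).1 map_cat cats0.
by rewrite size_map addn0.
Qed.

Lemma wprob_nil : wprob [::] = 1.
Proof.
apply: complexI; rewrite -(wprobE _).1 /= -[RHS]trM /Lam /trace.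
apply: eq_bigr => F _; rewrite -[RHS](sum_delta F (fun G => M F G)).
apply: eq_bigr => G _; congr (_ * _); rewrite -prod_delta.
by apply: eq_bigr => i _; rewrite nth_nil.
Qed.

(* The parts of the normalized conditional states form martingales in the outcomes,
   so their second moments increase with the number of measurements.  They stay
   bounded, hence some [k] consecutive measurements barely change them: given earlier
   outcomes, the next copies are nearly independent. *)
Definition potential (al : D * D * bool) m : R :=
  \sum_(z <- words m) cpart al.2 (wcond z al.1.1 al.1.2) ^+ 2 / wprob z.

Lemma potential_increment al m j : (m + j < n)%N ->
  potential al m <= potential al (m + j) /\ forall e : R, 0 < e ->
  \sum_(z <- words m) \sum_(y <- words j)
    `|cpart al.2 (wcond (z ++ y) al.1.1 al.1.2) -
      wprob (z ++ y) * (cpart al.2 (wcond z al.1.1 al.1.2) / wprob z)|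
  <= e / 2 + (potential al (m + j) - potential al m) / (2 * e).
Proof.
case: al => [[a b] t] /= mj.
have sz z y : z \in words m -> y \in words j -> (size (z ++ y) < n)%N.
  by move=> /words_size zm /words_size yj; rewrite size_cat zm yj.
have var z (zm : z \in words m) := @variance_increment R _ (words j)
  (fun y => wprob (z ++ y)) (fun y => cpart t (wcond (z ++ y) a b)) (wprob z)
  (cpart t (wcond z a b)) (fun y yj => wcond_bound t a b (sz z y zm yj))
  (esym (@wprob_sum z j (ltnW (eq_ind_r (fun k => (k + j < n)%N) mj (words_size zm)))))
  (etrans (f_equal (cpart t) (esym (@wcond_sum z j a b
     (eq_ind_r (fun k => (k + j < n)%N) mj (words_size zm))))) (cpart_sum t _ _)).
have eq1 : potential (a, b, t) (m + j) - potential (a, b, t) m =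
   \sum_(z <- words m) (\sum_(y <- words j) cpart t (wcond (z ++ y) a b) ^+ 2 / wprob (z ++ y)
      - cpart t (wcond z a b) ^+ 2 / wprob z).
  by rewrite /potential sum_words_cat sumrB.
split.
  rewrite -subr_ge0 eq1 big_seq; apply: sumr_ge0 => z zm.
  by case: (var z zm).
move=> e e0.
have -> : e / 2 = e / 2 * \sum_(z <- words m) wprob z.
  rewrite -[X in _ = _ * X]/(\sum_(z <- words m) wprob ([::] ++ z)) wprob_sum ?wprob_nil ?mulr1//.
  by rewrite add0n ltnW// (leq_ltn_trans _ mj)// leq_addr.
rewrite eq1 mulr_sumr mulr_suml -big_split [leLHS]big_seq [leRHS]big_seq /=.
by apply: ler_sum => z zm; case: (var z zm) => _; apply.
Qed.

Lemma potential_bound al m : (m < n)%N -> 0 <= potential al m <= 1.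
Proof.
case: al => [[a b] t] mn.
have p0 z : 0 <= wprob z by case: (wprobE z).
have s1 : \sum_(z <- words m) wprob z = 1.
  by rewrite -[LHS]/(\sum_(z <- words m) wprob ([::] ++ z)) wprob_sum ?wprob_nil// ltnW.
apply/andP; split; first by apply: sumr_ge0 => z _; rewrite divr_ge0 ?sqr_ge0.
rewrite /potential /= -s1 [leLHS]big_seq [leRHS]big_seq; apply: ler_sum => z zm.
have := wcond_bound t a b (eq_ind_r (fun k => (k < n)%N) mn (words_size zm)).
have := p0 z; rewrite le_eqVlt => /predU1P[<-|pz] h; first by rewrite invr0 mulr0.
rewrite ler_pdivrMr// -expr2 -real_normK ?num_real//.
by rewrite lerXn2r ?nnegrE// ltW.
Qed.

(** Pigeonhole over [T] consecutive windows of length [k]: the potentials of all entries and parts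
    together rise by at most their number, so some window has at most the average rise. Monotonicity
    passes this bound to each single potential and each [j] within the window. *)
Lemma small_increment k T : (0 < T)%N -> (T * k < n)%N ->
  exists2 t, (t < T)%N & forall al j, (j <= k)%N ->
    potential al (t * k + j) - potential al (t * k) <= #|{: D * D * bool}|%:R / T%:R.
Proof.
move=> T0 Tk; pose Phi m := \sum_al potential al m.
have mono al m j : (m + j < n)%N -> potential al m <= potential al (m + j).
  by move=> h; case: (potential_increment al h).
have [t tT ht] : exists2 t, (t < T)%N &
    Phi (t.+1 * k)%N - Phi (t * k)%N <= #|{: D * D * bool}|%:R / T%:R.
  apply: contrapT => h; set eta := _ / _ in h.
  have ht t : (t < T)%N -> 0 < Phi (t.+1 * k)%N - Phi (t * k)%N - eta.
    by move=> tT; rewrite subr_gt0 ltNge; apply/negP => h'; apply: h; exists t.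
  have : 0 < \sum_(0 <= t < T) (Phi (t.+1 * k)%N - Phi (t * k)%N - eta).
    rewrite big_mkord (bigD1 (Ordinal T0))//= ltr_pwDl ?ht//.
    by apply: sumr_ge0 => t _; apply/ltW/ht.
  rewrite sumrB (telescope_sumr (fun t => Phi (t * k)%N))// sumr_const_nat subn0 mul0n.
  rewrite -[eta *+ _]mulr_natr divfK ?pnatr_eq0 -?lt0n//.
  have bd al m : (m < n)%N -> 0 <= potential al m <= 1 by apply: potential_bound.
  have : Phi (T * k)%N <= #|{: D * D * bool}|%:R.
    rewrite -sumr_const; apply: ler_sum => al _.
    by case/andP: (bd al _ Tk).
  have : 0 <= Phi 0%N by apply: sumr_ge0 => al _; case/andP: (bd al _ (leq_ltn_trans (leq0n _) Tk)).
  lra.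
exists t => // al j jk.
have ek : (t.+1 * k = t * k + k)%N by rewrite mulSn addnC.
have tk : (t * k + k < n)%N.
  by apply: leq_ltn_trans Tk; rewrite addnC -mulSn leq_mul2r tT orbT.
apply: le_trans ht.
apply: (@le_trans _ _ (potential al (t.+1 * k) - potential al (t * k))).
  rewrite lerD2r ek (_ : (t * k + k = t * k + j + (k - j))%N); last by rewrite -addnA subnKC.
  apply: mono.
  by rewrite -addnA subnKC.
rewrite /Phi -sumrB (bigD1 al)//= lerDl; apply: sumr_ge0 => al' _.
by rewrite subr_ge0 ek; apply: mono.
Qed.


Variable dflt : op R D.
Hypothesis dflt_state : is_state dflt.

(** Outcomes of probability zero receive the arbitrary state [dflt], so that the mixture consists of
    states throughout. *)
Definition wstate z : op R D :=
  fun a b => if wprob z == 0 then dflt a b else (wprob z)^-1%:C * wcond z a b.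

Lemma wstateE z a b : (size z < n)%N -> (wprob z)%:C * wstate z a b = wcond z a b.
Proof.
move=> zn; rewrite /wstate; case: eqP => [p0|/eqP p0]; last first.
  by rewrite mulrA -real_complexM mulfV// mul1r.
have z0 t : cpart t (wcond z a b) = 0.
  by apply/eqP; rewrite -normr_le0 -p0; apply: wcond_bound.
rewrite p0 mul0r; move: (z0 true) (z0 false); rewrite /cpart.
by case: (wcond z a b) => u v /= -> ->.
Qed.

Lemma wstate_is_state z : (size z < n)%N -> is_state (wstate z).
Proof.
move=> zn; have [p0|p0] := eqVneq (wprob z) 0.
  by rewrite (_ : wstate z = dflt)//; apply: op_ext => a b; rewrite /wstate p0 eqxx.
have -> : wstate z = fun a b => (wprob z)^-1%:C * wcond z a b.
  by apply: op_ext => a b; rewrite /wstate (negPf p0).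
split; first by apply: psd_scale; [rewrite invr_ge0; case: (wprobE z)|apply: wcond_psd].
by rewrite /trace -mulr_sumr -/(trace _) wcond_trace// -real_complexM mulVf.
Qed.

(** If [wprob z = 0], the quotient on the right is [0] while [wstate z] is [dflt]; both sides agree
    because every extension of [z] then has probability zero. *)
Lemma wstate_increment t z y a b : (size z + size y < n)%N ->
  cpart t (wcond (z ++ y) a b - (wprob (z ++ y))%:C * wstate z a b) =
  cpart t (wcond (z ++ y) a b) - wprob (z ++ y) * (cpart t (wcond z a b) / wprob z).
Proof.
move=> zy; have zn : (size z < n)%N by apply: leq_ltn_trans zy; rewrite leq_addr.
rewrite cpartB cpart_real -(wstateE a b zn) cpart_real.
have [p0|p0] := eqVneq (wprob z) 0; last by rewrite [wprob z * _]mulrC mulfK.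
rewrite p0 mul0r !mul0r mulr0.
suff -> : wprob (z ++ y) = 0 by rewrite mul0r.
have := @wprob_sum z (size y) (ltnW zy); rewrite p0 => /eqP.
rewrite psumr_eq0 => [/allP h|w _]; last by case: (wprobE (z ++ w)).
apply/eqP/h; elim: y {zy h} => //= x y IH.
by apply/allpairsP; exists (x, y); rewrite mem_enum.
Qed.

Variable K : R.
Hypotheses (K1 : 1 <= K) (cK : forall a b x, normc (c a b x) <= K).

Lemma coef_bound os y : normc (coef os y) <= K ^+ size os.
Proof.
have K0 : 0 <= K := le_trans ler01 K1.
elim: os y => [|o os IH] [|x y]; rewrite /coef ?big_nil ?normc1 ?expr0//=.
  by rewrite exprn_ege1.
rewrite big_cons normcM exprS ler_pM ?normc_ge0//; exact: IH.
Qed.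

(** The last factor is peeled off: expanding the others in outcomes [y] makes them further
    conditioning, and [wcond (z ++ y)] is replaced by [wprob (z ++ y)] times [wstate z]. This costs
    at most [K ^ j * 2e], while the earlier error is multiplied by an entry of a state, of modulus
    at most [2]; hence the factor [2 * K] per position. *)
Lemma telescope_bound m k (e : R) : (m + k < n)%N -> 0 <= e ->
  (forall al j, (j <= k)%N -> \sum_(z <- words m) \sum_(y <- words j)
    `|cpart al.2 (wcond (z ++ y) al.1.1 al.1.2) -
      wprob (z ++ y) * (cpart al.2 (wcond z al.1.1 al.1.2) / wprob z)| <= e) ->
  forall os, (size os <= k)%N ->
  \sum_(z <- words m) normc (Lam M (EZ z ++ units os) -
      (wprob z)%:C * \prod_(o <- os) wstate z o.2 o.1)
  <= (size os)%:R * (2 * K) ^+ size os * (2 * e).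
Proof.
move=> mk e0 H; elim/last_ind => [_|os o IH].
  rewrite big1 ?mul0r ?mulr_ge0// => z _.
  by rewrite cats0 big_nil mulr1 (wprobE z).1 subrr normc0.
rewrite size_rcons => jk; set j := size os in jk IH *.
have K0 : 0 <= K := le_trans ler01 K1.
pose d z y := wcond (z ++ y) o.2 o.1 - (wprob (z ++ y))%:C * wstate z o.2 o.1.
pose err z := Lam M (EZ z ++ units os) - (wprob z)%:C * \prod_(o <- os) wstate z o.2 o.1.
have zn z : z \in words m -> (size z + j < n)%N.
  by move=> /words_size ->; apply: leq_ltn_trans mk; rewrite leq_add2l ltnW.
have step z : z \in words m -> normc (Lam M (EZ z ++ units (rcons os o)) -
      (wprob z)%:C * \prod_(o <- rcons os o) wstate z o.2 o.1) <=
   K ^+ j * \sum_(y <- words j) (`|cpart true (d z y)| + `|cpart false (d z y)|) + 2 * normc (err z).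
  move=> zm; have szj := zn _ zm.
  have eA : Lam M (EZ z ++ units (rcons os o)) =
      \sum_(y <- words j) coef os y * wcond (z ++ y) o.2 o.1.
    rewrite map_rcons -cats1 Lam_unit_words ?size_map -/j 1?ltnW//.
    by apply: eq_bigr => y _; rewrite /wcond map_cat catA.
  have eB : Lam M (EZ z ++ units os) =
      \sum_(y <- words j) coef os y * (wprob (z ++ y))%:C.
    rewrite -[units os]cats0 Lam_unit_words ?size_map -/j 1?ltnW//.
    by apply: eq_bigr => y _; rewrite cats0 -map_cat (wprobE _).1.
  have -> : Lam M (EZ z ++ units (rcons os o)) -
      (wprob z)%:C * \prod_(o <- rcons os o) wstate z o.2 o.1 =
      \sum_(y <- words j) coef os y * d z y + err z * wstate z o.2 o.1.
    rewrite /err mulrBl eB mulr_suml eA -cats1 big_cat big_seq1 /=.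
    under [X in _ = X + _]eq_bigr do rewrite mulrBr mulrA.
    rewrite sumrB addrA subrK; congr (_ - _).
    by rewrite mulrA.
  apply: le_trans (le_normcD _ _) _; apply: lerD.
    apply: le_trans (normc_sum _ _) _; rewrite mulr_sumr; apply: ler_sum => y _.
    by rewrite normcM ler_pM ?normc_ge0 ?coef_bound// normc_parts.
  rewrite normcM mulrC ler_wpM2r ?normc_ge0//.
  have [ps ts] := wstate_is_state (leq_ltn_trans (leq_addr _ _) szj).
  apply: le_trans (normc_parts _) _.
  have [h1 h2] := psd_entry_bound o.2 o.1 ps; rewrite ts /= in h1 h2.
  by rewrite [leRHS](_ : 2 = 1 + 1)// lerD.
rewrite big_seq; apply: le_trans (ler_sum _ step) _; rewrite -big_seq.
rewrite big_split /= -!mulr_sumr.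
have hd t : \sum_(z <- words m) \sum_(y <- words j) `|cpart t (d z y)| <= e.
  apply: le_trans (H (o.2, o.1, t) j (ltnW jk)); rewrite le_eqVlt; apply/orP; left.
  apply/eqP; rewrite [LHS]big_seq [RHS]big_seq; apply: eq_bigr => z zm.
  rewrite [LHS]big_seq [RHS]big_seq; apply: eq_bigr => y ym.
  by rewrite wstate_increment// (words_size ym) zn.
under eq_bigr do rewrite big_split.
rewrite big_split /=.
have {}IH := IH (ltnW jk).
have p1 : K ^+ j <= (2 * K) ^+ j.+1.
  have K2 : K <= 2 * K by rewrite mulrDl mul1r lerDl.
  apply: (@le_trans _ _ (K ^+ j.+1)); first by rewrite exprS ler_peMl// exprn_ge0.
  by apply: lerXn2r => //; rewrite nnegrE// (le_trans K0).
have p2 : 2 * (j%:R * (2 * K) ^+ j * (2 * e)) <= j%:R * (2 * K) ^+ j.+1 * (2 * e).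
  rewrite mulrA ler_wpM2r ?mulr_ge0// mulrCA ler_wpM2l// exprS.
  by rewrite ler_wpM2r ?exprn_ge0 ?mulr_ge0// ler_peMr.
rewrite (_ : j.+1%:R * (2 * K) ^+ j.+1 * (2 * e) =
  (2 * K) ^+ j.+1 * (2 * e) + j%:R * (2 * K) ^+ j.+1 * (2 * e)); last first.
  by rewrite -addn1 natrD; move: (j%:R : R) ((2 * K) ^+ _) => u w; ring.
apply: lerD.
  apply: ler_pM; rewrite ?exprn_ge0//.
    by apply: addr_ge0; apply: sumr_ge0 => z _; apply: sumr_ge0.
  by rewrite [leRHS](_ : 2 * e = e + e) ?mulrDl ?mul1r//; apply: lerD; [exact: (hd true)|exact: (hd false)].
by apply: le_trans p2; rewrite ler_pM2l.
Qed.

End DeFinetti.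

Lemma mxunit_state (R : realType) (D : finType) (a : D) : is_state (mxunit R a a).
Proof.
split; last by have [_ _ _ h _] := basis_resolution R D; rewrite h.
apply: (@gram_psd R D unit (fun _ i => (i == a)%:R)) => i j.
by rewrite sumr_const card_unit mulr1n rmorph_nat -natrM mulnb.
Qed.

Lemma de_finetti (R : realType) (D : finType) (k : nat) (eps : R) :
  (0 < #|D|)%N -> 0 < eps -> exists N, forall n, (N <= n)%N ->
  forall M : op R {ffun 'I_n -> D}, is_state M -> perm_inv M ->
  exists (m : nat) (p : 'I_m -> R) (s : 'I_m -> op R D),
  [/\ forall i, 0 <= p i, \sum_i p i = 1, forall i, is_state (s i),
    forall a b, \sum_i (p i)%:C * s i a b = Lam M [:: mxunit R b a]
  & forall f g, normc (kmarg k M f g - \sum_i (p i)%:C * tpow k (s i) f g) <= eps].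
Proof.
move=> D0 eps0; have [X [E [c [Epsd Eid Eunit]]]] := povm_exists R D0.
pose K : R := 1 + \sum_(abx : D * D * X) normc (c abx.1.1 abx.1.2 abx.2).
have K1 : 1 <= K by rewrite lerDl sumr_ge0// => i _; apply: normc_ge0.
have cK a b x : normc (c a b x) <= K.
  rewrite /K (bigD1 (a, b, x))//= addrCA lerDl addr_ge0// sumr_ge0// => i _.
  exact: normc_ge0.
(* The constant of [telescope_bound] at [k] factors; the added [1] keeps it positive when
   [k = 0]. *)
pose B := k%:R * (2 * K) ^+ k * 2 + 1.
have B0 : 0 < B by rewrite ltr_pwDr// !mulr_ge0// exprn_ge0// mulr_ge0// (le_trans ler01).
pose e := eps / B.
have e0 : 0 < e by rewrite divr_gt0.
(* Enough windows to bring the increments down to [e ^ 2], so that [e / 2 + e ^ 2 / (2 * e) = e]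
   below. *)
pose T := (Num.bound (#|{: D * D * bool}|%:R / e ^+ 2)).+1.
have hT : #|{: D * D * bool}|%:R / T%:R <= e ^+ 2.
  rewrite ler_pdivrMr ?ltr0n// mulrC -ler_pdivrMr ?exprn_gt0//.
  apply: le_trans (ltW (archi_boundP _)) _; first by rewrite divr_ge0 ?exprn_ge0// ltW.
  by rewrite ler_nat.
have T0 : (0 < T)%N by [].
exists (T * k).+1 => n Tk M [psdM trM] invM.
have [t tT ht] := small_increment psdM trM invM Epsd Eid T0 Tk.
set m := (t * k)%N in ht.
have mk : (m + k < n)%N.
  by apply: leq_ltn_trans Tk; rewrite addnC -mulSn leq_mul2r tT orbT.
have [a0 _] : exists a0 : D, True by case/card_gt0P: D0 => a0 _; exists a0.
have dst := mxunit_state R a0.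
have mn : (m < n)%N by apply: leq_ltn_trans mk; rewrite leq_addr.
have tele := telescope_bound psdM invM Epsd Eid Eunit dst K1 cK mk (ltW e0).
have {}tele := tele _.
pose W := words X m; pose P := wprob M E; pose S := wstate M E (mxunit R a0 a0).
have wn z : z \in W -> (size z < n)%N by move=> /words_size ->.
have toI (F : seq X -> R[i]) : \sum_(i < size W) F (nth [::] W i) = \sum_(z <- W) F z.
  by rewrite (big_nth [::]) big_mkord.
have toIR (F : seq X -> R) : \sum_(i < size W) F (nth [::] W i) = \sum_(z <- W) F z.
  by rewrite (big_nth [::]) big_mkord.
exists (size W), (fun i => P (nth [::] W i)), (fun i => S (nth [::] W i)); split.
- by move=> i; case: (wprobE psdM Epsd (nth [::] W i)).
- rewrite toIR -(wprob_nil psdM trM Epsd) -(@wprob_sum _ _ _ _ psdM invM _ _ Epsd Eid [::] m)//.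
  exact: ltnW.
- move=> i; apply: wstate_is_state => //; apply: wn; exact: mem_nth.
(* The weighted states are the conditional ones, which sum to the unconditioned marginal; no error
   arises here. *)
- move=> a b; rewrite (toI (fun z => (P z)%:C * S z a b)).
  rewrite -[RHS]/(wcond M E [::] a b) -(@wcond_sum _ _ _ _ invM _ _ Eid [::] m)//.
  rewrite [LHS]big_seq [RHS]big_seq; apply: eq_bigr => z zW.
  by rewrite wstateE ?wn.
move=> f g; rewrite (toI (fun z => (P z)%:C * tpow k (S z) f g)).
pose os := [seq (g i, f i) | i <- enum 'I_k].
have szos : size os = k by rewrite size_map size_enum_ord.
have -> : kmarg k M f g = \sum_(z <- W) Lam M ([seq E x | x <- z] ++ [seq mxunit R o.1 o.2 | o <- os]).
  have hsz : (size (Nil (op R D)) + m + size [seq mxunit R o.1 o.2 | o <- os] <= n)%N.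
    by rewrite size_map szos add0n ltnW.
  rewrite (_ : kmarg k M f g = Lam M [seq mxunit R o.1 o.2 | o <- os]); last first.
    by rewrite /kmarg /os -map_comp.
  exact: esym (Lam_id_words invM Eid hsz).
have eS z : tpow k (S z) f g = \prod_(o <- os) S z o.2 o.1.
  by rewrite /os big_map big_enum.
under [X in _ - X]eq_bigr do rewrite eS.
rewrite -sumrB; apply: le_trans (normc_sum _ _) _.
apply: le_trans (tele _ os _) _; rewrite ?szos//.
  move=> al j jk; have mj : (m + j < n)%N by apply: leq_ltn_trans mk; rewrite leq_add2l.
  have [_ h] := potential_increment psdM trM invM Epsd Eid al mj.
  apply: le_trans (h _ e0) _.
  have := le_trans (ht al j jk) hT => h'.
  rewrite [leRHS](_ : e = e / 2 + e ^+ 2 / (2 * e)); last by field; rewrite gt_eqF.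
  by rewrite lerD2l ler_wpM2r// invr_ge0 mulr_ge0// ltW.
rewrite mulrA /e mulrA ler_pdivrMr// mulrC ler_wpM2l ?ltW//.
by rewrite /B ltrDl.
Qed.

(** * Mutual information of symmetric states *)

Section EntropyFacts.
Variable R : realType.
Local Notation C := R[i].

Lemma tpow_mul n (D : finType) (M N : op R D) :
  tpow n (opmul M N) = opmul (tpow n M) (tpow n N).
Proof.
apply: op_ext => F G; rewrite /tpow /opmul bigA_distr_bigA.
by apply: eq_bigr => K _; rewrite big_split.
Qed.

Lemma tpow_id n (D : finType) : tpow n (@id_op R D) = @id_op R {ffun 'I_n -> D}.
Proof. by apply: op_ext => F G; rewrite /tpow prod_delta /id_op; case: eqP. Qed.

Lemma tpow_adj n (D : finType) (M : op R D) : tpow n (adj M) = adj (tpow n M).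
Proof. by apply: op_ext => F G; rewrite /tpow /adj conj_prod. Qed.

Lemma prod_real_complex (I : finType) (f : I -> R) :
  (\prod_i f i)%:C = \prod_i (f i)%:C :> C.
Proof. by rewrite rmorph_prod. Qed.

Lemma tpow_diag n (D : finType) (d : D -> R) :
  tpow n (diag_op d) = diag_op (fun K : {ffun 'I_n -> D} => \prod_i d (K i)).
Proof.
apply: op_ext => F G; rewrite /tpow /diag_op; case: eqP => [->|/eqP FG].
  by rewrite prod_real_complex; apply: eq_bigr => i _; rewrite eqxx.
have [i fi] : exists i, F i != G i.
  apply: contrapT => h; case/negP: FG; apply/eqP/ffunP => i; apply/eqP/negPn/negP => e.
  by apply: h; exists i.
by rewrite (bigD1 i)//= (negPf fi) mul0r.
Qed.

(** The prefactor stays inside the sum because [ln 0 = 0]: with a vanishing factor the logarithm of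
    the product is not the sum of the logarithms, but both sides are zero. *)
Lemma prod_xlnx n (x : 'I_n -> R) : (forall i, 0 <= x i) ->
  (\prod_i x i) * ln (\prod_i x i) = \sum_i (\prod_j x j) * ln (x i).
Proof.
move=> x0; have [/existsP[i /eqP xi]|] := boolP [exists i, x i == 0].
  by rewrite (bigD1 i)//= xi !mul0r big1// => j _; rewrite mul0r.
rewrite negb_exists => /forallP xn; rewrite -mulr_sumr; congr (_ * _).
have {}x0 i : 0 < x i by rewrite lt_neqAle eq_sym xn x0.
have : 0 < \prod_i x i /\ ln (\prod_i x i) = \sum_i ln (x i).
  apply: (big_ind2 (fun a b => 0 < a /\ ln a = b)) => //; first by rewrite ln1.
  by move=> a u b w [a0 <-] [b0 <-]; rewrite mulr_gt0// lnM.
by case.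
Qed.

Lemma entropy_tpow n (D : finType) (rho : op R D) : is_state rho ->
  vN_entropy (tpow n rho) = n%:R * vN_entropy rho.
Proof.
move=> /state_spectral[U [d [hU e d0 d1]]].
rewrite (@vN_entropyE _ _ rho d); last by exists U.
rewrite (@vN_entropyE _ _ _ (fun K : {ffun 'I_n -> D} => \prod_i d (K i))); last first.
  exists (tpow n U); split; first by rewrite /unitary -tpow_adj -tpow_mul hU tpow_id.
  by rewrite e !tpow_mul tpow_diag tpow_adj.
under eq_bigr do rewrite eta2E prod_xlnx// -sumrN mulr_suml.
rewrite exchange_big /=.
rewrite -[n in RHS]card_ord mulr_natl -sumr_const; apply: eq_bigr => i _.
(* The logarithm is attached to position [i] alone, so the sum over words factors and every other
   position contributes [\sum_x d x = 1]. *)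
transitivity (\prod_(j < n) \sum_x (d x * (if j == i then - ln (d x) / ln 2 else 1))).
  rewrite bigA_distr_bigA; apply: eq_bigr => K _.
  rewrite big_split /= (bigD1 i (F := fun j => if _ then _ else _))//= eqxx.
  rewrite [X in _ * (_ * X)]big1 => [|j /negPf ->//].
  by rewrite mulr1 !(mulNr, mulrN) mulrA.
rewrite (bigD1 i)//= eqxx [X in _ * X]big1 ?mulr1 => [|j /negPf ->].
  by apply: eq_bigr => x _; rewrite eta2E mulrA mulrN.
by under eq_bigr do rewrite mulr1.
Qed.

Lemma entropy_bound (I : finType) (M : op R I) : is_state M ->
  `|vN_entropy M| <= ln #|I|%:R / ln 2.
Proof.
move=> sM; have := entropy_lin sM (basis_resolution R I) (fun x => basis_compresses x M).
by rewrite /lin_entropy big1 ?subr0// => x _; rewrite ln1 mul0r mulr0.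
Qed.

Lemma ptr2_state (I J : finType) (M : op R (I * J)%type) : is_state M -> is_state (ptr2 M).
Proof.
move=> [h1 h2]; split; last by rewrite -h2 /trace sum_pair.
move=> v; have -> : \sum_i \sum_i' Num.conj (v i) * ptr2 M i i' * v i' =
    \sum_l \sum_i \sum_i' Num.conj (v i) * M (i, l) (i', l) * v i'.
  rewrite [RHS]exchange_big; apply: eq_bigr => i _; rewrite [RHS]exchange_big; apply: eq_bigr => i' _.
  by rewrite /ptr2 mulr_sumr mulr_suml.
apply: sumr_ge0 => l _; have := h1 (fun a => v a.1 * (a.2 == l)%:R).
rewrite sum_pair; under eq_bigr do under eq_bigr do rewrite sum_pair.
rewrite (_ : \sum_i _ = \sum_i \sum_i' Num.conj (v i) * M (i, l) (i', l) * v i')//.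
apply: eq_bigr => i _.
transitivity (\sum_l' (\sum_i' Num.conj (v i) * M (i, l') (i', l) * v i') * (l' == l)%:R).
  apply: eq_bigr => l' _; rewrite mulr_suml; apply: eq_bigr => i' _.
  transitivity (\sum_m (Num.conj (v i) * M (i, l') (i', m) * v i' * (l' == l)%:R) * (m == l)%:R).
    by apply: eq_bigr => m _; rewrite /= conjM rmorph_nat; ring.
  by rewrite sum_delta.
by rewrite sum_delta.
Qed.

Lemma swap_bij (I J : finType) : bijective (fun a : J * I => (a.2, a.1)).
Proof. by exists (fun a => (a.2, a.1)) => -[]. Qed.

Lemma ptr1_state (I J : finType) (M : op R (I * J)%type) : is_state M -> is_state (ptr1 M).
Proof. by move=> /(is_state_pull (@swap_bij I J))/ptr2_state. Qed.

Definition cqop (J K : finType) (p : K -> R) (rk : K -> op R J) : op R (J * K)%type :=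
  fun x y => if x.2 == y.2 then (p x.2)%:C * rk x.2 x.1 y.1 else 0.

Lemma eta2M (x y : R) : 0 <= x -> 0 <= y -> eta2 (x * y) = x * eta2 y + y * eta2 x.
Proof.
rewrite !eta2E le_eqVlt => /predU1P[<-|x0]; first by rewrite !(mul0r, oppr0, mulr0) addr0.
rewrite le_eqVlt => /predU1P[<-|y0]; first by rewrite !(mul0r, oppr0, mulr0) addr0.
rewrite lnM//; ring.
Qed.

(** The operator is block diagonal with eigenvalues [p k * d k i], and [eta2] of a product splits as
    a derivation. *)
Lemma entropy_cqop (J K : finType) (p : K -> R) (rk : K -> op R J) :
  (forall k, 0 <= p k) -> (forall k, is_state (rk k)) ->
  vN_entropy (cqop p rk) = \sum_k p k * vN_entropy (rk k) + \sum_k eta2 (p k).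
Proof.
move=> p0 srk.
pose U k := projT1 (cid (state_spectral (srk k))).
pose d k := projT1 (cid (projT2 (cid (state_spectral (srk k))))).
have h k : [/\ unitary (U k), rk k = opmul (opmul (U k) (diag_op (d k))) (adj (U k)),
    (forall i, 0 <= d k i) & \sum_i d k i = 1].
  exact: (projT2 (cid (projT2 (cid (state_spectral (srk k)))))).
pose V : op R (J * K)%type := fun x y => if x.2 == y.2 then U x.2 x.1 y.1 else 0.
have sumV k (F : J * K -> C) : \sum_x (if x.2 == k then F x else 0) = \sum_j F (j, k).
  rewrite sum_pair; apply: eq_bigr => j _; rewrite (bigD1 k)//= eqxx big1 ?addr0//.
  by move=> l /negPf ->.
rewrite (@vN_entropyE _ _ _ (fun x : J * K => p x.2 * d x.2 x.1)); last first.
  exists V; split.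
    apply: op_ext => -[i k] [j l]; rewrite /opmul.
    transitivity (\sum_x (if x.2 == k then Num.conj (U k x.1 i) *
        (if k == l then U k x.1 j else 0) else 0)).
      apply: eq_bigr => -[a b] _; rewrite /adj /V /=.
      by case: eqP => [->//|_]; rewrite rmorph0 mul0r.
    rewrite sumV /id_op xpair_eqE /=; case: (eqVneq k l) => [_|_]; last first.
      by rewrite andbF big1// => a _; rewrite mulr0.
    have [hU _ _ _] := h k; move: (congr1 (fun X => X i j) hU).
    by rewrite andbT /opmul /id_op.
  apply: op_ext => -[i k] [j l]; rewrite /cqop /opmul.
  transitivity (\sum_x (if x.2 == k then (p k)%:C * (U k i x.1 * (d k x.1)%:C *
     (if k == l then Num.conj (U k j x.1) else 0)) else 0)).
    rewrite sumV /=; case: (eqVneq k l) => [_|_]; last by rewrite big1// => a _; rewrite !mulr0.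
    have [_ -> _ _] := h k; rewrite -mulr_sumr; congr (_ * _).
    by apply: eq_bigr => a _; rewrite mul_diagr.
  apply: eq_bigr => -[a b] _; rewrite /= -/(opmul V _ _ _) mul_diagr /adj /V /= [k == b]eq_sym.
  case: eqP => [->|_]; last by rewrite !mul0r.
  rewrite real_complexM [l == k]eq_sym; case: eqP => [<-|_]; last by rewrite rmorph0 !mulr0.
  ring.
rewrite -(pair_bigA _ (fun j k => eta2 (p k * d k j))) /= exchange_big -big_split /=.
apply: eq_bigr => k _; have [hU e d0 d1] := h k.
rewrite (@vN_entropyE _ _ (rk k) (d k)); last by exists (U k).
under eq_bigr do rewrite eta2M//.
by rewrite big_split /= -mulr_sumr -mulr_suml d1 mul1r.
Qed.

Lemma cqop_state (J K : finType) (p : K -> R) (rk : K -> op R J) :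
  (forall k, 0 <= p k) -> \sum_k p k = 1 -> (forall k, is_state (rk k)) ->
  is_state (cqop p rk).
Proof.
move=> p0 p1 srk; split; last first.
  rewrite /trace /cqop sum_pair exchange_big /= -[RHS]/(1%:C) -p1 sum_real_complex.
  apply: eq_bigr => k _; under eq_bigr do rewrite eqxx.
  by rewrite -mulr_sumr -/(trace _); have [_ ->] := srk k; rewrite mulr1.
move=> v.
have -> : \sum_i \sum_j Num.conj (v i) * cqop p rk i j * v j =
    \sum_k (p k)%:C * \sum_i \sum_j Num.conj (v (i, k)) * rk k i j * v (j, k).
  rewrite sum_pair exchange_big; apply: eq_bigr => k _ /=.
  rewrite mulr_sumr; apply: eq_bigr => i _; rewrite sum_pair mulr_sumr.
  apply: eq_bigr => j _; rewrite (bigD1 k)//= [X in _ + X]big1 ?addr0; last first.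
    by move=> l kl; rewrite /cqop /= eq_sym (negPf kl) mulr0 mul0r.
  by rewrite /cqop /= eqxx; ring.
by apply: sumr_ge0 => k _; rewrite mulr_ge0// ?ler0c//; have [h _] := srk k; apply: h.
Qed.

(* The Shannon entropies of the classical label cancel. *)
Lemma mutinf_cq (A B : finType) m (p : 'I_m -> R) (rk : 'I_m -> op R (A * B)%type) :
  (forall k, 0 <= p k) -> (forall k, is_state (rk k)) ->
  \sum_k p k = 1 ->
  mutinf (cq_ext p rk) - mutinf (ptr_mid (cq_ext p rk)) = \sum_k p k * mutinf (rk k).
Proof.
move=> p0 srk p1; have scq := cqop_state p0 p1 srk.
pose h (x : A * (B * 'I_m)) : (A * B) * 'I_m := ((x.1, x.2.1), x.2.2).
have hb : bijective h by exists (fun y => (y.1.1, (y.1.2, y.2))) => [[a [b k]]|[[a b] k]].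
have e1 : cq_ext p rk = pull h (cqop p rk) by [].
have e2 : ptr1 (cq_ext p rk) = cqop p (fun k => ptr1 (rk k)).
  apply: op_ext => -[b k] [b' k']; rewrite /ptr1 /cq_ext /cqop /=.
  by case: eqP => _; [rewrite mulr_sumr|apply: big1].
have e3 : ptr_mid (cq_ext p rk) = cqop p (fun k => ptr2 (rk k)).
  apply: op_ext => -[b k] [b' k']; rewrite /ptr_mid /ptr2 /cq_ext /cqop /=.
  by case: eqP => _; [rewrite mulr_sumr|apply: big1].
have e4 : ptr2 (cq_ext p rk) = ptr2 (ptr_mid (cq_ext p rk)).
  apply: op_ext => a a'; rewrite /ptr2 /ptr_mid sum_pair exchange_big.
  by [].
have e5 : ptr1 (ptr_mid (cq_ext p rk)) = diag_op p.
  rewrite e3; apply: op_ext => k k'; rewrite /ptr1 /cqop /diag_op /=.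
  case: eqP => _; last exact: big1.
  by rewrite -mulr_sumr -/(trace _); have [_ ->] := ptr2_state (srk k); rewrite mulr1.
rewrite /mutinf e4 e5 e2 e3 {1}e1 entropy_pull//.
rewrite !entropy_cqop//; last 2 first.
- by move=> k; apply: ptr1_state.
- by move=> k; apply: ptr2_state.
have -> : vN_entropy (diag_op p) = \sum_k eta2 (p k).
  apply: vN_entropyE; exists (@id_op R _); split; first by rewrite /unitary opmul1r adj_id.
  by rewrite opmul1l adj_id opmul1r.
under [RHS]eq_bigr do rewrite mulrBr mulrDr.
rewrite !big_split /= sumrN; ring.
Qed.

End EntropyFacts.

(** * The convex roof and the linearized mutual information *)

Section MutualInformation.
Variable R : realType.
Local Notation C := R[i].
Local Notation lg x := (ln x / ln 2).

Definition lgdims (A B : finType) : R :=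
  lg #|A|%:R + lg #|B|%:R + lg #|{: A * B}|%:R.

(** A crude bound suffices to make the sets under [inf] bounded below. The same [lgdims] is the loss
    per leftover copy in the block estimate. *)
Lemma mutinf_lb (A B : finType) (M : op R (A * B)%type) : is_state M ->
  - lgdims A B <= mutinf M.
Proof.
move=> sM; have := entropy_bound sM; have := entropy_bound (ptr1_state sM).
have := entropy_bound (ptr2_state sM); rewrite !ler_norml /mutinf /lgdims.
by move=> /andP[h1 h2] /andP[h3 h4] /andP[h5 h6]; lra.
Qed.

Lemma decomp_lb (A B : finType) m (p : 'I_m -> R) (rk : 'I_m -> op R (A * B)%type) :
  (forall k, 0 <= p k) -> \sum_k p k = 1 -> (forall k, is_state (rk k)) ->
  - lgdims A B <= \sum_k p k * mutinf (rk k).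
Proof.
move=> p0 p1 srk; rewrite -[leLHS]mul1r -p1 mulr_suml; apply: ler_sum => k _.
by rewrite ler_wpM2l// mutinf_lb.
Qed.

Lemma Esq_C_le (A B : finType) (rho : op R (A * B)%type) m (p : 'I_m -> R) rk :
  is_cq_decomp rho p rk -> 2 * Esq_C rho <= \sum_k p k * mutinf (rk k).
Proof.
move=> D; have [p0 p1 srk _] := D; rewrite mulrC -ler_pdivlMr// -mutinf_cq//.
apply: ge_inf; last by exists m, p, rk.
exists (- lgdims A B / 2) => _ [m' [p' [rk' [[p0' p1' srk' _] ->]]]].
by rewrite ler_pM2r ?invr_gt0// mutinf_cq// decomp_lb.
Qed.

Lemma Esq_C_approx (A B : finType) (rho : op R (A * B)%type) (e : R) : is_state rho -> 0 < e ->
  exists m (p : 'I_m -> R) rk, is_cq_decomp rho p rk /\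
    \sum_k p k * mutinf (rk k) < 2 * Esq_C rho + e.
Proof.
move=> srho e0.
have e2 : 0 < e / 2 by rewrite divr_gt0.
have [|r [m [p [rk [D ->]]]]] := @inf_adherent R [set r : R | exists (m : nat) (p : 'I_m -> R)
    (rk : 'I_m -> op R (A * B)%type), is_cq_decomp rho p rk /\
         r = (mutinf (cq_ext p rk) - mutinf (ptr_mid (cq_ext p rk))) / 2] (e / 2) e2.
  split.
    exists ((mutinf (cq_ext (fun _ : 'I_1 => 1) (fun _ : 'I_1 => rho)) -
      mutinf (ptr_mid (cq_ext (fun _ : 'I_1 => 1) (fun _ : 'I_1 => rho)))) / 2).
    exists 1%N, (fun=> 1), (fun=> rho); split=> //; split=> //.
      by rewrite big_ord1.
    by move=> x y; rewrite big_ord1 mul1r.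
  exists (- lgdims A B / 2) => _ [m' [p' [rk' [[p0' p1' srk' _] ->]]]].
  by rewrite ler_pM2r ?invr_gt0// mutinf_cq// decomp_lb.
rewrite -[X in _ < X -> _]/(Esq_C rho + e / 2) => h; exists m, p, rk; split=> //.
have [p0 p1 srk _] := D; rewrite -mutinf_cq//; lra.
Qed.

(** An [ncopy] groups all [A] before all [B]; the symmetric algebra of the joint system needs a
    single word over [A * B]. *)
Definition zipf n (A B : finType) (x : ncopy n A B) : {ffun 'I_n -> (A * B)%type} :=
  [ffun i => (x.1 i, x.2 i)].
Definition unzipf n (A B : finType) (f : {ffun 'I_n -> (A * B)%type}) : ncopy n A B :=
  ([ffun i => (f i).1], [ffun i => (f i).2]).

Lemma zipfK n A B : cancel (@zipf n A B) (@unzipf n A B).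
Proof. by move=> [f g]; congr (_, _); apply/ffunP => i; rewrite !ffunE. Qed.

Lemma unzipfK n A B : cancel (@unzipf n A B) (@zipf n A B).
Proof. by move=> f; apply/ffunP => i; rewrite !ffunE; case: (f i). Qed.

Lemma zipf_bij n A B : bijective (@zipf n A B).
Proof. by exists (@unzipf n A B); [apply: zipfK|apply: unzipfK]. Qed.

Lemma unzipf_bij n A B : bijective (@unzipf n A B).
Proof. by exists (@zipf n A B); [apply: unzipfK|apply: zipfK]. Qed.

Lemma permx_zipf n A B p (x : ncopy n A B) : zipf (permx p x) = actf p (zipf x).
Proof. by apply/ffunP => i; rewrite !ffunE. Qed.

Lemma perm_inv_unzipf n A B (S : op R (ncopy n A B)) :
  perm_invariant S -> perm_inv (pull (@unzipf n A B) S).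
Proof.
have e p f : unzipf (actf p f) = permx p (@unzipf n A B f).
  by apply: (can_inj (@zipfK n A B)); rewrite permx_zipf !unzipfK.
by move=> hS p f g; rewrite /pull !e hS.
Qed.

Lemma perm_inv_ptr2 n A B (S : op R (ncopy n A B)) : perm_invariant S -> perm_inv (ptr2 S).
Proof.
move=> hS p f g; rewrite /ptr2 (reindex (actf p) (onW_bij _ (actf_bij B p))).
by apply: eq_bigr => h _; rewrite -(hS p (f, h) (g, h)).
Qed.

Lemma perm_inv_ptr1_ncopy n A B (S : op R (ncopy n A B)) : perm_invariant S -> perm_inv (ptr1 S).
Proof.
move=> hS p f g; rewrite /ptr1 (reindex (actf p) (onW_bij _ (actf_bij A p))).
by apply: eq_bigr => h _; rewrite -(hS p (h, f) (h, g)).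
Qed.

Lemma zipf_cat k m (A B : finType) (f : {ffun 'I_k -> A}) (g : {ffun 'I_m -> A})
    (f' : {ffun 'I_k -> B}) (g' : {ffun 'I_m -> B}) :
  zipf (catf (f, g), catf (f', g')) = catf (zipf (f, f'), zipf (g, g')).
Proof.
apply/ffunP => i; rewrite -(splitK i); rewrite ffunE.
by case: (fintype.split i) => a; rewrite /unsplit ?catf_l ?catf_r !ffunE.
Qed.

Lemma kmarg_ptr2 k m (A B : finType) (S : op R (ncopy (k + m) A B)) :
  kmarg k (ptr2 S) = ptr2 (pull (@zipf k A B) (kmarg k (pull (@unzipf _ A B) S))).
Proof.
rewrite !kmargE; apply: op_ext => f f'; rewrite /ptr2 /pull.
under eq_bigr do rewrite sum_cat.
rewrite exchange_big; apply: eq_bigr => h _ /=.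
rewrite [RHS](reindex _ (onW_bij _ (@zipf_bij m A B))) sum_pair.
apply: eq_bigr => g _; apply: eq_bigr => h' _.
by rewrite -!zipf_cat !zipfK.
Qed.

Lemma kmarg_ptr1_ncopy k m (A B : finType) (S : op R (ncopy (k + m) A B)) :
  kmarg k (ptr1 S) = ptr1 (pull (@zipf k A B) (kmarg k (pull (@unzipf _ A B) S))).
Proof.
rewrite !kmargE; apply: op_ext => f f'; rewrite /ptr2 /ptr1 /pull.
under eq_bigr do rewrite sum_cat.
rewrite exchange_big; apply: eq_bigr => h _ /=.
rewrite [RHS](reindex _ (onW_bij _ (@zipf_bij m A B))) sum_pair exchange_big /=.
apply: eq_bigr => g _; apply: eq_bigr => h' _.
by rewrite -!zipf_cat !zipfK.
Qed.

Definition tstate n (A B : finType) (rho : op R (A * B)%type) : op R (ncopy n A B) :=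
  pull (@zipf n A B) (tpow n rho).

Arguments tstate n {A B} rho.

Lemma ptr2_tstate n (A B : finType) (rho : op R (A * B)%type) :
  ptr2 (tstate n rho) = tpow n (ptr2 rho).
Proof.
apply: op_ext => f g; rewrite /ptr2 /tstate /pull /tpow bigA_distr_bigA.
by apply: eq_bigr => h _; apply: eq_bigr => i _; rewrite !ffunE.
Qed.

Lemma ptr1_tstate n (A B : finType) (rho : op R (A * B)%type) :
  ptr1 (tstate n rho) = tpow n (ptr1 rho).
Proof.
apply: op_ext => f g; rewrite /ptr1 /tstate /pull /tpow bigA_distr_bigA.
by apply: eq_bigr => h _; apply: eq_bigr => i _; rewrite !ffunE.
Qed.

Lemma tstate_state n (A B : finType) (rho : op R (A * B)%type) :
  is_state rho -> is_state (tstate n rho).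
Proof. by move=> h; apply: (is_state_pull (@zipf_bij n A B)); apply: tpow_state. Qed.

Lemma tstate_perm n (A B : finType) (rho : op R (A * B)%type) : perm_invariant (tstate n rho).
Proof. by move=> p x y; rewrite /tstate /pull !permx_zipf tpow_perm_inv. Qed.

Lemma mutinf_tstate n (A B : finType) (rho : op R (A * B)%type) : is_state rho ->
  mutinf (tstate n rho) = n%:R * mutinf rho.
Proof.
move=> h; rewrite /mutinf ptr2_tstate ptr1_tstate (entropy_pull (@zipf_bij n A B)); last exact: tpow_state.
by rewrite !entropy_tpow//; [rewrite mulrBr mulrDr|apply: ptr1_state|apply: ptr2_state].
Qed.

Lemma lin_entropy_sum (I X K : finType) (P : X -> op R I) r (p : K -> R) (M : K -> op R I) :
  lin_entropy P r (fun i j => \sum_k (p k)%:C * M k i j) = \sum_k p k * lin_entropy P r (M k).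
Proof.
rewrite /lin_entropy; under [RHS]eq_bigr do rewrite mulr_sumr.
rewrite [RHS]exchange_big; apply: eq_bigr => x _.
under [RHS]eq_bigr do rewrite mulrA.
rewrite -mulr_suml; congr (_ * _).
transitivity (cpart true (\sum_k (p k)%:C * trace (opmul (P x) (M k)))).
  congr complex.Re; rewrite /trace /opmul.
  under [RHS]eq_bigr do rewrite mulr_sumr.
  rewrite [RHS]exchange_big; apply: eq_bigr => i _.
  under [RHS]eq_bigr do rewrite mulr_sumr.
  rewrite [RHS]exchange_big; apply: eq_bigr => j _.
  by rewrite mulr_sumr; apply: eq_bigr => k _; rewrite mulrCA.
by rewrite cpart_sum; apply: eq_bigr => k _; rewrite cpart_real.
Qed.

Lemma normc_Re (z : C) : `|complex.Re z| <= normc z.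
Proof.
by case: z => a b; rewrite /normc /= -sqrtr_sqr ler_wsqrtr// lerDl sqr_ge0.
Qed.

Lemma lin_entropy_cont (I X : finType) (P : X -> op R I) r : exists2 c : R, 0 <= c &
  forall (M N : op R I) e, (forall i j, normc (M i j - N i j) <= e) ->
  `|lin_entropy P r M - lin_entropy P r N| <= c * e.
Proof.
exists (\sum_x (\sum_i \sum_j normc (P x i j)) * `|lg (r x)|).
  apply: sumr_ge0 => x _; rewrite mulr_ge0//; do 2!apply: sumr_ge0 => ? _.
  exact: normc_ge0.
move=> M N e he; rewrite /lin_entropy -sumrB mulr_suml.
apply: le_trans (ler_norm_sum _ _ _) _; apply: ler_sum => x _.
rewrite -mulrBl normrM mulrAC ler_wpM2r//.
have -> : complex.Re (trace (opmul (P x) M)) - complex.Re (trace (opmul (P x) N)) =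
   complex.Re (trace (opmul (P x) M) - trace (opmul (P x) N)).
  exact/esym/(cpartB true).
apply: le_trans (normc_Re _) _; rewrite /trace -sumrB mulr_suml.
apply: le_trans (normc_sum _ _) _; apply: ler_sum => i _.
rewrite /opmul -sumrB mulr_suml; apply: le_trans (normc_sum _ _) _; apply: ler_sum => j _.
by rewrite -mulrBr normcM ler_wpM2l ?normc_ge0.
Qed.

Lemma resolution_card_gt0 (I X : finType) (P : X -> op R I) r :
  (0 < #|I|)%N -> resolution P r -> (0 < #|X|)%N.
Proof.
move=> /card_gt0P[i _] [_ _ h _ _]; rewrite lt0n; apply/negP => /eqP/card0_eq X0.
have := h i i; rewrite big1 => [|x]; last by have := X0 x.
by rewrite /id_op eqxx => /eqP; rewrite eq_sym oner_eq0.
Qed.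

Lemma lg_block (v d b r : nat) : (0 < v)%N -> (0 < d)%N ->
  lg (v ^ b * d ^ r)%:R = b%:R * lg v%:R + r%:R * lg d%:R :> R.
Proof.
move=> v0 d0; rewrite natrM lnM ?posrE ?ltr0n ?expn_gt0 ?v0 ?d0// !natrX.
by rewrite !lnXn ?ltr0n// mulrDl -[ln _ *+ b]mulr_natl -[ln _ *+ r]mulr_natl !mulrA.
Qed.

Section Families.
Variables (A B : finType) (k : nat).
Hypotheses (A0 : (0 < #|A|)%N) (B0 : (0 < #|B|)%N).
Variables (XA XB XAB : finType).
Variables (PA : XA -> op R {ffun 'I_k -> A}) (rA : XA -> R).
Variables (PB : XB -> op R {ffun 'I_k -> B}) (rB : XB -> R).
Variables (PAB : XAB -> op R {ffun 'I_k -> (A * B)%type}) (rAB : XAB -> R).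
Hypotheses (hA : resolution PA rA) (hB : resolution PB rB) (hAB : resolution PAB rAB).
Hypotheses (cA : forall x M, perm_inv M -> compresses (PA x) M)
  (cB : forall x M, perm_inv M -> compresses (PB x) M)
  (cAB : forall x M, perm_inv M -> compresses (PAB x) M).

Definition mutinf_lin (T : op R {ffun 'I_k -> (A * B)%type}) : R :=
  lin_entropy PA rA (ptr2 (pull (@zipf k A B) T)) +
  lin_entropy PB rB (ptr1 (pull (@zipf k A B) T)) - lin_entropy PAB rAB T.

Definition lgloss : R := lg #|XA|%:R + lg #|XB|%:R + lg #|XAB|%:R.

Lemma mutinf_lin_approx (S : op R (ncopy k A B)) : is_state S -> perm_invariant S ->
  `|mutinf S - mutinf_lin (pull (@unzipf k A B) S)| <= lgloss.
Proof.
move=> sS iS; have zu : pull (@zipf k A B) (pull (@unzipf k A B) S) = S.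
  by apply: op_ext => x y; rewrite /pull !zipfK.
have uS : is_state (pull (@unzipf k A B) S) := is_state_pull (@unzipf_bij k A B) sS.
rewrite /mutinf_lin zu /mutinf /lgloss -(entropy_pull (@unzipf_bij k A B) sS).
have := entropy_lin (ptr2_state sS) hA (fun x => cA x (perm_inv_ptr2 iS)).
have := entropy_lin (ptr1_state sS) hB (fun x => cB x (perm_inv_ptr1_ncopy iS)).
have := entropy_lin uS hAB (fun x => cAB x (perm_inv_unzipf iS)).
rewrite !ler_norml => /andP[h1 h2] /andP[h3 h4] /andP[h5 h6].
by apply/andP; split; lra.
Qed.

Lemma mutinf_lin_sum (K : finType) (p : K -> R) T :
  mutinf_lin (fun f g => \sum_i (p i)%:C * T i f g) = \sum_(i : K) p i * mutinf_lin (T i).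
Proof.
rewrite /mutinf_lin.
have -> : ptr2 (pull (@zipf k A B) (fun f g => \sum_i (p i)%:C * T i f g)) =
   fun f g => \sum_i (p i)%:C * ptr2 (pull (@zipf k A B) (T i)) f g.
  apply: op_ext => f g; rewrite /ptr2 /pull exchange_big.
  by apply: eq_bigr => i _; rewrite mulr_sumr.
have -> : ptr1 (pull (@zipf k A B) (fun f g => \sum_i (p i)%:C * T i f g)) =
   fun f g => \sum_i (p i)%:C * ptr1 (pull (@zipf k A B) (T i)) f g.
  apply: op_ext => f g; rewrite /ptr1 /pull exchange_big.
  by apply: eq_bigr => i _; rewrite mulr_sumr.
rewrite !lin_entropy_sum -big_split -sumrB; apply: eq_bigr => i _ /=.
by rewrite mulrBr mulrDr.
Qed.

Lemma mutinf_lin_cont : exists2 c : R, 0 <= c & forall T T' e,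
  (forall f g, normc (T f g - T' f g) <= e) -> `|mutinf_lin T - mutinf_lin T'| <= c * e.
Proof.
have [c1 c10 h1] := lin_entropy_cont PA rA.
have [c2 c20 h2] := lin_entropy_cont PB rB.
have [c3 c30 h3] := lin_entropy_cont PAB rAB.
pose nA : R := #|{ffun 'I_k -> A}|%:R; pose nB : R := #|{ffun 'I_k -> B}|%:R.
exists (c1 * nB + c2 * nA + c3).
  by rewrite !addr_ge0// mulr_ge0// ler0n.
move=> T T' e he.
have {}h1 := h1 (ptr2 (pull (@zipf k A B) T)) (ptr2 (pull (@zipf k A B) T')) (nB * e).
have {}h2 := h2 (ptr1 (pull (@zipf k A B) T)) (ptr1 (pull (@zipf k A B) T')) (nA * e).
have {}h3 := h3 T T' e he.
have : `|lin_entropy PA rA (ptr2 (pull (@zipf k A B) T)) -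
   lin_entropy PA rA (ptr2 (pull (@zipf k A B) T'))| <= c1 * (nB * e).
  apply: h1 => i j; rewrite /ptr2 -sumrB; apply: le_trans (normc_sum _ _) _.
  by rewrite mulr_natl -sumr_const; apply: ler_sum => x _; apply: he.
have : `|lin_entropy PB rB (ptr1 (pull (@zipf k A B) T)) -
   lin_entropy PB rB (ptr1 (pull (@zipf k A B) T'))| <= c2 * (nA * e).
  apply: h2 => i j; rewrite /ptr1 -sumrB; apply: le_trans (normc_sum _ _) _.
  by rewrite mulr_natl -sumr_const; apply: ler_sum => x _; apply: he.
move: h3; rewrite /mutinf_lin !mulrDl -!mulrA !ler_norml => /andP[? ?] /andP[? ?] /andP[? ?].
by apply/andP; split; lra.
Qed.

(** [A], [B] and [A * B] are cut into the same blocks, so the three block functionals combine into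
    [mutinf_lin] of one marginal. With at least one block the length converts to [k + _], the form
    required by [kmarg_ptr2]. *)
Lemma mutinf_blocks b r (S : op R (ncopy (iter b.+1 (addn k) r) A B)) :
  is_state S -> perm_invariant S ->
  b.+1%:R * mutinf_lin (kmarg k (pull (@unzipf _ A B) S)) - (b.+1%:R * lgloss + r%:R * lgdims A B)
  <= mutinf S.
Proof.
move=> sS iS.
have uS := is_state_pull (@unzipf_bij (iter b.+1 (addn k) r) A B) sS.
rewrite /mutinf_lin -kmarg_ptr2 -kmarg_ptr1_ncopy.
have [YA [QA [sA [gA nA fA lA]]]] := block_resolution r hA cA b.+1.
have [YB [QB [sB [gB nB fB lB]]]] := block_resolution r hB cB b.+1.
have [YAB [QAB [sAB [gAB nAB fAB lAB]]]] := block_resolution r hAB cAB b.+1.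
have h1 := entropy_lin (ptr2_state sS) gA (fun x => fA x _ (perm_inv_ptr2 iS)).
have h2 := entropy_lin (ptr1_state sS) gB (fun x => fB x _ (perm_inv_ptr1_ncopy iS)).
have h3 := entropy_lin uS gAB (fun x => fAB x _ (perm_inv_unzipf iS)).
have c0 (D : finType) : (0 < #|D|)%N -> (0 < #|{ffun 'I_k -> D}|)%N.
  by move=> D0; rewrite card_ffun expn_gt0 D0.
have AB0 : (0 < #|{: A * B}|)%N by rewrite card_prod muln_gt0 A0 B0.
rewrite nA lg_block ?(resolution_card_gt0 (c0 _ A0) hA)// (lA _ (perm_inv_ptr2 iS)) in h1.
rewrite nB lg_block ?(resolution_card_gt0 (c0 _ B0) hB)// (lB _ (perm_inv_ptr1_ncopy iS)) in h2.
rewrite nAB lg_block ?(resolution_card_gt0 (c0 _ AB0) hAB)// (lAB _ (perm_inv_unzipf iS)) in h3.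
rewrite (entropy_pull (@unzipf_bij _ A B) sS) in h3.
move: h1 h2 h3; rewrite /mutinf /lgloss /lgdims !ler_norml.
move=> /andP[h1 h2] /andP[h3 h4] /andP[h5 h6].
lra.
Qed.

End Families.
End MutualInformation.
Arguments tstate {R} n {A B} rho.

(** * Asymptotic bounds and the limit *)

Section Final.
Variable R : realType.
Local Notation C := R[i].
Local Notation lg x := (ln x / ln 2).

Definition dimsq (A B : finType) : nat :=
  (#|A| * #|A| + #|B| * #|B| + #|{: A * B}| * #|{: A * B}|)%N.

(** Interface for the two asymptotic bounds: the projections are hidden, and [F] is known only
    through its loss [V], linearity, Lipschitz continuity and the block inequality. *)
Lemma mutinf_lin_exists (A B : finType) k : (0 < #|A|)%N -> (0 < #|B|)%N ->
  exists (F : op R {ffun 'I_k -> (A * B)%type} -> R) (V : R),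
  [/\ V <= (dimsq A B)%:R * lg k.+1%:R,
   forall S, is_state S -> perm_invariant S -> `|mutinf S - F (pull (@unzipf k A B) S)| <= V,
   forall (K : finType) (p : K -> R) T,
     F (fun f g => \sum_i (p i)%:C * T i f g) = \sum_i p i * F (T i),
   exists2 c : R, 0 <= c & forall T T' e,
     (forall f g, normc (T f g - T' f g) <= e) -> `|F T - F T'| <= c * e &
   forall b r S, is_state S -> perm_invariant S ->
     b.+1%:R * F (kmarg k (pull (@unzipf (iter b.+1 (addn k) r) A B) S))
       - (b.+1%:R * V + r%:R * lgdims R A B) <= mutinf S].
Proof.
move=> A0 B0; have AB0 : (0 < #|{: A * B}|)%N by rewrite card_prod muln_gt0 A0 B0.
have [vA [PA [rA [hA bA cA]]]] := sym_resolution R k A0.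
have [vB [PB [rB [hB bB cB]]]] := sym_resolution R k B0.
have [vAB [PAB [rAB [hAB bAB cAB]]]] := sym_resolution R k AB0.
exists (mutinf_lin PA rA PB rB PAB rAB), (lgloss R 'I_vA 'I_vB 'I_vAB); split.
- have c0 (D : finType) : (0 < #|D|)%N -> (0 < #|{ffun 'I_k -> D}|)%N.
    by move=> D0; rewrite card_ffun expn_gt0 D0.
  have bd (v m : nat) : (0 < v)%N -> (v <= k.+1 ^ m)%N -> lg v%:R <= m%:R * lg k.+1%:R :> R.
    move=> v0 vm; rewrite mulrA ler_pM2r ?invr_gt0 ?ln2_gt0//.
    rewrite mulr_natl -lnXn ?ltr0n// ler_ln ?posrE ?ltr0n ?exprn_gt0 ?ltr0n//.
    by rewrite -natrX ler_nat.
  rewrite /lgloss !card_ord /dimsq !natrD !mulrDl.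
  have := resolution_card_gt0 (c0 _ A0) hA; have := resolution_card_gt0 (c0 _ B0) hB.
  have := resolution_card_gt0 (c0 _ AB0) hAB; rewrite !card_ord => v3 v2 v1.
  by rewrite !lerD// bd.
- by move=> S; apply: mutinf_lin_approx.
- by move=> K p T; apply: mutinf_lin_sum.
- exact: mutinf_lin_cont.
- by move=> b r S; apply: mutinf_blocks.
Qed.

Lemma lnS_sublinear (d : R) : 0 < d ->
  exists k0, forall k, (k0 <= k)%N -> ln k.+1%:R <= d * k%:R.
Proof.
(* Since [ln x = 2 * ln (sqrt x) <= 2 * sqrt x], it is enough that [4 * k.+1 <= d ^ 2 * k ^ 2]; as
   [k.+1 <= 2 * k], this holds once [k >= 8 / d ^ 2]. *)
move=> d0; exists (Num.bound (8 / d ^+ 2)).+1 => k hk.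
have k1 : (1 <= k)%N by apply: leq_trans hk.
have kR : 8 / d ^+ 2 <= k%:R.
  apply: le_trans (ltW (archi_boundP _)) _; first by rewrite divr_ge0 ?exprn_ge0// ltW.
  by rewrite ler_nat ltnW.
set x : R := k.+1%:R; have x0 : 0 < x by rewrite ltr0n.
have sx : 0 < Num.sqrt x by rewrite sqrtr_gt0.
have -> : ln x = 2 * ln (Num.sqrt x).
  by rewrite -[in LHS](sqr_sqrtr (ltW x0)) lnXn// mulr_natl.
have h1 := ltW (ln_sublinear sx).
have h2 : 2 * Num.sqrt x <= d * k%:R.
  rewrite -ler_sqr ?nnegrE ?mulr_ge0 ?sqrtr_ge0 ?ler0n ?(ltW d0)//.
  rewrite !exprMn (sqr_sqrtr (ltW x0)).
  have : x <= 2 * k%:R by rewrite -natrM ler_nat mul2n -addnn -addn1 leq_add2l.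
  have : 8 * k%:R <= d ^+ 2 * k%:R ^+ 2.
    rewrite [k%:R ^+ 2]expr2 mulrA ler_wpM2r// -ler_pdivrMl ?exprn_gt0// mulrC.
    by [].
  lra.
lra.
Qed.

Lemma upd_unzipf n (A B : finType) (f : {ffun 'I_n -> (A * B)%type}) k (c : A * B) :
  (upd (unzipf f).1 k c.1, upd (unzipf f).2 k c.2) = unzipf (upd f k c).
Proof. by congr (_, _); apply/ffunP => i; rewrite !ffunE; case: eqP. Qed.

Lemma marg_kE n (A B : finType) (S : op R (ncopy n A B)) k c c' :
  marg_k S k c c' =
  \sum_(f : {ffun 'I_n -> (A * B)%type}) (f k == c)%:R * pull (@unzipf n A B) S f (upd f k c').
Proof.
rewrite /marg_k big_mkcond (reindex _ (onW_bij _ (@unzipf_bij n A B))).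
apply: eq_bigr => f _; rewrite upd_unzipf !ffunE.
have -> : ((f k).1 == c.1) && ((f k).2 == c.2) = (f k == c).
  by case: (f k) c => ? ? [? ?]; rewrite xpair_eqE.
by case: eqP; rewrite ?mul1r ?mul0r.
Qed.

Lemma marg_k_tstate n (A B : finType) (rho : op R (A * B)%type) k :
  is_state rho -> marg_k (tstate n rho) k = rho.
Proof.
move=> [_ tr]; apply: op_ext => c c'; rewrite marg_kE.
transitivity (\prod_(i < n) \sum_x (if i == k then (x == c)%:R * rho x c' else rho x x)).
  rewrite bigA_distr_bigA; apply: eq_bigr => f _.
  rewrite /tstate /pull !unzipfK /tpow (bigD1 k)//= [RHS](bigD1 k)//= eqxx ffunE eqxx mulrA.
  by congr (_ * _); apply: eq_bigr => i /negPf ik; rewrite ik ffunE ik.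
rewrite (bigD1 k)//= eqxx [X in _ * X]big1 ?mulr1 => [|i /negPf -> //].
by under eq_bigr do rewrite mulrC; rewrite (sum_delta c (fun x => rho x c')).
Qed.

Lemma marg_k_Lam n (A B : finType) (S : op R (ncopy n.+1 A B)) c c' :
  Lam (pull (@unzipf n.+1 A B) S) [:: mxunit R c' c] = marg_k S ord0 c c'.
Proof.
rewrite marg_kE /Lam; apply: eq_bigr => F _.
rewrite -[RHS]mulrC -[RHS](_ : \sum_G pull (@unzipf _ A B) S F G * (F ord0 == c)%:R * (G == upd F ord0 c')%:R = _).
  apply: eq_bigr => G _; rewrite -mulrA; congr (_ * _).
  rewrite -prod_delta !big_ord_recl /= mulrA; congr (_ * _).
    rewrite /mxunit /id_op ffunE eqxx.
    by case: eqP => _; case: eqP => _; rewrite /= ?(mulr1, mulr0, mul0r).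
  by apply: eq_bigr => i _; rewrite nth_nil ffunE.
by rewrite (sum_delta _ (fun G => pull (@unzipf _ A B) S F G * (F ord0 == c)%:R)).
Qed.

Definition mixture n (A B : finType) m (p : 'I_m -> R) (rk : 'I_m -> op R (A * B)%type) :
  op R (ncopy n A B) := fun x y => \sum_k (p k)%:C * tstate n (rk k) x y.

Arguments mixture n {A B m} p rk.

Lemma mixture_broadcast n (A B : finType) (rho : op R (A * B)%type) m
    (p : 'I_m -> R) (rk : 'I_m -> op R (A * B)%type) : is_cq_decomp rho p rk ->
  perm_invariant (mixture n p rk) /\ is_broadcast rho (mixture n p rk).
Proof.
move=> [p0 p1 srk e]; split.
  by move=> q x y; apply: eq_bigr => k _; rewrite tstate_perm.
split; first split.
- by apply: psd_sum => // k; have [] := tstate_state n (srk k).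
- rewrite /trace /mixture exchange_big -[RHS]/(1%:C) -p1 sum_real_complex.
  apply: eq_bigr => k _; rewrite -mulr_sumr -/(trace _).
  by have [_ ->] := tstate_state n (srk k); rewrite mulr1.
move=> k; apply: op_ext => c c'; rewrite -e /marg_k /mixture exchange_big.
apply: eq_bigr => i _; rewrite -mulr_sumr; congr (_ * _).
by have := marg_k_tstate k (srk i); move=> /(congr1 (fun X => X c c')).
Qed.

Lemma Ib_sym_le n (A B : finType) (rho : op R (A * B)%type) (S : op R (ncopy n A B)) :
  perm_invariant S -> is_broadcast rho S -> Ib_sym_n rho n <= mutinf S.
Proof.
move=> h1 h2; apply: ge_inf; last by exists S.
by exists (- lgdims R {ffun 'I_n -> A} {ffun 'I_n -> B}) => _ [S' [_ [sS' _]] <-]; apply: mutinf_lb.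
Qed.

Lemma Ib_sym_ge n (A B : finType) (rho : op R (A * B)%type) x : is_state rho ->
  (forall S : op R (ncopy n A B), perm_invariant S -> is_broadcast rho S -> x <= mutinf S) ->
  x <= Ib_sym_n rho n.
Proof.
move=> sr h; apply: lb_le_inf; last by move=> _ [S [h1 h2] <-]; apply: h.
(* The tensor power of [rho], seen as a mixture with one term, shows that the infimum is over a
   nonempty set. *)
exists (mutinf (mixture n (fun _ : 'I_1 => 1) (fun _ : 'I_1 => rho))).
exists (mixture n (fun _ : 'I_1 => 1) (fun _ : 'I_1 => rho)) => //.
by apply: mixture_broadcast; split=> //; [rewrite big_ord1|move=> c c'; rewrite big_ord1 mul1r].
Qed.

Lemma lgdims_ge0 (A B : finType) : (0 < #|A|)%N -> (0 < #|B|)%N -> 0 <= lgdims R A B.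
Proof.
move=> A0 B0; have AB0 : (0 < #|{: A * B}|)%N by rewrite card_prod muln_gt0 A0 B0.
by rewrite /lgdims !addr_ge0// divr_ge0 ?ln_ge0 ?ler1n//.
Qed.

Lemma iter_addn b k r : iter b (addn k) r = (b * k + r)%N.
Proof. by elim: b => //= b ->; rewrite mulSn addnA. Qed.

Section Limit.
Variables (A B : finType) (rho : op R (A * B)%type).
Hypothesis sr : is_state rho.

Lemma dims_gt0 : (0 < #|A|)%N /\ (0 < #|B|)%N.
Proof.
have : (0 < #|{: A * B}|)%N.
  rewrite lt0n; apply/negP => /eqP/card0_eq h; case: sr => _.
  rewrite /trace big1 => [/eqP|x _]; last by have := h x.
  by rewrite eq_sym oner_eq0.
by rewrite card_prod muln_gt0 => /andP.
Qed.

Lemma dimsq_lnS (e : R) : 0 < e ->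
  exists k0, forall k, (k0 <= k)%N -> (dimsq A B)%:R * lg k.+1%:R <= e * k%:R.
Proof.
move=> e0; set L : R := (dimsq A B)%:R.
have L1 : 0 < L + 1 by rewrite ltr_wpDl ?ler0n.
have d0 : 0 < e * ln 2 / (L + 1) by rewrite divr_gt0// mulr_gt0// ln2_gt0.
have [k0 hk0] := lnS_sublinear d0; exists k0 => k /hk0 h.
have l0 : 0 <= ln k.+1%:R :> R by rewrite ln_ge0// ler1n.
rewrite mulrA ler_pdivrMr ?ln2_gt0//; apply: (@le_trans _ _ ((L + 1) * ln k.+1%:R)).
  by rewrite ler_wpM2r// lerDl.
have -> : e * k%:R * ln 2 = (L + 1) * (e * ln 2 / (L + 1) * k%:R).
  by field; rewrite gt_eqF.
by rewrite ler_pM2l.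
Qed.

Lemma Ib_sym_upper (e : R) : 0 < e ->
  exists N, forall n, (N <= n)%N -> Ib_sym_n rho n <= n%:R * (2 * Esq_C rho + e).
Proof.
move=> e0; have [A0 B0] := dims_gt0.
have e2 : 0 < e / 2 by rewrite divr_gt0.
(* The loss [V] is paid twice, for the mixture and for its product components; [e / 2] covers this
   and the other half the near-optimal decomposition. *)
have e4 : 0 < e / 4 by rewrite divr_gt0.
have [m [p [rk [D hD]]]] := Esq_C_approx sr e2.
have [N hN] := dimsq_lnS e4; exists N => n /hN hn.
have [pm [sm bm]] := mixture_broadcast n D.
have [p0 p1 srk _] := D.
apply: le_trans (Ib_sym_le pm (conj sm bm)) _.
have [F [V [hV hF Fsum _ _]]] := mutinf_lin_exists n A0 B0.
have h1 := hF _ sm pm.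
have eF : F (pull (@unzipf n A B) (mixture n p rk)) =
    \sum_k p k * F (pull (@unzipf n A B) (tstate n (rk k))) by rewrite -Fsum.
have h2 : \sum_k p k * F (pull (@unzipf n A B) (tstate n (rk k))) <=
    \sum_k p k * (n%:R * mutinf (rk k) + V).
  apply: ler_sum => k _; rewrite ler_wpM2l//.
  have := hF _ (tstate_state n (srk k)) (@tstate_perm _ n _ _ (rk k)).
  by rewrite mutinf_tstate// ler_norml => /andP[? ?]; lra.
have e3 : \sum_k p k * (n%:R * mutinf (rk k) + V) = n%:R * (\sum_k p k * mutinf (rk k)) + V.
  under eq_bigr do rewrite mulrDr mulrCA.
  by rewrite big_split /= -mulr_sumr -mulr_suml p1 mul1r.
have h4 : n%:R * (\sum_k p k * mutinf (rk k)) <= n%:R * (2 * Esq_C rho + e / 2).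
  by rewrite ler_wpM2l// ltW.
move: h1; rewrite eF ler_norml => /andP[_ h1].
rewrite e3 in h2; move: hV hn h4; rewrite !mulrDr; lra.
Qed.

Lemma Ib_sym_lower (e : R) : 0 < e ->
  exists N, forall n, (N <= n)%N -> n%:R * (2 * Esq_C rho - e) <= Ib_sym_n rho n.
Proof.
move=> e0; have [A0 B0] := dims_gt0.
have AB0 : (0 < #|{: A * B}|)%N by rewrite card_prod muln_gt0 A0 B0.
(* Budget of [e / 3] per copy each: two losses [V] of at most [e / 6 * k] per block, the de Finetti
   error, and the leftover copies. *)
have e6 : 0 < e / 6 by rewrite divr_gt0.
have [k k1 hk] : exists2 k, (0 < k)%N & (dimsq A B)%:R * lg k.+1%:R <= e / 6 * k%:R.
  by have [k0 hk0] := dimsq_lnS e6; exists (maxn k0 1); [rewrite leq_max orbT|rewrite hk0 ?leq_maxl].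
have kR : 0 < k%:R :> R by rewrite ltr0n.
have [F [V [hV hF Fsum [c c0 Fcont] Fblock]]] := mutinf_lin_exists k A0 B0.
have c1 : 0 < c + 1 by rewrite ltr_wpDl.
pose e' := e / 3 * k%:R / (c + 1).
have e'0 : 0 < e' by rewrite !mulr_gt0// invr_gt0.
have [N1 hN1] := de_finetti k AB0 e'0.
set x := 2 * Esq_C rho.
(* For [n >= Q] the fewer than [k] leftover copies fit into the last [e / 3]; the absolute value is
   there because [x - 2 * e / 3] may be negative. *)
pose Q := k%:R * (`|x - 2 * e / 3| + lgdims R A B) / (e / 3).
pose N2 := Num.bound Q.
exists (maxn k (maxn N1 N2)) => n; rewrite !geq_max => /and3P[kn N1n N2n].
apply: Ib_sym_ge => // S pS bS.
have [b [r [rk en]]] : exists b r, (r < k)%N /\ n = iter b.+1 (addn k) r.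
  (* Blocks are counted as [b.+1], whence the predecessor; [k <= n] provides at least one. *)
  exists (n %/ k).-1, (n %% k)%N; rewrite ltn_mod k1; split=> //.
  by rewrite prednK ?divn_gt0// iter_addn -divn_eq.
have nE : n%:R = b.+1%:R * k%:R + r%:R :> R by rewrite en iter_addn natrD natrM.
have Qn : Q <= n%:R.
  apply: le_trans (ltW (archi_boundP _)) _; last by rewrite ler_nat.
  apply: divr_ge0; last by apply/ltW/divr_gt0.
  by rewrite mulr_ge0// addr_ge0// lgdims_ge0.
have [sS mS] := bS.
have [m [p [s [p0 p1 ss s1 sk]]]] :=
  hN1 n N1n _ (is_state_pull (@unzipf_bij n A B) sS) (perm_inv_unzipf pS).
(* The one-copy marginal of the de Finetti mixture is exactly [rho], so [Esq_C] of [rho] itself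
   bounds its average mutual information. *)
have D : is_cq_decomp rho p s.
  split=> // a a'; rewrite s1.
  have : (0 < n)%N by apply: leq_trans kn.
  case: (n) S {pS bS sS sk s1 en nE Qn kn N1n N2n} mS => // n' S mS _.
  by rewrite marg_k_Lam mS.
have hE := Esq_C_le D; rewrite -/x in hE.
have hF1 : \sum_i p i * (k%:R * mutinf (s i) - V) <=
    F (fun f g => \sum_i (p i)%:C * tpow k (s i) f g).
  rewrite Fsum; apply: ler_sum => i _; rewrite ler_wpM2l//.
  have := hF _ (tstate_state k (ss i)) (@tstate_perm _ k _ _ (s i)).
  have -> : pull (@unzipf k A B) (tstate k (s i)) = tpow k (s i).
    by apply: op_ext => f g; rewrite /tstate /pull !unzipfK.
  by rewrite mutinf_tstate// ler_norml => /andP[? ?]; lra.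
have e3 : \sum_i p i * (k%:R * mutinf (s i) - V) = k%:R * (\sum_i p i * mutinf (s i)) - V.
  under eq_bigr do rewrite mulrBr mulrCA.
  by rewrite sumrB -mulr_sumr -mulr_suml p1 mul1r.
have hF2 := Fcont _ _ _ sk.
have ce' : c * e' <= e / 3 * k%:R.
  have e3k : 0 < e / 3 * k%:R by rewrite mulr_gt0// divr_gt0.
  by rewrite /e' mulrCA (ger_pMr _ e3k) ler_pdivrMr// mul1r lerDl.
have hkE : k%:R * x <= k%:R * \sum_i p i * mutinf (s i) by rewrite ler_wpM2l// ltW.
have hF3 : k%:R * (x - 2 * e / 3) <= F (kmarg k (pull (@unzipf n A B) S)) - V.
  rewrite e3 in hF1; move: hF2; rewrite ler_norml => /andP[hF2 _].
  rewrite mulrBr; move: hV hk; lra.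
have hb : b.+1%:R * F (kmarg k (pull (@unzipf n A B) S)) -
    (b.+1%:R * V + r%:R * lgdims R A B) <= mutinf S.
  (* The type of [S] depends on [n], so the equation for [n] is eliminated with [S] generalized. *)
  by case: _ / (esym en) S sS pS {bS mS sk s1 hF2 hF3} => S sS pS; apply: Fblock.
apply: le_trans hb.
have b1 : 0 <= b.+1%:R :> R by [].
have h5 := ler_wpM2l b1 hF3.
have rk' : r%:R <= k%:R :> R by rewrite ler_nat ltnW.
have r0 : 0 <= r%:R :> R by [].
have h6 : r%:R * (x - 2 * e / 3) <= k%:R * `|x - 2 * e / 3|.
  apply: le_trans (ler_norm _) _; rewrite normrM ger0_norm//.
  by rewrite ler_wpM2r.
have h7 : r%:R * lgdims R A B <= k%:R * lgdims R A B by rewrite ler_wpM2r// lgdims_ge0.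
have h8 : k%:R * (`|x - 2 * e / 3| + lgdims R A B) <= n%:R * (e / 3).
  by rewrite -ler_pdivrMr// divr_gt0.
move: h5 h6 h7 h8; rewrite !mulrBr !mulrDr !mulrDl nE.
move: (lgdims R A B) (`|_|) (F _) => u w t; rewrite !mulrDl !mulrA; lra.
Qed.

End Limit.
End Final.

Theorem theorem4 (R : realType) (A B : finType) (rho : op R (A * B)%type) :
  is_state rho ->
  (fun n : nat => Ib_sym_n rho n.+1 / n.+1%:R) @ \oo --> 2 * Esq_C rho.
Proof.
move=> sr; apply/cvgrPdist_le => e e0.
have [N1 h1] := Ib_sym_upper sr e0; have [N2 h2] := Ib_sym_lower sr e0.
exists (maxn N1 N2) => // n /=; rewrite geq_max => /andP[n1 n2].
have {}h1 := h1 n.+1 (leqW n1); have {}h2 := h2 n.+1 (leqW n2).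
have n0 : 0 < n.+1%:R :> R by rewrite ltr0n.
rewrite ler_distlC; apply/andP; split.
  by rewrite ler_pdivlMr// mulrC.
by rewrite ler_pdivrMr// mulrC.
Qed.
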